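(* Let $D\subseteq\mathbb{C}^2$ be a pseudoconvex domain with smooth boundary $M$, let $p\in M$ be a point of finite type $k$ with $k>2$, let $\mu$ be the weight of the complex nontangential direction at $p$, and let $P(z,\bar z,u)$ be the polynomial defining a generalized model $v=P(z,\bar z,u)$ to $M$ at $p$ (in fixed local holomorphic coordinates corresponding to the weight vector $(\frac1k,\mu)$). If there exists $h\in\mathbb{H}_{k,\mu}$ such that $$D^2_z(P+h)(z,u;\zeta)>0\quad\text{for all }\big((z,u),\zeta\big)\in S_2\times S_1,$$ then $M$ is locally convexifiable at $p$.
   Context: **Coordinates and type.** The type of $p\in M$ is the maximal order of contact of $M$ with complex curves passing through $p$. Here $k>2$ is the (finite) type of $p$; by pseudoconvexity $k$ is even. Local holomorphic coordinates $(z,w)$, $z=x+iy$, $w=u+iv$, are centered at $p$ and chosen so that the positive $v$-axis is the inner normal direction to $D$ at $p$; near $p$, $M$ is given by $v=F(z,\bar z,u)$. Such coordinates can be chosen so that $v=P_1(z,\bar z)+o(|z|^k,u)$, where $P_1$ is a real-valued homogeneous polynomial of degree $k$ of the form $P_1(z,\bar z)=a_0|z|^k+\sum_{j=2,\dots,k}|z|^{k-j}\,\mathrm{Re}(a_jz^j)$ with $a_j\in\mathbb{C}$ and $a_0>0$. **Weights.** A weight vector is a pair of rational numbers $\lambda=(\lambda_1,\lambda_2)$, with $\lambda_2>0$, such that $\lambda_1=\frac1n$ for some $n\in\mathbb{N}$ and there exist integers $k_1\ge 0$, $k_2>0$ with $k_1\lambda_1+k_2\lambda_2=1$. The monomial $c\,z^i\bar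 z^ju^l$ has weight $(i+j)\lambda_1+l\lambda_2$. A real-valued polynomial in $z,\bar z,u$ is $\lambda$-homogeneous of weight $\gamma$ if it is a sum of monomials of weight $\gamma$; the same weight assignment and notion of homogeneity are used for $\lambda=(\frac1k,0)$. A weight vector $(\frac1k,\lambda_2)$ is allowable if there are local holomorphic coordinates $(z,w)$, $z=x+iy$, $w=u+iv$, centered at $p$ and with the positive $v$-axis being the inner normal direction to $D$ at $p$, in which the defining equation has the form $v=P(z,\bar z,u)+o_{wt}(1)$, where $$P(z,\bar z,u)=\sum_{\frac mk+\lambda_2l=1}\ \sum_{j=0}^m a_{mjl}z^j\bar z^{m-j}u^l$$ is $\lambda$-homogeneous of weight one and $o_{wt}(1)$ denotes terms (in the Taylor expansion) of weight bigger than one with respect to $(\frac1k,\lambda_2)$. For any $\delta>0$ only finitely many $\lambda_2>\delta$ make $(\frac1k,\lambda_2)$ a weight vector. If the set of allowable values of $\lambda_2$ is finite, $\mu$ is the smallest of them; if this set is not bounded away from zero, $\mu=0$. The number $\mu$ is the weight of $w$ and $u$. **Generalized model.** If $\mu>0$, fix local holomorphic coordinates in which the defining equation is $v=P(z,\bar z,u)+o_{wt}(1)$, with $P(z,\bar z,u)=\sum_{\frac mk+\mu l=1}\ \sum_{j=0}^m a_{mjl}z^j\bar z^{m-j}u^l$ and $o_{wt}(1)$ denoting terms of weight bigger than one with respect to $(\frac1k,\mu)$; the hypersurface $v=P(z,\bar z,u)$ is a generalized model to $M$ at $p$. If $\mu=0$, a generalized model is $v=P_1(z,\bar z)$, i.e.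 $P=P_1$. **The space $\mathbb{H}_{k,\mu}$.** $\mathbb{H}_{k,\mu}$ is the set of all real-valued $(\frac1k,\mu)$-homogeneous polynomials in $z,u$ (i.e. in $z,\bar z,u$) of weight one that are harmonic in the $z$ variable (for $\mu>0$: those of the form $\mathrm{Re}\sum_{\frac mk+\mu l=1}\alpha_mz^mu^l$, $\alpha_m\in\mathbb{C}$). **Hessian in the $z$-direction.** For $(z,u)\in\mathbb{C}\times\mathbb{R}$, $\zeta\in\mathbb{C}$, $z=x_1+ix_2$, $\zeta=\xi_1+i\xi_2$, set $$D^2_zP(z,u;\zeta)=\sum_{i,j=1}^2\frac{\partial^2P}{\partial x_i\partial x_j}(z,u)\,\xi_i\xi_j.$$ Also $S_2=\{(z,u)\in\mathbb{C}\times\mathbb{R}:|z|^2+u^2=1\}$ and $S_1=\{\zeta\in\mathbb{C}:|\zeta|=1\}$. **Local convexifiability.** $M$ is locally convexifiable at $p$ if there exist local holomorphic coordinates in a full neighbourhood of $p$ such that $M$ is convex with respect to the underlying linear space. *)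

(* Defs.v *)
From HB Require Import structures.
From mathcomp Require Import all_boot all_order all_algebra complex.
From mathcomp Require Import all_classical all_reals all_analysis.
Set Implicit Arguments.
Unset Strict Implicit.
Unset Printing Implicit Defensive.
Import Order.TTheory GRing.Theory Num.Theory numFieldNormedType.Exports.
Local Open Scope classical_set_scope.
Local Open Scope ring_scope.
Local Open Scope complex_scope.

(* [R[i]] packed as a [numClosedFieldType], so that it carries the normed
   topology of a number field.  Differentiability of maps between [Cx R] and
   [C2 R] is over the scalar field [Cx R], i.e. complex differentiability. *)
Definition Cx (R : realType) : numClosedFieldType := R[i].
Definition C2 (R : realType) : normedModType (Cx R) := (Cx R * Cx R)%type.

(* (x, y, u) with z = x + iy and w = u + iv *)
Definition R3 (R : realType) : normedModType R := (R * R * R)%type.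
(* ((x, y), (u, v)) *)
Definition R4 (R : realType) : normedModType R := ((R * R) * (R * R))%type.

Section Coordinates.
Variable R : realType.

Definition pt3 (x y u : R) : R3 R := (x, y, u).
Definition pt4 (x y u v : R) : R4 R := ((x, y), (u, v)).

Definition cplx_of_real (a : R4 R) : C2 R :=
  (a.1.1 +i* a.1.2, a.2.1 +i* a.2.2).
Definition real_of_cplx (q : C2 R) : R4 R :=
  pt4 (complex.Re q.1) (complex.Im q.1) (complex.Re q.2) (complex.Im q.2).

Definition zu (q : C2 R) : R3 R :=
  pt3 (complex.Re q.1) (complex.Im q.1) (complex.Re q.2).
Definition vv (q : C2 R) : R := complex.Im q.2.

End Coordinates.

Section Smoothness.
Variables (R : realType) (V : normedModType R).

Definition iterD (vs : seq V) (f : V -> R) : V -> R :=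
  foldr (fun v g => 'D_v g) f vs.

(* C^oo on the open set [A]: every iterated directional derivative is
   differentiable, hence continuous, on [A]. *)
Definition smooth_on (A : set V) (f : V -> R) : Prop :=
  forall (vs : seq V) (a : V), A a -> differentiable (iterD vs f) a.

End Smoothness.

Section Domains.
Variable R : realType.
Implicit Types (D U V : set (C2 R)) (p q : C2 R) (r : C2 R -> R).

Definition bdry D : set (C2 R) := closure D `\` interior D.

Definition domain D : Prop := open D /\ connected D.

Definition defining_function D U r : Prop :=
  [/\ open U,
      smooth_on [set a | U (cplx_of_real a)] (r \o @cplx_of_real R),
      forall q, U q -> (D q <-> r q < 0),
      forall q, U q -> (bdry D q <-> r q = 0)
    & forall q, U q -> bdry D q ->
        exists e : R4 R, 'D_e (r \o @cplx_of_real R) (real_of_cplx q) != 0].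

Definition smooth_boundary D : Prop :=
  forall q, bdry D q -> exists U r, U q /\ defining_function D U r.

Definition xdir (j : 'I_2) : R4 R :=
  if j == ord0 then pt4 1 0 0 0 else pt4 0 0 1 0.
Definition ydir (j : 'I_2) : R4 R :=
  if j == ord0 then pt4 0 1 0 0 else pt4 0 0 0 1.

Definition cderive (g : R4 R -> Cx R) (e a : R4 R) : Cx R :=
  'D_e (fun b => complex.Re (g b)) a +i* 'D_e (fun b => complex.Im (g b)) a.

Definition d_z (j : 'I_2) (g : R4 R -> Cx R) (a : R4 R) : Cx R :=
  (cderive g (xdir j) a - 'i * cderive g (ydir j) a) / 2.
Definition d_zbar (j : 'I_2) (g : R4 R -> Cx R) (a : R4 R) : Cx R :=
  (cderive g (xdir j) a + 'i * cderive g (ydir j) a) / 2.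

Definition realC r (a : R4 R) : Cx R := (r (cplx_of_real a))%:C.

Definition complex_tangent r q (t : 'I_2 -> Cx R) : Prop :=
  \sum_(j < 2) d_z j (realC r) (real_of_cplx q) * t j = 0.

Definition levi_form r q (t : 'I_2 -> Cx R) : Cx R :=
  \sum_(i < 2) \sum_(j < 2)
    d_z i (d_zbar j (realC r)) (real_of_cplx q) * t i * (t j)^*.

(* Levi's condition; [0 <= z] in [Cx R] says that z is real and nonnegative. *)
Definition pseudoconvex D : Prop :=
  forall q U r, bdry D q -> U q -> defining_function D U r ->
  forall t, complex_tangent r q t -> 0 <= levi_form r q t.

End Domains.

Section FiniteType.
Variable R : realType.
Implicit Types (D : set (C2 R)) (p : C2 R) (gamma : Cx R -> C2 R).

(* f(t) = O(|t|^n) as t -> 0 *)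
Definition vanishes_to (W : normedModType (Cx R)) (f : Cx R -> W) (n : nat) :
  Prop := exists c : Cx R, \forall t \near (0 : Cx R), `|f t| <= c * `|t| ^+ n.

(* germ at p of a complex curve, parametrized with multiplicity m; singular
   curves (m > 1) are allowed *)
Definition curve_at p gamma (m : nat) : Prop :=
  [/\ gamma 0 = p,
      \forall t \near (0 : Cx R), differentiable gamma t,
      vanishes_to (fun t => gamma t - p) m
    & ~ vanishes_to (fun t => gamma t - p) m.+1].

(* The order of contact of the curve gamma with {r = 0} is the ratio of the
   vanishing orders of r o gamma and of gamma - p. *)
Definition has_type D p (k : nat) : Prop :=
  exists U r, [/\ U p, defining_function D U r,
    exists gamma m, curve_at p gamma m /\
      vanishes_to (fun t => (r (gamma t))%:C : Cx R) (k * m)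
  & forall gamma m, curve_at p gamma m ->
      ~ vanishes_to (fun t => (r (gamma t))%:C : Cx R) (k * m).+1].

End FiniteType.

Section HolomorphicCoordinates.
Variable R : realType.
Implicit Types (D U : set (C2 R)) (p : C2 R) (Phi : C2 R -> C2 R).

(* Phi maps U biholomorphically onto an open set. *)
Definition biholomorphic_on U Phi : Prop :=
  [/\ open U, open (Phi @` U),
      forall q, U q -> differentiable Phi q
    & exists Psi : C2 R -> C2 R,
        (forall q, U q -> Psi (Phi q) = q) /\
        (forall q, (Phi @` U) q -> differentiable Psi q)].

Definition local_coordinates p U Phi : Prop := U p /\ biholomorphic_on U Phi.

(* Coordinates centered at p in which D and its boundary are v > F(z, u) and
   v = F(z, u); as dF(0) = 0, the positive v-axis is the inner normal
   direction to D at p. *)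
Definition graph_coordinates D p U Phi (F : R3 R -> R) : Prop :=
  [/\ local_coordinates p U Phi /\ Phi p = 0,
      smooth_on (@zu R @` (Phi @` U)) F,
      forall e, 'D_e F 0 = 0,
      forall q, U q -> (D q <-> F (zu (Phi q)) < vv (Phi q))
    & forall q, U q -> (bdry D q <-> vv (Phi q) = F (zu (Phi q)))].

Definition locally_convexifiable D p : Prop :=
  exists U Phi, local_coordinates p U Phi /\
    convex_set (@real_of_cplx R @` (Phi @` (D `&` U))).

End HolomorphicCoordinates.

Section Weights.
Variable R : realType.
Implicit Types (D : set (C2 R)) (p : C2 R) (P F h : R3 R -> R).

Definition weight_vector (lam1 lam2 : rat) : Prop :=
  [/\ 0 < lam2, exists n : nat, (0 < n)%N /\ lam1 = n%:R^-1
    & exists k1 k2 : nat, (0 < k2)%N /\ k1%:R * lam1 + k2%:R * lam2 = 1].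

(* Weight of z^i zbar^j u^l with m = i + j; also that of x^i y^j u^l. *)
Definition weight (lam1 lam2 : rat) (m l : nat) : rat :=
  m%:R * lam1 + l%:R * lam2.

(* Real-valued polynomial functions which are sums of monomials
   a_ijl z^i zbar^j u^l of weight g. *)
Definition homogeneous (lam1 lam2 g : rat) P : Prop :=
  exists (N : nat) (a : nat -> nat -> nat -> Cx R),
    (forall i j l, a i j l != 0 -> weight lam1 lam2 (i + j) l = g) /\
    forall x y u : R, (P (pt3 x y u))%:C =
      \sum_(i < N) \sum_(j < N) \sum_(l < N)
        a i j l * (x +i* y) ^+ i * ((x +i* y)^* ) ^+ j * u%:C ^+ l.

Definition ex : R3 R := pt3 1 0 0.
Definition ey : R3 R := pt3 0 1 0.
Definition eu : R3 R := pt3 0 0 1.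

(* f = o_wt(1): its Taylor expansion at 0 only has terms of weight > 1. *)
Definition o_wt (lam1 lam2 : rat) (f : R3 R -> R) : Prop :=
  forall i j l : nat, weight lam1 lam2 (i + j) l <= 1 ->
    iterD (nseq i ex ++ nseq j ey ++ nseq l eu) f 0 = 0.

Definition model_coordinates D p (lam1 lam2 : rat) P : Prop :=
  exists U Phi F, [/\ graph_coordinates D p U Phi F,
    homogeneous lam1 lam2 1 P & o_wt lam1 lam2 (fun a => F a - P a)].

Definition allowable D p (k : nat) : set rat :=
  [set lam | weight_vector k%:R^-1 lam /\
             exists P, model_coordinates D p k%:R^-1 lam P].

Definition is_mu D p (k : nat) (mu : rat) : Prop :=
  [/\ finite_set (allowable D p k), allowable D p k mu
    & forall lam, allowable D p k lam -> mu <= lam] \/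
  mu = 0 /\ forall d : rat, 0 < d ->
    exists lam, allowable D p k lam /\ lam < d.

(* P1 = a_0 |z|^k + sum_(j = 2, ..., k) |z|^(k-j) Re (a_j z^j), a_0 > 0;
   being a polynomial forces the terms with k - j odd to vanish. *)
Definition leading_polynomial (k : nat) (P1 : R3 R -> R) : Prop :=
  homogeneous k%:R^-1 0 1 P1 /\
  exists (a0 : R) (a : nat -> Cx R), 0 < a0 /\
    forall x y u : R, P1 (pt3 x y u) =
      a0 * Num.sqrt (x ^+ 2 + y ^+ 2) ^+ k +
      \sum_(2 <= j < k.+1) Num.sqrt (x ^+ 2 + y ^+ 2) ^+ (k - j) *
        complex.Re (a j * (x +i* y : Cx R) ^+ j).

Definition leading_coordinates D p (k : nat) (P1 : R3 R -> R) : Prop :=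
  exists U Phi F, [/\ graph_coordinates D p U Phi F, leading_polynomial k P1
    & (fun a => F a - P1 a) =o_ (0 : R3 R)
      (fun a => Num.sqrt (a.1.1 ^+ 2 + a.1.2 ^+ 2) ^+ k + `|a.2|)].

Definition generalized_model D p (k : nat) (mu : rat) P : Prop :=
  (0 < mu -> model_coordinates D p k%:R^-1 mu P) /\
  (mu = 0 -> leading_coordinates D p k P).

Definition Hspace (k : nat) (mu : rat) : set (R3 R -> R) :=
  [set h | homogeneous k%:R^-1 mu 1 h /\
           forall a, 'D_ex ('D_ex h) a + 'D_ey ('D_ey h) a = 0].

Definition zdir (i : 'I_2) : R3 R := if i == ord0 then ex else ey.

Definition D2z P (a : R3 R) (xi : 'I_2 -> R) : R :=
  \sum_(i < 2) \sum_(j < 2) 'D_(zdir i) ('D_(zdir j) P) a * xi i * xi j.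

End Weights.

(* Main.v *)
Require Import Defs.
From HB Require Import structures.
From mathcomp Require Import all_boot all_order all_algebra complex.
From mathcomp Require Import all_classical all_reals all_analysis.
From mathcomp Require Import ring lra zify.
Set Implicit Arguments.
Unset Strict Implicit.
Unset Printing Implicit Defensive.
Import Order.TTheory GRing.Theory Num.Theory numFieldNormedType.Exports.
Import Normc.
Local Open Scope classical_set_scope.
Local Open Scope ring_scope.
Local Open Scope complex_scope.
(* [ssrnat] exports a lemma of the same name. *)
Local Notation iterD := Defs.iterD.

(** The hypothesis makes P + h strongly convex in z away from the origin, but only in
z, and only after adding the harmonic polynomial h.  One holomorphic change of
coordinates repairs both defects.

Write h(z, u) = Re q(z, u) with q a holomorphic polynomial in (z, w), weighted
homogeneous of weight one ([harmonic_Re]), put Q = q + w^2 and replace (z, w) by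
the coordinates whose inverse is the shear (z, w) |-> (z, w - i Q(z, w)).  In the
new coordinates D is given by rr < 0, where, with w = u + iv,
    rr(z, w) = F(z, u + Im Q(z, w)) + Re Q(z, w) - v.
The term Re q restores h, and Re w^2 = u^2 - v^2 provides convexity in u.

Let s be the weighted distance of the point (z, u + Im Q) to the origin, and consider
the second derivative of rr in a complex direction (zeta, om).  The Hessian of P + h
contributes at least c X^2, where X is |zeta| times the power of s that homogeneity
dictates, and w^2 contributes 2 (Re om)^2 - 2 (Im om)^2.  All other terms are small
multiples of (X + |Re om| + |Im om|)^2, by the weighted Taylor expansion of F
([weighted_taylor]) and by homogeneity of q ([wpol_bound], [wpol_lipschitz]).  If the
direction is tangent to rr = 0 then Im om is itself a small multiple of
X + |Re om|, so that the second derivative is at least c/2 X^2 + (Re om)^2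
([rr2_pos]).  The smallness of the mixed terms needs the weight of u to be less than
1/2; this follows from the hypothesis, because the second derivative of P + h in x
would otherwise be an affine function on the u-axis that is zero at u = 0 and
positive at u = 1 and u = -1 ([hess_axis_pos_weight]).  For the same kind of reason
the case mu = 0 cannot occur ([mu0_not_positive]).

Thus rr = 0 is strongly convex in tangent directions at all its points near the
origin, except at the origin itself, where convexity is degenerate in z.  Convexity
of rr < 0 in a small box follows by a touching argument ([segment_negative]): a
segment with end points in rr < 0 that leaves this set is moved up in the direction
of v, where rr decreases; at the last position in which it still meets rr >= 0 the
function rr has a zero maximum on the segment, which contradicts the sign of the
second derivative.

The shear is inverted on the box by minimizing the distance to the target
([perturbed_identity_onto]), and composing the given coordinates with this inverse
yields coordinates in which D is convex ([straightening]).

Weights are made integral: z has weight wz, w and u have weight wu, and defining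
functions have weight n + n, so that n is half of the total weight and both wz < n
and wu < n hold. *)

(** * Functions of one real variable *)

Section OneVariable.
Variable R : realType.
Implicit Types (g : R -> R) (t : R).

Lemma is_derive_affine (a b t : R) : is_derive t 1 (fun s => a + s * b) b.
Proof.
have -> : (fun s : R => a + s * b) = cst a + b *: (id : R -> R).
  by apply/funext => s; rewrite [RHS]/(a + b * s) mulrC.
have E : 0 + b *: (1 : R) = b by rewrite add0r; exact: mulr1.
by rewrite -[X in is_derive _ _ _ X]E; apply: is_deriveD.
Qed.

Lemma segment_lt (a b t d : R) : 0 <= t <= 1 -> `|a| < d -> `|b| < d ->
  `|a + t * (b - a)| < d.
Proof.
move=> /andP[t0 t1]; rewrite !ltr_norml => /andP[h1 h2] /andP[h3 h4].
have -> : a + t * (b - a) = (1 - t) * a + t * b by ring.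
have [->|tn0] := eqVneq t 0; first by rewrite subr0 mul1r mul0r addr0 h1.
have tpos : 0 < t by rewrite lt_def tn0.
have k1 : t * - d < t * b by rewrite ltr_pM2l.
have k2 : t * b < t * d by rewrite ltr_pM2l.
have k3 : (1 - t) * - d <= (1 - t) * a by rewrite ler_wpM2l ?subr_ge0 // ltW.
have k4 : (1 - t) * a <= (1 - t) * d by rewrite ler_wpM2l ?subr_ge0 // ltW.
by apply/andP; split; lra.
Qed.

Lemma mean_value g (g1 : R -> R) a b : a < b ->
  (forall t, a <= t <= b -> is_derive t 1 g (g1 t)) ->
  exists2 c, a < c < b & g b - g a = g1 c * (b - a).
Proof.
move=> ab dg; have [||c cab E] := @MVT R g g1 a b ab.
- by move=> t; rewrite in_itv /= => /andP[/ltW ? /ltW ?]; apply: dg; apply/andP.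
- apply: derivable_within_continuous => t; rewrite in_itv /= => tab.
  by have [] := dg t tab.
by exists c => //; move: cab; rewrite in_itv.
Qed.

(** The version needed for the touching argument: g1 is only known to be
differentiable at the maximum itself, so that the sign of g1 to the right of t0 is read
off the difference quotients and turned into growth of g by the mean value theorem. *)
Lemma second_derivative_test g (g1 : R -> R) t0 (g2 e : R) : 0 < e ->
  (forall t, `|t - t0| < e -> is_derive t 1 g (g1 t)) ->
  is_derive t0 1 g1 g2 ->
  (forall t, `|t - t0| < e -> g t <= g t0) -> g1 t0 = 0 /\ g2 <= 0.
Proof.
move=> e0 dg dg1 gmax.
have inball t : t \in `]t0 - e, t0 + e[%R -> `|t - t0| < e.
  by rewrite in_itv /= ltr_distl.
have g10 : g1 t0 = 0.
  have dt0 : is_derive t0 1 g 0.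
    apply: (@derive1_at_max R g (t0 - e) (t0 + e) t0).
    - by lra.
    - by move=> t /inball/dg[].
    - by rewrite in_itv /=; apply/andP; split; lra.
    - by move=> t /inball/gmax.
  have [_ <-] : is_derive t0 1 g (g1 t0) by apply: dg; rewrite subrr normr0.
  by case: dt0.
split=> //; rewrite leNgt; apply/negP => g20.
have [dg1' g1E] := dg1.
have : (fun h : R => h^-1 *: (g1 (h *: (1 : R) + t0) - g1 t0)) @ 0^' --> g2.
  by rewrite -g1E; exact: dg1'.
move=> /cvgrPdist_lt /(_ g2 g20).
rewrite near_withinE /= => /nbhs_ballP[d /= d0 Hd].
have pos t : t0 < t < t0 + d -> 0 < g1 t.
  move=> /andP[tt0 ttd].
  have := Hd (t - t0); rewrite /ball /= sub0r normrN.
  have -> : `|t - t0| < d by rewrite gtr0_norm; lra.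
  have -> : t - t0 != 0 by rewrite subr_eq0 gt_eqF.
  move=> /(_ isT isT); rewrite g10 subr0 /GRing.scale /= mulr1 subrK.
  rewrite ltr_distlC subrr => /andP[+ _].
  by rewrite pmulr_rgt0 // invr_gt0 subr_gt0.
pose t1 := t0 + Num.min e d / 2.
have md : 0 < Num.min e d by rewrite lt_min e0 d0.
have me : Num.min e d <= e by rewrite ge_min lexx.
have md' : Num.min e d <= d by rewrite ge_min lexx orbT.
have [||c /andP[c0 c1] E] := @mean_value g g1 t0 t1; first by rewrite /t1; lra.
  move=> t /andP[? t1t]; apply: dg; rewrite /t1 in t1t.
  by rewrite ger0_norm; lra.
have gc : 0 < g1 c by apply: pos; rewrite c0 /=; rewrite /t1 in c1; lra.
have : g t1 <= g t0 by apply: gmax; rewrite /t1 addrAC subrr add0r gtr0_norm; lra.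
have : 0 < g1 c * (t1 - t0) by rewrite mulr_gt0 // /t1; lra.
rewrite -E; lra.
Qed.

End OneVariable.

(** * Derivatives along curves and lines *)

Section ChainRule.
Variable R : realType.

(** The chain rule for curves in R3, with the differential expanded along the three axes. *)
Lemma is_derive_path (F : R3 R -> R) (x y u : R -> R) (t dx dy du : R) :
  differentiable F (pt3 (x t) (y t) (u t)) ->
  is_derive t 1 x dx -> is_derive t 1 y dy -> is_derive t 1 u du ->
  is_derive t 1 (fun s => F (pt3 (x s) (y s) (u s)))
    ('D_(@ex R) F (pt3 (x t) (y t) (u t)) * dx +
     'D_(@ey R) F (pt3 (x t) (y t) (u t)) * dy +
     'D_(@eu R) F (pt3 (x t) (y t) (u t)) * du).
Proof.
move=> dF [hx Ex] [hy Ey] [hu Eu].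
move: hx hy hu => /derivable1_diffP hx /derivable1_diffP hy /derivable1_diffP hu.
have dG : differentiable (fun s => pt3 (x s) (y s) (u s) : R3 R) t.
  by apply: differentiable_pair => //; apply: differentiable_pair.
have dFG : differentiable (F \o (fun s => pt3 (x s) (y s) (u s))) t.
  exact: differentiable_comp.
apply: DeriveDef; first by apply/derivable1_diffP.
rewrite -[LHS]/('D_1 (F \o (fun s => pt3 (x s) (y s) (u s))) t).
rewrite deriveE // diff_comp //= diff_pair //; last exact: differentiable_pair.
rewrite diff_pair //= -!deriveE // Ex Ey Eu.
have -> : (dx, dy, du) = dx *: ex R + dy *: ey R + du *: eu R :> R3 R.
  rewrite -[RHS]/((dx * 1 + dy * 0 + du * 0, dx * 0 + dy * 1 + du * 0,
                   dx * 0 + dy * 0 + du * 1)).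
  by rewrite !(mulr1, mulr0, addr0, add0r).
rewrite deriveE // !linearD !linearZ /= -!deriveE //.
by congr (_ + _ + _); exact: mulrC.
Qed.

End ChainRule.

Section MixedPartials.
Variables (R : realType) (V : normedModType R).
Implicit Types (f : V -> R) (a u v : V) (A : set V).

Lemma is_derive_line f a v t : differentiable f (a + t *: v) ->
  is_derive t 1 (fun s => f (a + s *: v)) ('D_v f (a + t *: v)).
Proof.
move=> df; pose l := fun s : R => a + s *: v.
have dl : is_diff t l ( *:%R^~ v).
  by apply: is_diff_eq; rewrite add0r.
have dfl : differentiable (f \o l) t by apply: differentiable_comp.
apply: DeriveDef; first by apply/derivable1_diffP.
rewrite -[LHS]/('D_1 (f \o l) t) deriveE // diff_comp //= [RHS]deriveE //.
by rewrite diff_val scale1r.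
Qed.

(** The mean value theorem, once in the direction u for the difference in the
direction v, then once in the direction v. *)
Lemma second_difference f a u v (r : R) : 0 < r ->
  (forall s t, 0 <= s <= r -> 0 <= t <= r ->
     differentiable f (a + s *: u + t *: v) /\
     differentiable ('D_u f) (a + s *: u + t *: v)) ->
  exists c d, [/\ 0 <= c <= r, 0 <= d <= r &
    f (a + r *: u + r *: v) - f (a + r *: u) - f (a + r *: v) + f a =
    r ^+ 2 * 'D_v ('D_u f) (a + c *: u + d *: v)].
Proof.
move=> r0 df.
have rr : 0 <= r <= r by rewrite lexx ltW.
have r00 : 0 <= (0 : R) <= r by rewrite lexx ltW.
pose g s := f (a + r *: v + s *: u) - f (a + s *: u).
pose g1 s := 'D_u f (a + r *: v + s *: u) - 'D_u f (a + s *: u).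
have [s sr|c /andP[c0 cr] gE] := @mean_value R g g1 0 r r0.
  apply: is_deriveB; apply: is_derive_line.
    by have [] := df s r sr rr; rewrite addrAC.
  by have [] := df s 0 sr r00; rewrite scale0r addr0.
pose h t := 'D_u f (a + c *: u + t *: v).
have cr' : 0 <= c <= r by rewrite !ltW.
have [t tr|d /andP[d0 dr] hE] := @mean_value R h
    (fun t => 'D_v ('D_u f) (a + c *: u + t *: v)) 0 r r0.
  by apply: is_derive_line; have [] := df c t cr' tr.
exists c, d; split=> //; first by rewrite !ltW.
move: gE hE; rewrite /g /g1 /h !scale0r !addr0 !subr0.
rewrite [a + r *: v + r *: u]addrAC [a + r *: v + c *: u]addrAC.
move=> gE hE; rewrite hE in gE.
transitivity (f (a + r *: u + r *: v) - f (a + r *: u) -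
   (f (a + r *: v) - f a)); first by ring.
rewrite gE; ring.
Qed.

(** Symmetry of second derivatives.  The second difference over a small
parallelogram does not depend on the order of the two directions; it is r ^+ 2 times
both mixed derivatives, each taken at some point of the parallelogram, and these are
continuous. *)
Lemma derive_comm f A a u v : open A -> smooth_on A f -> A a ->
  'D_u ('D_v f) a = 'D_v ('D_u f) a.
Proof.
move=> oA sf Aa.
have : {for a, continuous ('D_u ('D_v f))}.
  exact: differentiable_continuous (sf [:: u; v] a Aa).
have : {for a, continuous ('D_v ('D_u f))}.
  exact: differentiable_continuous (sf [:: v; u] a Aa).
move=> /cvgrPdist_lt cvu /cvgrPdist_lt cuv.
have nA : nbhs a A by exact: open_nbhs_nbhs.
apply/eqP; rewrite -subr_eq0 -normr_eq0 eq_le normr_ge0 andbT.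
apply/ler_addgt0Pr => e e0; rewrite add0r.
have e20 : 0 < e / 2 by rewrite divr_gt0.
have /nbhs_ballP[d /= d0 Hd] : nbhs a (A `&`
    ([set b | `|'D_v ('D_u f) a - 'D_v ('D_u f) b| < e / 2] `&`
     [set b | `|'D_u ('D_v f) a - 'D_u ('D_v f) b| < e / 2])).
  exact: filterI nA (filterI (cvu _ e20) (cuv _ e20)).
(* the size r keeps both parallelograms inside the ball of radius d *)
pose M := `|u| + `|v| + 1.
have M0 : 0 < M by rewrite /M; have := normr_ge0 u; have := normr_ge0 v; lra.
pose r := d / M / 2.
have r0 : 0 < r by rewrite !divr_gt0.
have inb x y s t : `|x| + `|y| < M -> 0 <= s <= r -> 0 <= t <= r ->
    ball a d (a + s *: x + t *: y).
  move=> xyM /andP[s0 sr] /andP[t0 tr].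
  rewrite -ball_normE /= -addrA opprD addNKr normrN.
  rewrite (le_lt_trans (ler_normD _ _)) // !normrZ !ger0_norm //.
  have rM : r * M = d / 2 by rewrite /r; field; rewrite gt_eqF.
  have x0 := normr_ge0 x; have y0 := normr_ge0 y.
  have : s * `|x| + t * `|y| <= r * (`|x| + `|y|).
    by rewrite mulrDr lerD // ler_wpM2r.
  have : r * (`|x| + `|y|) <= r * M by rewrite ler_wpM2l // ltW.
  lra.
have uvM : `|u| + `|v| < M by rewrite /M; lra.
have vuM : `|v| + `|u| < M by rewrite /M; lra.
have [s t sr tr|c [c' [cr cr' E]]] := @second_difference f a u v r r0.
  have [? _] := Hd _ (inb _ _ _ _ uvM sr tr).
  by split; [exact: (sf [::])|exact: (sf [:: u])].
have [s t sr tr|b [b' [br br' E']]] := @second_difference f a v u r r0.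
  have [? _] := Hd _ (inb _ _ _ _ vuM sr tr).
  by split; [exact: (sf [::])|exact: (sf [:: v])].
have EE : 'D_v ('D_u f) (a + c *: u + c' *: v) =
          'D_u ('D_v f) (a + b *: v + b' *: u).
  apply: (@mulfI _ (r ^+ 2)); first by rewrite expf_neq0 // gt_eqF.
  apply: (etrans (esym E)); apply: etrans E'.
  by rewrite [a + r *: v + _]addrAC; congr (_ + _); exact: addrAC.
have [_ [/= h1 _]] := Hd _ (inb _ _ _ _ uvM cr cr').
have [_ [_ /= h2]] := Hd _ (inb _ _ _ _ vuM br br').
rewrite EE in h1.
move: h1 h2; move: ('D_u ('D_v f) a) ('D_v ('D_u f) a) ('D_u _ _) => X Y W.
move=> h1 h2; have -> : X - Y = (X - W) - (Y - W) by ring.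
clear -h1 h2; apply: le_trans (ler_normB _ _) _.
by rewrite [leRHS]splitr lerD // ltW.
Qed.

End MixedPartials.

(** * Smooth functions and iterated derivatives *)

Section DifferentiableEps.
Variables (K : numFieldType) (V W : normedModType K).
Implicit Types (f : V -> W) (x : V).

(** Differentiability from an epsilon estimate, so that asymptotic notation
need not appear in later proofs. *)
Lemma differentiable_eps f (L : {linear V -> W}) x : continuous L ->
  (forall e : K, 0 < e -> \forall h \near (0 : V),
     `|f (h + x) - (f x + L h)| <= e * `|h|) ->
  differentiable f x.
Proof.
move=> Lc Hf.
have H : f \o shift x = cst (f x) + L +o_ (0 : V) id by apply/eqaddoP.
by apply/diff_locallyP; rewrite (diff_unique Lc H).
Qed.

Lemma eps_differentiable f x : differentiable f x ->
  forall e : K, 0 < e -> \forall h \near (0 : V),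
     `|f (h + x) - (f x + 'd f x h)| <= e * `|h|.
Proof. by move=> /diff_locallyP[_ /eqaddoP]. Qed.

(** Differentiability depends on the germ only.  Smoothness on an open set is
inherited by differences of functions through this lemma, since iterated derivatives of
a difference split only on that set. *)
Lemma near_eq_differentiable f g x : (\forall b \near x, f b = g b) ->
  differentiable f x -> differentiable g x.
Proof.
move=> fg df; apply: (@differentiable_eps g ('d f x)).
  exact: diff_continuous.
move=> e e0; have := eps_differentiable df e0.
have fg0 : \forall h \near (0 : V), f (h + x) = g (h + x).
  by move: fg; rewrite (near_shift 0 x) /= subr0.
apply: filterS2 fg0 => h ->.
by rewrite (nbhs_singleton fg).
Qed.

End DifferentiableEps.

Section Smooth.
Variables (R : realType) (V : normedModType R).
Implicit Types (f g : V -> R) (a v : V) (A : set V) (vs ws : seq V).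

Lemma iterD_cat vs ws f : iterD (vs ++ ws)%SEQ f = iterD vs (iterD ws f).
Proof. exact: foldr_cat. Qed.

Lemma smooth_iterD A vs f : smooth_on A f -> smooth_on A (iterD vs f).
Proof. by move=> sf ws a Aa; rewrite -iterD_cat; exact: sf. Qed.

(** Locality of iterated derivatives: the induction uses the equality on a
whole neighbourhood of each point. *)
Lemma eq_iterD A vs f g : open A -> (forall a, A a -> f a = g a) ->
  forall a, A a -> iterD vs f a = iterD vs g a.
Proof.
move=> oA fg; elim: vs => [|v vs IH] //= a Aa.
apply: near_eq_derive; apply: (filterS IH); exact: open_nbhs_nbhs.
Qed.

Lemma iterD_rotate A v vs f : open A -> smooth_on A f ->
  forall a, A a -> iterD (v :: vs) f a = iterD (rcons vs v) f a.
Proof.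
move=> oA sf; elim: vs => [|w vs IH] //= a Aa.
rewrite (derive_comm v w oA (smooth_iterD vs sf)) //.
exact: (@eq_iterD A [:: w]).
Qed.

(** Iterated derivatives of smooth functions do not depend on the order of
the directions.  The condition o_wt fixes one order, while derivatives of a function
that is flat produce all of them. *)
Lemma iterD_perm A vs ws f : open A -> smooth_on A f -> perm_eq vs ws ->
  forall a, A a -> iterD vs f a = iterD ws f a.
Proof.
move=> oA sf; elim: vs ws => [|v vs IH] ws.
  by rewrite perm_sym => /perm_nilP ->.
move=> vsP; have vws : v \in ws by rewrite -(perm_mem vsP) mem_head.
case/splitPr: vws vsP => w1 w2 vsP.
have /IH {}IH : perm_eq vs (w1 ++ w2).
  rewrite -(perm_cons v); apply: (perm_trans vsP).
  by rewrite -(cat1s v w2) perm_catCA.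
move=> a Aa.
rewrite -cat_rcons [in RHS]iterD_cat -(iterD_rotate v w1 oA _ Aa).
  rewrite -iterD_cat; exact: (@eq_iterD A [:: v]).
exact: smooth_iterD.
Qed.

Lemma iterDB A vs f g : open A -> smooth_on A f -> smooth_on A g ->
  forall a, A a -> iterD vs (fun b => f b - g b) a = iterD vs f a - iterD vs g a.
Proof.
move=> oA sf sg; elim: vs => [|v vs IH] //= a Aa.
have -> : 'D_v (iterD vs (fun b => f b - g b)) a =
          'D_v (fun b => iterD vs f b - iterD vs g b) a.
  exact: (@eq_iterD A [:: v]).
by apply: deriveB; apply: diff_derivable; [exact: sf|exact: sg].
Qed.

Lemma smooth_onB A f g : open A -> smooth_on A f -> smooth_on A g ->
  smooth_on A (fun b => f b - g b).
Proof.
move=> oA sf sg vs a Aa.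
have : differentiable (fun b => iterD vs f b - iterD vs g b) a.
  by apply: differentiableB; [exact: sf|exact: sg].
apply: near_eq_differentiable; near=> b; rewrite (iterDB vs oA sf sg) //.
by near: b; exact: open_nbhs_nbhs.
Unshelve. all: by end_near. Qed.

Lemma smooth_onS A B f : A `<=` B -> smooth_on B f -> smooth_on A f.
Proof. by move=> AB sf vs a /AB; exact: sf. Qed.

End Smooth.

(** * Weighted Taylor estimates *)

Section R3Norm.
Variable R : realType.

Lemma norm_pt3 (x y u : R) :
  `|pt3 x y u| = Num.max (Num.max `|x| `|y|) `|u| :> R.
Proof. by []. Qed.

Lemma ball_pt3 (d x y u : R) :
  ball (0 : R3 R) d (pt3 x y u) <-> [/\ `|x| < d, `|y| < d & `|u| < d].
Proof.
rewrite -ball_normE /= sub0r normrN norm_pt3 !gt_max.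
by split=> [/andP[/andP[-> ->] ->]|[-> -> ->]].
Qed.

Lemma nbhs0_pt3 (A : set (R3 R)) : nbhs (0 : R3 R) A ->
  exists2 d : R, 0 < d & forall x y u, `|x| < d -> `|y| < d -> `|u| < d ->
    A (pt3 x y u).
Proof.
move=> /nbhs_ballP[d /= d0 Hd]; exists d => // x y u hx hy hu.
by apply: Hd; apply/ball_pt3.
Qed.

End R3Norm.

Section WeightedTaylor.
Variables (R : realType) (wz wu : nat).
Hypotheses (wz0 : (0 < wz)%N) (wu0 : (0 < wu)%N).
Implicit Types (f : R3 R -> R) (vs : seq (R3 R)) (v : R3 R).

Definition axes : seq (R3 R) := [:: ex R; ey R; eu R].

Definition dir_weight v : nat := if v == eu R then wu else wz.

Definition order_weight vs : nat := \sum_(v <- vs) dir_weight v.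

(** Vanishing to weighted order N at the origin.  All orders of the directions
are allowed, so that [flat_derive] holds for any function. *)
Definition flat (N : nat) f : Prop := forall vs,
  all (mem axes) vs -> (order_weight vs < N)%N -> iterD vs f 0 = 0.

Lemma flat_derive N f v : v \in axes -> flat N f ->
  flat (N - dir_weight v) ('D_v f).
Proof.
move=> vax ff vs vsax vsN; rewrite -[X in iterD X _ _]cats0.
have -> : iterD (vs ++ [::])%SEQ ('D_v f) = iterD (rcons vs v) f.
  by rewrite cats0 -cats1 iterD_cat.
apply: ff; first by rewrite all_rcons vsax andbT.
by rewrite /order_weight big_rcons /= addnC -ltn_subRL.
Qed.

Lemma expr_le_le1 (s : R) m n : 0 <= s <= 1 -> (m <= n)%N -> s ^+ n <= s ^+ m.
Proof. by move=> /andP[s0 s1] mn; exact: ler_wiXn2l. Qed.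

(** By induction on the weighted order N, reducing it by the weight of one
direction: f vanishes at 0, hence equals its derivative along the radius at an
intermediate point, and each partial derivative is flat of an order lowered by exactly
the weight of the coordinate that multiplies it. *)
Lemma weighted_taylor A N f (B : R) : 0 <= B -> open A -> A 0 ->
  smooth_on A f -> flat N f ->
  exists rho C : R, [/\ 0 < rho, 0 <= C & forall s x y u : R, 0 <= s <= 1 ->
    `|x| <= B * s ^+ wz -> `|y| <= B * s ^+ wz -> `|u| <= B * s ^+ wu ->
    `|x| < rho -> `|y| < rho -> `|u| < rho -> `|f (pt3 x y u)| <= C * s ^+ N].
Proof.
move=> B0 oA A0; elim/ltn_ind: N f => -[_|N IH] f sf ff.
  have : {for 0, continuous f}.
    exact: differentiable_continuous (sf [::] 0 A0).
  move=> /cvgrPdist_lt /(_ 1 ltr01) /nbhs0_pt3 [d d0 Hd].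
  exists d, (`|f 0| + 1); split=> // s x y u _ _ _ _ xd yd ud.
  rewrite expr0 mulr1; have := Hd _ _ _ xd yd ud.
  move: (f (pt3 x y u)) (f 0) => a b ab; rewrite distrC in ab.
  rewrite -[a in `|a|](subrK b) (le_trans (ler_normD _ _)) // addrC lerD2l.
  exact: ltW.
(* positivity of the weights makes the induction well founded *)
have wN v : (N.+1 - dir_weight v < N.+1)%N.
  by rewrite /dir_weight; case: ifP => _; rewrite ltn_subrL ?wz0 ?wu0.
have step v : v \in axes -> exists rho C : R, [/\ 0 < rho, 0 <= C &
    forall s x y u : R, 0 <= s <= 1 ->
    `|x| <= B * s ^+ wz -> `|y| <= B * s ^+ wz -> `|u| <= B * s ^+ wu ->
    `|x| < rho -> `|y| < rho -> `|u| < rho ->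
    `|'D_v f (pt3 x y u)| <= C * s ^+ (N.+1 - dir_weight v)].
  move=> vax; apply: (IH _ (wN v) ('D_v f)); last exact: flat_derive.
  exact: (smooth_iterD [:: v] sf).
have axx : ex R \in axes by rewrite !inE eqxx.
have axy : ey R \in axes by rewrite !inE eqxx orbT.
have axu : eu R \in axes by rewrite !inE eqxx !orbT.
have [rx [cx [rx0 cx0 Hx]]] := step (ex R) axx.
have [ry [cy [ry0 cy0 Hy]]] := step (ey R) axy.
have [ru [cu [ru0 cu0 Hu]]] := step (eu R) axu.
have exw : dir_weight (ex R) = wz.
  rewrite /dir_weight ifF //; apply/eqP => -[] /eqP; by rewrite oner_eq0.
have eyw : dir_weight (ey R) = wz.
  rewrite /dir_weight ifF //; apply/eqP => -[] /eqP; by rewrite oner_eq0.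
have euw : dir_weight (eu R) = wu by rewrite /dir_weight eqxx.
rewrite exw in Hx; rewrite eyw in Hy; rewrite euw in Hu.
have [d d0 Hd] := nbhs0_pt3 (open_nbhs_nbhs (conj oA A0)).
exists (Num.min (Num.min rx ry) (Num.min ru d)), (B * cx + B * cy + B * cu).
split=> [||s x y u s01 xB yB uB].
- by rewrite !lt_min rx0 ry0 ru0 d0.
- by rewrite !addr_ge0 ?mulr_ge0.
rewrite !lt_min.
move=> /andP[/andP[xrx xry] /andP[xru xd]].
move=> /andP[/andP[yrx yry] /andP[yru yd]].
move=> /andP[/andP[urx ury] /andP[uru ud]].
have scale (t a b : R) : 0 <= t <= 1 -> `|a| <= b -> `|t * a| <= b.
  move=> /andP[t0 t1] ab; rewrite normrM ger0_norm // (le_trans _ ab) //.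
  by rewrite ler_piMl.
have scalelt (t a b : R) : 0 <= t <= 1 -> `|a| < b -> `|t * a| < b.
  by move=> t01 ab; rewrite (le_lt_trans (scale _ _ _ t01 (lexx _))).
pose g t := f (pt3 (t * x) (t * y) (t * u)).
pose pt t : R3 R := pt3 (t * x) (t * y) (t * u).
pose g1 t := 'D_(ex R) f (pt t) * x + 'D_(ey R) f (pt t) * y +
             'D_(eu R) f (pt t) * u.
have [t t01|t /andP[t0 t1]] := @mean_value R g g1 0 1 ltr01.
  have lin (a : R) : is_derive t 1 (fun r : R => r * a) a.
    have := is_derive_affine 0 a t.
    by under eq_fun do rewrite add0r.
  apply: is_derive_path => //.
  by apply: (sf [::]); apply: Hd; apply: scalelt.
have t01 : 0 <= t <= 1 by rewrite !ltW.
have pt0 : pt3 0 0 0 = 0 :> R3 R by [].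
have f0 : f 0 = 0 by apply: (ff [::]) => //; rewrite /order_weight big_nil.
rewrite /g !mul1r !mul0r pt0 f0 !subr0 mulr1 => ->.
have bnd (w : nat) (D a b C : R) : 0 <= C -> `|D| <= C * s ^+ (N.+1 - w) ->
    `|a| <= B * s ^+ w -> `|D * a| <= B * C * s ^+ N.+1.
  move=> C0 hD ha; rewrite normrM.
  apply: (@le_trans _ _ (C * s ^+ (N.+1 - w) * (B * s ^+ w))).
    exact: ler_pM.
  rewrite mulrACA -exprD [C * B]mulrC ler_wpM2l ?mulr_ge0 //.
  by apply: expr_le_le1 => //; rewrite addnC -leq_subLR.
rewrite /g1 !mulrDl; apply: (le_trans (ler_normD _ _)); apply: lerD.
  apply: (le_trans (ler_normD _ _)); apply: lerD.
    by apply: (bnd wz) => //; apply: Hx => //; (apply: scale || apply: scalelt).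
  by apply: (bnd wz) => //; apply: Hy => //; (apply: scale || apply: scalelt).
by apply: (bnd wu) => //; apply: Hu => //; (apply: scale || apply: scalelt).
Qed.

End WeightedTaylor.

(** * Real polynomials in x, y, u *)

Section RealPolynomials.
Variable R : realType.
Implicit Types (f g : R3 R -> R) (v a : R3 R).

(** Polynomial functions as an inductive class: closure under derivatives and
continuity are then inductions on the class, without coefficients. *)
Inductive poly3 : (R3 R -> R) -> Prop :=
| poly3_cst c : poly3 (fun=> c)
| poly3_x : poly3 (fun a => a.1.1)
| poly3_y : poly3 (fun a => a.1.2)
| poly3_u : poly3 (fun a => a.2)
| poly3_add f g : poly3 f -> poly3 g -> poly3 (fun a => f a + g a)
| poly3_mul f g : poly3 f -> poly3 g -> poly3 (fun a => f a * g a).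

Lemma differentiable_fst (W1 W2 : normedModType R) (b : W1 * W2) :
  differentiable (fst : (W1 * W2)%type -> W1) b.
Proof. by apply: linear_differentiable => z; exact: cvg_fst. Qed.

Lemma differentiable_snd (W1 W2 : normedModType R) (b : W1 * W2) :
  differentiable (snd : (W1 * W2)%type -> W2) b.
Proof. by apply: linear_differentiable => z; exact: cvg_snd. Qed.

Lemma differentiable_coord1 a : differentiable (fun b : R3 R => b.1.1) a.
Proof.
apply: (@differentiable_comp _ _ _ _ (fst : R3 R -> _) fst).
  exact: differentiable_fst.
exact: differentiable_fst.
Qed.

Lemma differentiable_coord2 a : differentiable (fun b : R3 R => b.1.2) a.
Proof.
apply: (@differentiable_comp _ _ _ _ (fst : R3 R -> _) snd).
  exact: differentiable_fst.
exact: differentiable_snd.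
Qed.

(** The derivative of a linear form, computed from the difference quotient,
which is constant. *)
Lemma derive_additive f v a :
  (forall b c, f (b + c) = f b + f c) -> (forall s b, f (s *: b) = s * f b) ->
  'D_v f a = f v.
Proof.
move=> fD fZ; apply: cvg_lim => //; apply: cvg_near_cst.
near=> h; rewrite /= fD addrK fZ /GRing.scale /= mulKf //.
by near: h; exact: nbhs_dnbhs_neq.
Unshelve. all: by end_near. Qed.

Lemma poly3_differentiable f : poly3 f -> forall a, differentiable f a.
Proof.
elim=> [c|||| g1 g2 _ IH1 _ IH2|g1 g2 _ IH1 _ IH2] a.
- exact: differentiable_cst.
- exact: differentiable_coord1.
- exact: differentiable_coord2.
- exact: differentiable_snd.
- by apply: differentiableD.
- by apply: differentiableM.
Qed.

Lemma poly3_derive f v : poly3 f -> poly3 ('D_v f).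
Proof.
elim=> [c|||| g1 g2 p1 IH1 p2 IH2|g1 g2 p1 IH1 p2 IH2].
- have -> : 'D_v (fun=> c) = (fun=> 0) :> (R3 R -> R).
    by apply/funext => a; exact: derive_cst.
  exact: poly3_cst.
- have -> : 'D_v (fun a : R3 R => a.1.1) = (fun=> v.1.1).
    apply/funext => a; exact: derive_additive.
  exact: poly3_cst.
- have -> : 'D_v (fun a : R3 R => a.1.2) = (fun=> v.1.2).
    apply/funext => a; exact: derive_additive.
  exact: poly3_cst.
- have -> : 'D_v (fun a : R3 R => a.2) = (fun=> v.2).
    apply/funext => a; exact: derive_additive.
  exact: poly3_cst.
- have -> : 'D_v (fun a => g1 a + g2 a) = (fun a => 'D_v g1 a + 'D_v g2 a).
    by apply/funext => a; apply: deriveD;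
       apply: diff_derivable; exact: poly3_differentiable.
  exact: poly3_add.
- have -> : 'D_v (fun a => g1 a * g2 a) =
            (fun a => g1 a * 'D_v g2 a + g2 a * 'D_v g1 a).
    by apply/funext => a; apply: deriveM;
       apply: diff_derivable; exact: poly3_differentiable.
  by apply: poly3_add; apply: poly3_mul.
Qed.

Lemma poly3_smooth f A : poly3 f -> smooth_on A f.
Proof.
move=> pf vs a _; suff : poly3 (iterD vs f) by move=> /poly3_differentiable.
by elim: vs => //= v vs; exact: poly3_derive.
Qed.

Definition cpoly3 (g : R3 R -> Cx R) : Prop :=
  poly3 (fun a => complex.Re (g a)) /\ poly3 (fun a => complex.Im (g a)).

Lemma poly3_opp f : poly3 f -> poly3 (fun a => - f a).
Proof.
move=> pf; have -> : (fun a => - f a) = (fun a => (-1) * f a).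
  by apply/funext => a; rewrite mulN1r.
exact: poly3_mul (poly3_cst _) pf.
Qed.

Lemma cpoly3_cst c : cpoly3 (fun=> c).
Proof. by split; exact: poly3_cst. Qed.

Lemma cpoly3_add (p q : R3 R -> Cx R) : cpoly3 p -> cpoly3 q ->
  cpoly3 (fun a => p a + q a).
Proof.
move=> [r1 i1] [r2 i2]; split.
  by under eq_fun do rewrite raddfD; exact: poly3_add.
by under eq_fun do rewrite raddfD; exact: poly3_add.
Qed.

Lemma Re_add (z w : Cx R) : complex.Re (z + w) = complex.Re z + complex.Re w.
Proof. by case: z w => [? ?] [? ?]. Qed.

Lemma Im_add (z w : Cx R) : complex.Im (z + w) = complex.Im z + complex.Im w.
Proof. by case: z w => [? ?] [? ?]. Qed.

Lemma Re_mul (z w : Cx R) : complex.Re (z * w) =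
  complex.Re z * complex.Re w - complex.Im z * complex.Im w.
Proof. by case: z w => [? ?] [? ?]. Qed.

Lemma Im_mul (z w : Cx R) : complex.Im (z * w) =
  complex.Re z * complex.Im w + complex.Im z * complex.Re w.
Proof. by case: z w => [? ?] [? ?]. Qed.

Lemma cpoly3_mul (p q : R3 R -> Cx R) : cpoly3 p -> cpoly3 q ->
  cpoly3 (fun a => p a * q a).
Proof.
move=> [r1 i1] [r2 i2]; split.
  under eq_fun do rewrite Re_mul.
  by apply: poly3_add; [|apply: poly3_opp]; apply: poly3_mul.
under eq_fun do rewrite Im_mul.
by apply: poly3_add; apply: poly3_mul.
Qed.

Lemma cpoly3_exp (g : R3 R -> Cx R) n : cpoly3 g -> cpoly3 (fun a => g a ^+ n).
Proof.
move=> pg; elim: n => [|n IH].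
  by under eq_fun do rewrite expr0; exact: cpoly3_cst.
by under eq_fun do rewrite exprS; exact: cpoly3_mul.
Qed.

Lemma cpoly3_sum (N : nat) (g : 'I_N -> R3 R -> Cx R) :
  (forall i, cpoly3 (g i)) -> cpoly3 (fun a => \sum_(i < N) g i a).
Proof.
move=> pg; elim: N g pg => [|N IH] g pg.
  by under eq_fun do rewrite big_ord0; exact: cpoly3_cst.
under eq_fun do rewrite big_ord_recl.
by apply: cpoly3_add => //; apply: IH.
Qed.

End RealPolynomials.

(** * Dilations and homogeneous polynomials *)

Section Dilations.
Variables (R : realType) (wz wu : nat).
Implicit Types (f P : R3 R -> R) (v a : R3 R) (s : R).

Definition dil s a : R3 R :=
  pt3 (s ^+ wz * a.1.1) (s ^+ wz * a.1.2) (s ^+ wu * a.2).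

Lemma dir_weightE : [/\ dir_weight wz wu (ex R) = wz,
  dir_weight wz wu (ey R) = wz & dir_weight wz wu (eu R) = wu].
Proof.
by split; rewrite /dir_weight ?eqxx // ifF //; apply/eqP => -[] /eqP;
   rewrite oner_eq0.
Qed.

Lemma dil_axis s v : v \in axes R -> dil s v = s ^+ dir_weight wz wu v *: v.
Proof.
have [hx hy hu] := dir_weightE.
have Z (c x y u : R) : c *: (pt3 x y u : R3 R) = pt3 (c * x) (c * y) (c * u) by [].
by rewrite !inE => /or3P[] /eqP ->; rewrite ?hx ?hy ?hu /dil Z /= ?mulr0.
Qed.

(** Differentiate both sides of f (dil s a) = c f a along the axis v, on which
dil s acts as multiplication by the power of s given by the weight. *)
Lemma derive_dil f s c v : v \in axes R -> s != 0 ->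
  (forall a, differentiable f a) ->
  (forall a, f (dil s a) = c * f a) ->
  forall a, 'D_v f (dil s a) = c / s ^+ dir_weight wz wu v * 'D_v f a.
Proof.
move=> vax s0 df fs a.
set w := dir_weight wz wu v.
have dilD t : dil s (a + t *: v) = dil s a + t *: (s ^+ w *: v).
  rewrite -dil_axis //.
  rewrite -[LHS]/(pt3 (s ^+ wz * (a.1.1 + t * v.1.1))
    (s ^+ wz * (a.1.2 + t * v.1.2)) (s ^+ wu * (a.2 + t * v.2))).
  rewrite -[RHS]/(pt3 (s ^+ wz * a.1.1 + t * (s ^+ wz * v.1.1))
    (s ^+ wz * a.1.2 + t * (s ^+ wz * v.1.2))
    (s ^+ wu * a.2 + t * (s ^+ wu * v.2))).
  by rewrite !mulrDr !(mulrCA t).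
have D1 : is_derive (0 : R) (1 : R) (fun t : R => f (dil s a + t *: (s ^+ w *: v)))
   ('D_(s ^+ w *: v) f (dil s a)).
  have := @is_derive_line R (R3 R) f (dil s a) (s ^+ w *: v) 0.
  by rewrite scale0r addr0; apply; exact: df.
have D2 : is_derive (0 : R) (1 : R) (fun t : R => c * f (a + t *: v)) (c * 'D_v f a).
  have -> : (fun t : R => c * f (a + t *: v)) = c *: (fun t => f (a + t *: v)) by [].
  rewrite -[X in is_derive _ _ _ X]/(c *: 'D_v f a); apply: is_deriveZ.
  have := @is_derive_line R (R3 R) f a v 0.
  by rewrite scale0r addr0; apply; exact: df.
have E : (fun t : R => f (dil s a + t *: (s ^+ w *: v))) = fun t => c * f (a + t *: v).
  by apply/funext => t; rewrite -dilD fs.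
rewrite E in D1; case: D1 D2 => _ D1 [_]; rewrite D1.
rewrite deriveE // linearZ /= -deriveE // => H.
have {}H : s ^+ w * 'D_v f (dil s a) = c * 'D_v f a := H.
apply: (mulfI (expf_neq0 w s0)); rewrite H.
by rewrite mulrA [_ * (c / _)]mulrC divfK ?expf_neq0.
Qed.

Lemma iterD_dil f s c vs : all (mem (axes R)) vs -> s != 0 -> poly3 f ->
  (forall a, f (dil s a) = c * f a) ->
  forall a, iterD vs f (dil s a) =
    c / s ^+ order_weight wz wu vs * iterD vs f a.
Proof.
move=> vsax s0 pf fs.
elim: vs vsax => [_ a|v vs IH /= /andP[vax vsax] a].
  by rewrite /order_weight big_nil expr0 divr1.
rewrite (derive_dil vax s0 _ (IH vsax)); last first.
  by move=> b; exact: (@poly3_smooth R f setT pf vs b).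
rewrite /order_weight big_cons exprD invfM.
by rewrite [_^-1 * _]mulrC mulrA.
Qed.

Lemma dil0 s : dil s 0 = 0.
Proof. by rewrite /dil !mulr0. Qed.

(** The origin is fixed by all dilations; with s = 2 the two powers differ
unless the weights agree. *)
Lemma iterD_dil0 f n vs : all (mem (axes R)) vs -> poly3 f ->
  (forall s a, f (dil s a) = s ^+ n * f a) ->
  order_weight wz wu vs != n -> iterD vs f 0 = 0.
Proof.
move=> vsax pf fs vsn.
have two0 : (2 : R) != 0 by rewrite pnatr_eq0.
have := iterD_dil vsax two0 pf (fs 2) 0.
rewrite dil0 => /eqP.
rewrite -subr_eq0 -[X in X - _]mul1r -mulrBl mulf_eq0 => /orP[|/eqP//].
rewrite subr_eq0 eq_sym -(inj_eq (mulIf (expf_neq0 (order_weight wz wu vs) two0))).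
rewrite mul1r divfK ?expf_neq0 // -!natrX eqr_nat eqn_exp2l // => /eqP nE.
by rewrite nE eqxx in vsn.
Qed.

(** A list of axis directions is a permutation of the sorted list that the
definition of o_wt tests. *)
Lemma canonical_order vs : all (mem (axes R)) vs -> exists i j l,
  perm_eq vs (nseq i (ex R) ++ nseq j (ey R) ++ nseq l (eu R)) /\
  order_weight wz wu vs = ((i + j) * wz + l * wu)%N.
Proof.
have [hx hy hu] := dir_weightE.
elim: vs => [_|v vs IH /= /andP[vax /IH[i [j [l [vsP vsw]]]]]].
  by exists 0%N, 0%N, 0%N; rewrite /order_weight big_nil.
have {}vsP p : count p vs = (p (ex R) * i + (p (ey R) * j + p (eu R) * l))%N.
  by rewrite (permP vsP) !count_cat !count_nseq.
have {}vax : v \in axes R := vax.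
move: vax; rewrite !inE => /or3P[] /eqP vE.
- exists i.+1, j, l; split.
    apply/permP => p; rewrite !count_cat !count_nseq /= vsP vE.
    by rewrite mulnS addnA.
  by rewrite /order_weight big_cons vE hx [X in (_ + X)%N]vsw; lia.
- exists i, j.+1, l; split.
    apply/permP => p; rewrite !count_cat !count_nseq /= vsP vE.
    by rewrite mulnS; lia.
  by rewrite /order_weight big_cons vE hy [X in (_ + X)%N]vsw; lia.
- exists i, j, l.+1; split.
    apply/permP => p; rewrite !count_cat !count_nseq /= vsP vE.
    by rewrite mulnS; lia.
  by rewrite /order_weight big_cons vE hu [X in (_ + X)%N]vsw; lia.
Qed.

End Dilations.

Section Homogeneous.
Variables (R : realType) (wz wu n : nat) (lam1 lam2 : rat).
Implicit Types (f P : R3 R -> R).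

Lemma R3_eta (a : R3 R) : a = pt3 a.1.1 a.1.2 a.2.
Proof. by case: a => [[x y] u]. Qed.

(** The defining sum is complex; its real part is a real polynomial and
equals P. *)
Lemma homogeneous_poly3 g P : homogeneous lam1 lam2 g P -> poly3 P.
Proof.
move=> [N [c [_ PE]]].
pose S (a : R3 R) := \sum_(i < N) \sum_(j < N) \sum_(l < N)
  c i j l * (a.1.1 +i* a.1.2) ^+ i * Num.conj (a.1.1 +i* a.1.2 : Cx R) ^+ j * a.2%:C ^+ l.
have -> : P = fun a => complex.Re (S a : Cx R).
  by apply/funext => a; rewrite [in LHS](R3_eta a) -[LHS]/(complex.Re (_%:C)) PE.
suff [] : cpoly3 S by [].
apply: cpoly3_sum => i; apply: cpoly3_sum => j; apply: cpoly3_sum => l.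
apply: cpoly3_mul; [apply: cpoly3_mul; [apply: cpoly3_mul|]|].
- exact: cpoly3_cst.
- by apply: cpoly3_exp; split; [exact: poly3_x|exact: poly3_y].
- apply: cpoly3_exp; split; [exact: poly3_x|].
  by apply: poly3_opp; exact: poly3_y.
- by apply: cpoly3_exp; split; [exact: poly3_u|exact: poly3_cst].
Qed.

Lemma homogeneous_dil P :
  (forall m l, weight lam1 lam2 m l = 1 -> (m * wz + l * wu)%N = n) ->
  homogeneous lam1 lam2 1 P -> forall s a, P (dil wz wu s a) = s ^+ n * P a.
Proof.
move=> wE [N [c [c0 PE]]] s a.
apply: (@complexI R).
have PaE := PE a.1.1 a.1.2 a.2; rewrite -R3_eta in PaE.
have -> : (s ^+ n * P a)%:C = (s ^+ n)%:C * (P a)%:C by exact: rmorphM.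
apply: (etrans (PE (s ^+ wz * a.1.1) (s ^+ wz * a.1.2) (s ^+ wu * a.2))).
rewrite [X in _ = _ * X]PaE.
rewrite mulr_sumr; apply: eq_bigr => i _.
rewrite mulr_sumr; apply: eq_bigr => j _.
rewrite mulr_sumr; apply: eq_bigr => l _.
have [->|cijl] := eqVneq (c i j l) 0; first by rewrite !(mul0r, mulr0).
have wn := wE _ _ (c0 _ _ _ cijl).
have zE : (s ^+ wz * a.1.1 +i* (s ^+ wz * a.1.2) : Cx R) =
   (s ^+ wz)%:C * (a.1.1 +i* a.1.2).
  by congr (_ +i* _); rewrite mul0r ?subr0 ?addr0.
have zbE : Num.conj (s ^+ wz * a.1.1 +i* (s ^+ wz * a.1.2) : Cx R) =
   (s ^+ wz)%:C * Num.conj (a.1.1 +i* a.1.2 : Cx R).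
  by congr (_ +i* _); rewrite mul0r ?subr0 ?addr0 //= mulrN.
have uE : (s ^+ wu * a.2)%:C = (s ^+ wu)%:C * a.2%:C :> Cx R by exact: rmorphM.
have sE : (s ^+ n)%:C =
    (s ^+ wz)%:C ^+ i * (s ^+ wz)%:C ^+ j * (s ^+ wu)%:C ^+ l :> Cx R.
  rewrite -!rmorphXn /= -!rmorphM /= -!exprM -!exprD -wn.
  by congr (_ ^+ _)%:C; lia.
rewrite zbE zE uE !exprMn sE.
move: (_ ^+ i) (_ ^+ i) (_ ^+ j) (_ ^+ j) (_ ^+ l) (_ ^+ l) => x1 x2 x3 x4 x5 x6.
ring.
Qed.

Hypothesis wlt : forall m l, weight lam1 lam2 m l = 1 -> (m * wz + l * wu)%N = n.
Hypothesis wle : forall m l, (m * wz + l * wu <= n)%N -> weight lam1 lam2 m l <= 1.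

Lemma flat_homogeneous P : homogeneous lam1 lam2 1 P -> flat wz wu n P.
Proof.
move=> hP vs vsax vsn; apply: (@iterD_dil0 R wz wu P n) => //.
- exact: homogeneous_poly3 hP.
- exact: homogeneous_dil.
- by rewrite neq_ltn vsn.
Qed.

Lemma flat_remainder A F P : open A -> A 0 -> smooth_on A F -> poly3 P ->
  o_wt lam1 lam2 (fun a => F a - P a) -> flat wz wu n.+1 (fun a => F a - P a).
Proof.
move=> oA A0 sF pP oFP vs vsax vsn.
have sFP : smooth_on A (fun a => F a - P a).
  by apply: smooth_onB => //; exact: poly3_smooth.
have [i [j [l [vsP vsw]]]] := canonical_order wz wu vsax.
rewrite (iterD_perm oA sFP vsP A0); apply: oFP; apply: wle.
by rewrite -vsw -ltnS.
Qed.

(** F has no terms below weight one: P is homogeneous of that weight, and the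
rest is of higher order. *)
Lemma flat_defining A F P : open A -> A 0 -> smooth_on A F ->
  homogeneous lam1 lam2 1 P ->
  o_wt lam1 lam2 (fun a => F a - P a) -> flat wz wu n F.
Proof.
move=> oA A0 sF hP oFP vs vsax vsn; have pP := homogeneous_poly3 hP.
have /(_ vs vsax) := flat_remainder oA A0 sF pP oFP.
rewrite (iterDB vs oA sF (poly3_smooth pP) A0).
by rewrite (flat_homogeneous hP vsax vsn) subr0; apply; exact: ltnW.
Qed.

End Homogeneous.

(** * Complex-valued functions and polynomial identities *)

Section ComplexPaths.
Variable R : realType.
Implicit Types (f g : R -> Cx R) (d e : Cx R) (t : R).

(** Derivative of a complex-valued function of a real variable, componentwise, so
that real and imaginary parts can be used in real estimates directly. *)
Definition cder f d t : Prop :=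
  is_derive t 1 (fun s => complex.Re (f s)) (complex.Re d) /\
  is_derive t 1 (fun s => complex.Im (f s)) (complex.Im d).

Lemma is_derive_ext (p q : R -> R) t (d d' : R) : (forall s, p s = q s) ->
  d = d' -> is_derive t 1 p d -> is_derive t 1 q d'.
Proof. by move=> /funext -> ->. Qed.

Lemma cder_cst c t : cder (fun=> c) 0 t.
Proof. by split; exact: is_derive_cst. Qed.

Lemma cder_affine (a b : Cx R) t : cder (fun s => a + s%:C * b) b t.
Proof.
case: a b => [a1 a2] [b1 b2]; split.
  apply: is_derive_ext (is_derive_affine a1 b1 t) => // s.
  by rewrite /= mul0r subr0.
apply: is_derive_ext (is_derive_affine a2 b2 t) => // s.
by rewrite /= mul0r addr0.
Qed.

Lemma cder_add f g d e t : cder f d t -> cder g e t ->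
  cder (fun s => f s + g s) (d + e) t.
Proof.
move=> [fr fi] [gr gi]; split.
  apply: is_derive_ext (is_deriveD fr gr) => [s|]; rewrite raddfD //.
apply: is_derive_ext (is_deriveD fi gi) => [s|]; rewrite raddfD //.
Qed.

Lemma cder_mul f g d e t : cder f d t -> cder g e t ->
  cder (fun s => f s * g s) (f t * e + d * g t) t.
Proof.
move=> [fr fi] [gr gi]; split.
  apply: is_derive_ext (is_deriveB (is_deriveM fr gr) (is_deriveM fi gi)).
    by move=> s; rewrite Re_mul.
  rewrite Re_add !Re_mul /GRing.scale /=; ring.
apply: is_derive_ext (is_deriveD (is_deriveM fr gi) (is_deriveM fi gr)).
  by move=> s; rewrite Im_mul.
rewrite Im_add !Im_mul /GRing.scale /=; ring.
Qed.

Lemma cder_exp f d t n : cder f d t ->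
  cder (fun s => f s ^+ n) (n%:R * f t ^+ n.-1 * d) t.
Proof.
move=> df; elim: n => [|n IH].
  by rewrite !mul0r; exact: cder_cst.
have -> : n.+1%:R * f t ^+ n.+1.-1 * d =
    f t * (n%:R * f t ^+ n.-1 * d) + d * f t ^+ n.
  case: n {IH} => [|n] /=; first by rewrite expr0; ring.
  by rewrite [in LHS]mulrSr !exprS; ring.
by under eq_fun do rewrite exprS; exact: cder_mul df IH.
Qed.

Lemma cder_sum (N : nat) (f : 'I_N -> R -> Cx R) (d : 'I_N -> Cx R) t :
  (forall i, cder (f i) (d i) t) ->
  cder (fun s => \sum_(i < N) f i s) (\sum_(i < N) d i) t.
Proof.
elim: N f d => [|N IH] f d df.
  by under eq_fun do rewrite big_ord0; rewrite big_ord0; exact: cder_cst.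
under eq_fun do rewrite big_ord_recl.
by rewrite big_ord_recl; apply: cder_add => //; apply: IH.
Qed.

End ComplexPaths.

Section PolynomialIdentities.
Variable R : realType.
Let C := Cx R.

(** The natural numbers already are too many roots for a nonzero polynomial. *)
Lemma poly_vanish_real (p : {poly C}) : (forall t : R, p.[t%:C] = 0) -> p = 0.
Proof.
move=> p0; apply/eqP; apply: contraT => pn0.
pose rs := [seq (i%:R : C) | i <- iota 0 (size p)].
have := @max_poly_roots _ p rs pn0; rewrite size_map size_iota ltnn; apply.
- apply/allP => z /mapP[i _ ->]; rewrite /root -(p0 i%:R).
  by rewrite rmorph_nat.
- rewrite map_inj_uniq ?iota_uniq // => i j /eqP.
  by rewrite eqr_nat => /eqP.
Qed.

Lemma poly_coef0 N (c : nat -> C) : (forall t : R,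
  \sum_(i < N) c i * t%:C ^+ i = 0) -> forall i, (i < N)%N -> c i = 0.
Proof.
move=> H i iN; suff : (\poly_(i < N) c i)`_i = 0 by rewrite coef_poly iN.
have -> : \poly_(i < N) c i = 0; last by rewrite coef0.
by apply: poly_vanish_real => t; rewrite horner_poly.
Qed.

(** Uniqueness of the coefficients of a polynomial in z, its conjugate and u.
The identity in real x, y, u extends to complex values of x and y, one variable at a
time; then z and its conjugate become independent variables. *)
Lemma conj_poly_coef0 N (c : nat -> nat -> nat -> C) :
  (forall x y u : R, \sum_(i < N) \sum_(j < N) \sum_(l < N)
     c i j l * (x +i* y) ^+ i * Num.conj (x +i* y : C) ^+ j * u%:C ^+ l = 0) ->
  forall i j l, (i < N)%N -> (j < N)%N -> (l < N)%N -> c i j l = 0.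
Proof.
move=> H i j l iN jN lN.
have H1 (x y : R) : \sum_(i < N) \sum_(j < N)
    c i j l * (x%:C + 'i * y%:C) ^+ i * (x%:C - 'i * y%:C) ^+ j = 0.
  have zE : x%:C + 'i * y%:C = (x +i* y) :> C.
    by congr (_ +i* _); rewrite !(mul0r, mulr0, mul1r, addr0, add0r, subr0).
  have zbE : x%:C - 'i * y%:C = Num.conj (x +i* y : C) :> C.
    by congr (_ +i* _); rewrite !(mul0r, mulr0, mul1r, addr0, add0r, subr0, oppr0).
  rewrite zE zbE.
  apply: (@poly_coef0 N (fun l => \sum_(i < N) \sum_(j < N)
    c i j l * (x +i* y) ^+ i * Num.conj (x +i* y : C) ^+ j)) => // u.
  rewrite -[RHS](H x y u).
  under eq_bigr do rewrite mulr_suml; rewrite exchange_big; apply: eq_bigr => i' _.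
  under eq_bigr do rewrite mulr_suml; rewrite exchange_big; apply: eq_bigr => j' _.
  by [].
(* let y become complex, then x in H3 *)
have H2 (x : R) (y : C) : \sum_(i < N) \sum_(j < N)
    c i j l * (x%:C + 'i * y) ^+ i * (x%:C - 'i * y) ^+ j = 0.
  pose p : {poly C} := \sum_(i < N) \sum_(j < N)
    (c i j l)%:P * ((x%:C)%:P + 'i%:P * 'X) ^+ i * ((x%:C)%:P - 'i%:P * 'X) ^+ j.
  have pE z : p.[z] = \sum_(i < N) \sum_(j < N)
      c i j l * (x%:C + 'i * z) ^+ i * (x%:C - 'i * z) ^+ j.
    rewrite /p horner_sum; apply: eq_bigr => i' _.
    rewrite horner_sum; apply: eq_bigr => j' _.
    by rewrite !hornerE.
  have p0 : p = 0 by apply: poly_vanish_real => t; rewrite pE.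
  by rewrite -pE p0 horner0.
have H3 (x y : C) : \sum_(i < N) \sum_(j < N)
    c i j l * (x + 'i * y) ^+ i * (x - 'i * y) ^+ j = 0.
  pose p : {poly C} := \sum_(i < N) \sum_(j < N)
    (c i j l)%:P * ('X + ('i * y)%:P) ^+ i * ('X - ('i * y)%:P) ^+ j.
  have pE z : p.[z] = \sum_(i < N) \sum_(j < N)
      c i j l * (z + 'i * y) ^+ i * (z - 'i * y) ^+ j.
    rewrite /p horner_sum; apply: eq_bigr => i' _.
    rewrite horner_sum; apply: eq_bigr => j' _.
    by rewrite !hornerE.
  have p0 : p = 0 by apply: poly_vanish_real => t; rewrite pE.
  by rewrite -pE p0 horner0.
(* choose x and y with x + iy = a and x - iy = b *)
have H4 (a b : C) : \sum_(i < N) \sum_(j < N) c i j l * a ^+ i * b ^+ j = 0.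
  have two0 : (2 : C) != 0 by rewrite pnatr_eq0.
  have := H3 ((a + b) / 2) ('i * (b - a) / 2).
  have -> : (a + b) / 2 + 'i * ('i * (b - a) / 2) = a.
    by rewrite !mulrA -expr2 sqrCi; field.
  have -> : (a + b) / 2 - 'i * ('i * (b - a) / 2) = b.
    by rewrite !mulrA -expr2 sqrCi; field.
  by [].
have H5 (b : C) : \sum_(j < N) c i j l * b ^+ j = 0.
  apply: (@poly_coef0 N (fun i => \sum_(j < N) c i j l * b ^+ j)) => // t.
  rewrite -[RHS](H4 t%:C b); apply: eq_bigr => i' _.
  by rewrite mulr_suml; apply: eq_bigr => j' _; rewrite mulrAC.
by apply: (@poly_coef0 N (fun j => c i j l)) => // t.
Qed.

End PolynomialIdentities.

(** * Holomorphic polynomials of a given weighted order *)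

Section HolomorphicPolynomials.
Variables (R : realType) (wz wu : nat).
Implicit Types (g : Cx R -> Cx R -> Cx R) (s : R) (z w : Cx R).

(** The index is a lower bound for the weighted order and not a degree, whence the
weakening rule: q + w ^+ 2 has the order of w ^+ 2, although it is not homogeneous. *)
Inductive wpol : nat -> (Cx R -> Cx R -> Cx R) -> Prop :=
| wpol_zero n : wpol n (fun _ _ => 0)
| wpol_cst c : wpol 0 (fun _ _ => c)
| wpol_z : wpol wz (fun z _ => z)
| wpol_w : wpol wu (fun _ w => w)
| wpol_add n g1 g2 : wpol n g1 -> wpol n g2 -> wpol n (fun z w => g1 z w + g2 z w)
| wpol_mul n1 n2 g1 g2 : wpol n1 g1 -> wpol n2 g2 ->
    wpol (n1 + n2) (fun z w => g1 z w * g2 z w)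
| wpol_weaken m n g : (m <= n)%N -> wpol n g -> wpol m g.

Lemma wpol_sum n N (g : 'I_N -> Cx R -> Cx R -> Cx R) :
  (forall i, wpol n (g i)) -> wpol n (fun z w => \sum_(i < N) g i z w).
Proof.
elim: N g => [|N IH] g pg.
  have -> : (fun z w => \sum_(i < 0) g i z w) = fun _ _ => 0.
    by apply/funext => z; apply/funext => w; rewrite big_ord0.
  exact: wpol_zero.
have -> : (fun z w => \sum_(i < N.+1) g i z w) =
    (fun z w => g ord0 z w + \sum_(i < N) g (lift ord0 i) z w).
  by apply/funext => z; apply/funext => w; rewrite big_ord_recl.
by apply: wpol_add => //; apply: IH.
Qed.

Lemma wpol_exp n g i : wpol n g -> wpol (i * n) (fun z w => g z w ^+ i).
Proof.
move=> pg; elim: i => [|i IH]; first exact: wpol_cst.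
have -> : (fun z w => g z w ^+ i.+1) = (fun z w => g z w * g z w ^+ i).
  by apply/funext => z; apply/funext => w; rewrite exprS.
by rewrite mulSn; exact: wpol_mul.
Qed.

(** Complex differentiability on C2, with gz and gw as partial derivatives. *)
Definition pairdiff g (gz gw : Cx R -> Cx R -> Cx R) := forall q : C2 R,
  is_diff q (fun q : C2 R => g q.1 q.2)
    (fun e : C2 R => gz q.1 q.2 * e.1 + gw q.1 q.2 * e.2).

(** The chain rule along real curves, the form in which gz and gw enter real
second derivatives. *)
Definition pathdiff g (gz gw : Cx R -> Cx R -> Cx R) :=
  forall (zt wt : R -> Cx R) (dz dw : Cx R) (t : R),
  cder zt dz t -> cder wt dw t ->
  cder (fun s => g (zt s) (wt s))
     (gz (zt t) (wt t) * dz + gw (zt t) (wt t) * dw) t.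

Lemma cder_eq (f : R -> Cx R) d d' t : d = d' -> cder f d t -> cder f d' t.
Proof. by move->. Qed.

(** Both chain rules are proved in one induction, since they must hold for
the same partial derivatives. *)
Lemma wpol_derive n g : wpol n g -> exists gz gw,
  [/\ wpol (n - wz) gz, wpol (n - wu) gw, pathdiff g gz gw & pairdiff g gz gw].
Proof.
elim=> {n g}.
- move=> n; exists (fun _ _ => 0), (fun _ _ => 0).
  split; [exact: wpol_zero|exact: wpol_zero| |].
    move=> zt wt dz dw t _ _; apply: cder_eq (cder_cst _ _).
    by rewrite !mul0r addr0.
  move=> q; have -> : (fun e : C2 R => 0 * e.1 + 0 * e.2) = 0.
    by apply/funext => e; rewrite !mul0r addr0.
  exact: is_diff_cst.
- move=> c; exists (fun _ _ => 0), (fun _ _ => 0).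
  split; [exact: wpol_zero|exact: wpol_zero| |].
    move=> zt wt dz dw t _ _; apply: cder_eq (cder_cst _ _).
    by rewrite !mul0r addr0.
  move=> q; have -> : (fun e : C2 R => 0 * e.1 + 0 * e.2) = 0.
    by apply/funext => e; rewrite !mul0r addr0.
  exact: is_diff_cst.
- exists (fun _ _ => 1), (fun _ _ => 0).
  split; [rewrite subnn; exact: wpol_cst|exact: wpol_zero| |].
    move=> zt wt dz dw t hz _; apply: cder_eq hz.
    by rewrite mul0r addr0 mul1r.
  move=> q; have -> : (fun e : C2 R => 1 * e.1 + 0 * e.2) = fst.
    by apply/funext => e; rewrite mul0r addr0 mul1r.
  apply: DiffDef.
    by apply: linear_differentiable => x; exact: cvg_fst.
  by apply: diff_lin => x; exact: cvg_fst.
- exists (fun _ _ => 0), (fun _ _ => 1).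
  split; [exact: wpol_zero|rewrite subnn; exact: wpol_cst| |].
    move=> zt wt dz dw t _ hw; apply: cder_eq hw.
    by rewrite mul0r add0r mul1r.
  move=> q; have -> : (fun e : C2 R => 0 * e.1 + 1 * e.2) = snd.
    by apply/funext => e; rewrite mul0r add0r mul1r.
  apply: DiffDef.
    by apply: linear_differentiable => x; exact: cvg_snd.
  by apply: diff_lin => x; exact: cvg_snd.
- move=> n g1 g2 _ [gz1 [gw1 [pz1 pw1 hp1 hq1]]] _ [gz2 [gw2 [pz2 pw2 hp2 hq2]]].
  exists (fun z w => gz1 z w + gz2 z w), (fun z w => gw1 z w + gw2 z w).
  split; [exact: wpol_add|exact: wpol_add| |].
    move=> zt wt dz dw t hz hw.
    apply: cder_eq (cder_add (hp1 _ _ _ _ _ hz hw) (hp2 _ _ _ _ _ hz hw)).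
    ring.
  move=> q; apply: is_diff_eq (is_diffD (hq1 q) (hq2 q)) _.
  apply/funext => e; rewrite -[LHS]/(gz1 q.1 q.2 * e.1 + gw1 q.1 q.2 * e.2 +
    (gz2 q.1 q.2 * e.1 + gw2 q.1 q.2 * e.2)).
  by rewrite !mulrDl addrACA.
- move=> n1 n2 g1 g2 p1 [gz1 [gw1 [pz1 pw1 hp1 hq1]]].
  move=> p2 [gz2 [gw2 [pz2 pw2 hp2 hq2]]].
  exists (fun z w => g1 z w * gz2 z w + gz1 z w * g2 z w).
  exists (fun z w => g1 z w * gw2 z w + gw1 z w * g2 z w).
  split.
  + by apply: wpol_add; [apply: wpol_weaken (wpol_mul p1 pz2)|
      apply: wpol_weaken (wpol_mul pz1 p2)]; lia.
  + by apply: wpol_add; [apply: wpol_weaken (wpol_mul p1 pw2)|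
      apply: wpol_weaken (wpol_mul pw1 p2)]; lia.
  + move=> zt wt dz dw t hz hw.
    apply: cder_eq (cder_mul (hp1 _ _ _ _ _ hz hw) (hp2 _ _ _ _ _ hz hw)).
    ring.
  + move=> q; apply: is_diff_eq (is_diffM (hq1 q) (hq2 q)) _.
    apply/funext => e; rewrite -[LHS]/(
      g1 q.1 q.2 * (gz2 q.1 q.2 * e.1 + gw2 q.1 q.2 * e.2) +
      g2 q.1 q.2 * (gz1 q.1 q.2 * e.1 + gw1 q.1 q.2 * e.2)).
    rewrite !mulrDl !mulrDr !mulrA addrACA.
    by rewrite ![g2 _ _ * _]mulrC.
- move=> m n g mn _ [gz [gw [pz pw hp hq]]]; exists gz, gw; split=> //.
    by apply: wpol_weaken pz; lia.
  by apply: wpol_weaken pw; lia.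
Qed.

End HolomorphicPolynomials.

(** * Harmonic polynomials as real parts *)

Section Harmonic.
Variables (R : realType).
Let C := Cx R.
Implicit Types (f h : R3 R -> R).

Lemma derive_ex_path f (x y u d : R) : differentiable f (pt3 x y u) ->
  is_derive x 1 (fun t => f (pt3 t y u)) d -> 'D_(ex R) f (pt3 x y u) = d.
Proof.
move=> df [_ <-].
have [_ ->] := @is_derive_path R f id (cst y) (cst u) x 1 0 0 df
  (is_derive_id _ _) (is_derive_cst _ _ _) (is_derive_cst _ _ _).
have L (a b c : R) : a = a * 1 + b * 0 + c * 0.
  by rewrite !mulr0 !addr0 mulr1.
exact: L.
Qed.

Lemma derive_ey_path f (x y u d : R) : differentiable f (pt3 x y u) ->
  is_derive y 1 (fun t => f (pt3 x t u)) d -> 'D_(ey R) f (pt3 x y u) = d.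
Proof.
move=> df [_ <-].
have [_ ->] := @is_derive_path R f (cst x) id (cst u) y 0 1 0 df
  (is_derive_cst _ _ _) (is_derive_id _ _) (is_derive_cst _ _ _).
have L (a b c : R) : b = a * 0 + b * 1 + c * 0.
  by rewrite !mulr0 addr0 add0r mulr1.
exact: L.
Qed.

(** The real-valued f has a complex expansion S; its derivative is then the
derivative of S, which is real because S is. *)
Lemma derive_ex_complex f (S S' : R -> R -> R -> C) :
  (forall a, differentiable f a) ->
  (forall x y u, (f (pt3 x y u))%:C = S x y u) ->
  (forall x y u, cder (fun t => S t y u) (S' x y u) x) ->
  forall x y u, ('D_(ex R) f (pt3 x y u))%:C = S' x y u.
Proof.
move=> df fS dS x y u; have [dr di] := dS x y u.
have fE t : f (pt3 t y u) = complex.Re (S t y u) by rewrite -fS.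
have {}dr : is_derive x 1 (fun t => f (pt3 t y u)) (complex.Re (S' x y u)).
  by under eq_fun do rewrite fE.
rewrite (derive_ex_path (df _) dr).
have {}di : is_derive x 1 (cst (0 : R)) (complex.Im (S' x y u)).
  by apply: is_derive_ext di => // s; rewrite -fS.
have Im0 : complex.Im (S' x y u) = 0 by case: di => _ <-; exact: derive_cst.
by case: (S' x y u) Im0 => a b /= ->.
Qed.

Lemma derive_ey_complex f (S S' : R -> R -> R -> C) :
  (forall a, differentiable f a) ->
  (forall x y u, (f (pt3 x y u))%:C = S x y u) ->
  (forall x y u, cder (fun t => S x t u) (S' x y u) y) ->
  forall x y u, ('D_(ey R) f (pt3 x y u))%:C = S' x y u.
Proof.
move=> df fS dS x y u; have [dr di] := dS x y u.
have fE t : f (pt3 x t u) = complex.Re (S x t u) by rewrite -fS.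
have {}dr : is_derive y 1 (fun t => f (pt3 x t u)) (complex.Re (S' x y u)).
  by under eq_fun do rewrite fE.
rewrite (derive_ey_path (df _) dr).
have {}di : is_derive y 1 (cst (0 : R)) (complex.Im (S' x y u)).
  by apply: is_derive_ext di => // s; rewrite -fS.
have Im0 : complex.Im (S' x y u) = 0 by case: di => _ <-; exact: derive_cst.
by case: (S' x y u) Im0 => a b /= ->.
Qed.

(** The monomials in which homogeneous polynomials are written. *)
Definition mono (c : C) (i j l : nat) (x y u : R) : C :=
  c * (x +i* y) ^+ i * Num.conj (x +i* y : C) ^+ j * u%:C ^+ l.

(* the derivative of [mono] in a direction along which z and its conjugate
   have derivatives e and e' *)
Definition dmono (e e' c : C) (i j l : nat) (x y u : R) : C :=
  mono (e * i%:R * c) i.-1 j l x y u + mono (e' * j%:R * c) i j.-1 l x y u.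

Lemma cder_mono_x c i j l x y u :
  cder (fun t => mono c i j l t y u) (dmono 1 1 c i j l x y u) x.
Proof.
have dz : cder (fun t : R => (t +i* y : C)) 1 x.
  by split; [exact: is_derive_id|exact: is_derive_cst].
have dzb : cder (fun t : R => Num.conj (t +i* y : C)) 1 x.
  by split; [exact: is_derive_id|exact: is_derive_cst].
apply: cder_eq (cder_mul (cder_mul (cder_mul (cder_cst c x) (cder_exp i dz))
  (cder_exp j dzb)) (cder_cst (u%:C ^+ l) x)).
rewrite /dmono /mono.
move: (_ ^+ i) (_ ^+ i.-1) (_ ^+ j) (_ ^+ j.-1) (_ ^+ l) => a1 a2 a3 a4 a5.
ring.
Qed.

Lemma cder_mono_y c i j l x y u :
  cder (fun t => mono c i j l x t u) (dmono 'i (- 'i) c i j l x y u) y.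
Proof.
have dz : cder (fun t : R => (x +i* t : C)) 'i y.
  by split; [exact: is_derive_cst|exact: is_derive_id].
have dzb : cder (fun t : R => Num.conj (x +i* t : C)) (- 'i) y.
  split; first by rewrite /= oppr0; exact: is_derive_cst.
  exact: (is_deriveN (is_derive_id _ _)).
apply: cder_eq (cder_mul (cder_mul (cder_mul (cder_cst c y) (cder_exp i dz))
  (cder_exp j dzb)) (cder_cst (u%:C ^+ l) y)).
rewrite /dmono /mono.
move: (_ ^+ i) (_ ^+ i.-1) (_ ^+ j) (_ ^+ j.-1) (_ ^+ l) => a1 a2 a3 a4 a5.
ring.
Qed.

(** The second derivative of [mono] in the direction of [dmono]. *)
Definition ddmono (e e' c : C) (i j l : nat) (x y u : R) : C :=
  dmono e e' (e * i%:R * c) i.-1 j l x y u + dmono e e' (e' * j%:R * c) i j.-1 l x y u.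

(** The Laplacian is 4 d/dz d/dzbar.  Multiplication by z and its conjugate
removes the lowered exponents and the exceptions at exponent 0. *)
Lemma laplacian_mono c i j l x y u (z := (x +i* y : C)) :
  (ddmono 1 1 c i j l x y u + ddmono 'i (- 'i) c i j l x y u) * (z * Num.conj z)
  = 4 * mono (i%:R * j%:R * c) i j l x y u.
Proof.
have i2 : 'i * 'i = -1 :> C by rewrite -expr2 sqrCi.
transitivity ((i%:R * z ^+ i.-1 * z) * (j%:R * Num.conj z ^+ j.-1 * Num.conj z)
   * c * u%:C ^+ l * 4).
  rewrite /ddmono /dmono /mono -/z.
  move: (z ^+ i) (z ^+ i.-1) (z ^+ i.-1.-1) (Num.conj z ^+ j)
    (Num.conj z ^+ j.-1) (Num.conj z ^+ j.-1.-1) (_ ^+ l)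
    (i.-1%:R) (j.-1%:R) => a1 a2 a3 a4 a5 a6 a7 a8 a9.
  ring: i2.
have nX (a : C) n : n%:R * a ^+ n.-1 * a = n%:R * a ^+ n.
  by case: n => [|n]; rewrite ?mul0r //= -mulrA -exprSr.
rewrite !nX /mono -/z; ring.
Qed.

(** After multiplication by z and its conjugate, the vanishing Laplacian is an
identity between polynomials with coefficients 4 i j c i j l. *)
Lemma harmonic_coef0 h N (c : nat -> nat -> nat -> C) :
  (forall a, differentiable h a) -> (forall a, differentiable ('D_(ex R) h) a) ->
  (forall a, differentiable ('D_(ey R) h) a) ->
  (forall x y u, (h (pt3 x y u))%:C =
    \sum_(i < N) \sum_(j < N) \sum_(l < N) mono (c i j l) i j l x y u) ->
  (forall a, 'D_(ex R) ('D_(ex R) h) a + 'D_(ey R) ('D_(ey R) h) a = 0) ->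
  forall i j l, (0 < i < N)%N -> (0 < j < N)%N -> (l < N)%N -> c i j l = 0.
Proof.
move=> dh dhx dhy hE lap i j l /andP[i0 iN] /andP[j0 jN] lN.
have hx x y u := derive_ex_complex dh hE (fun x y u =>
  cder_sum (fun i => cder_sum (fun j => cder_sum (fun l =>
    cder_mono_x (c i j l) i j l x y u)))) x y u.
have hxx x y u := derive_ex_complex dhx hx (fun x y u =>
  cder_sum (fun i => cder_sum (fun j => cder_sum (fun l =>
    cder_add (cder_mono_x (1 * i%:R * c i j l) i.-1 j l x y u)
             (cder_mono_x (1 * j%:R * c i j l) i j.-1 l x y u))))) x y u.
have hy x y u := derive_ey_complex dh hE (fun x y u =>
  cder_sum (fun i => cder_sum (fun j => cder_sum (fun l =>
    cder_mono_y (c i j l) i j l x y u)))) x y u.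
have hyy x y u := derive_ey_complex dhy hy (fun x y u =>
  cder_sum (fun i => cder_sum (fun j => cder_sum (fun l =>
    cder_add (cder_mono_y ('i * i%:R * c i j l) i.-1 j l x y u)
             (cder_mono_y (- 'i * j%:R * c i j l) i j.-1 l x y u))))) x y u.
have S0 x y u : \sum_(i < N) \sum_(j < N) \sum_(l < N)
    4 * mono (i%:R * j%:R * c i j l) i j l x y u = 0.
  have S0 : ('D_(ex R) ('D_(ex R) h) (pt3 x y u))%:C +
            ('D_(ey R) ('D_(ey R) h) (pt3 x y u))%:C = 0 :> C.
    by rewrite -[LHS]rmorphD lap.
  have {}S0 := etrans (esym (congr2 +%R (hxx x y u) (hyy x y u))) S0.
  clear -S0; rewrite -big_split /= in S0.
  apply: etrans (mul0r ((x +i* y : C) * Num.conj (x +i* y : C))).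
  rewrite -[X in _ = X * _]S0.
  rewrite mulr_suml; apply: eq_bigr => i' _; rewrite -big_split /=.
  rewrite mulr_suml; apply: eq_bigr => j' _; rewrite -big_split /=.
  rewrite mulr_suml; apply: eq_bigr => l' _.
  by rewrite -laplacian_mono.
have : i%:R * j%:R * c i j l = 0.
  apply: (@conj_poly_coef0 R N (fun i j l => i%:R * j%:R * c i j l)) => // x y u.
  have four0 : (4 : C) != 0 by rewrite pnatr_eq0.
  apply: (mulfI four0); rewrite mulr0 -[RHS](S0 x y u).
  rewrite mulr_sumr; apply: eq_bigr => i' _.
  rewrite mulr_sumr; apply: eq_bigr => j' _.
  by rewrite mulr_sumr; apply: eq_bigr => l' _.
by move/eqP; rewrite !mulf_eq0 !pnatr_eq0 !gtn_eqF //= => /eqP.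
Qed.

End Harmonic.

Section HarmonicIsRe.
Variables (R : realType) (wz wu n : nat) (lam1 lam2 : rat).
Let C := Cx R.

Hypothesis wlt : forall m l, weight lam1 lam2 m l = 1 -> (m * wz + l * wu)%N = n.

(** A real harmonic polynomial has only pure powers of z and of its conjugate;
the latter have the same real parts as their conjugates, which are powers of z. *)
Lemma harmonic_Re (h : R3 R -> R) : homogeneous lam1 lam2 1 h ->
  (forall a, 'D_(ex R) ('D_(ex R) h) a + 'D_(ey R) ('D_(ey R) h) a = 0) ->
  exists2 q : C -> C -> C, wpol wz wu n q &
    forall x y u, h (pt3 x y u) = complex.Re (q (x +i* y) u%:C).
Proof.
move=> hh lap; have ph := homogeneous_poly3 hh; case: hh => N [c [c0 hE]].
have dh : forall a, differentiable h a := poly3_differentiable ph.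
have dhx := poly3_differentiable (poly3_derive (ex R) ph).
have dhy := poly3_differentiable (poly3_derive (ey R) ph).
have cE := harmonic_coef0 dh dhx dhy hE lap.
(* pure powers of the conjugate of z are replaced by their conjugates; there are
   no mixed terms by cE *)
pose b i j l := if (j == 0)%N then c i j l else
  if (i == 0)%N then Num.conj (c i j l) else 0.
exists (fun z w => \sum_(i < N) \sum_(j < N) \sum_(l < N)
   b i j l * z ^+ (i + j) * w ^+ l).
  apply: wpol_sum => i; apply: wpol_sum => j; apply: wpol_sum => l.
  have [b0|b0] := eqVneq (b i j l) 0.
    have -> : (fun z w : C => b i j l * z ^+ (i + j) * w ^+ l) = fun _ _ => 0.
      by apply/funext => z; apply/funext => w; rewrite b0 !mul0r.
    exact: wpol_zero.
  have cn0 : c i j l != 0.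
    move: b0; rewrite /b; case: ifP => // _; case: ifP; rewrite ?eqxx // => _.
    by rewrite conjC_eq0.
  rewrite -(wlt (c0 _ _ _ cn0)) -[((i + j) * wz)%N]add0n.
  apply: wpol_mul; [apply: wpol_mul|].
  - exact: wpol_cst.
  - by apply: wpol_exp; exact: wpol_z.
  - by apply: wpol_exp; exact: wpol_w.
move=> x y u; rewrite -[LHS]/(complex.Re (h (pt3 x y u))%:C) hE.
have Re_sum (F : 'I_N -> C) :
    complex.Re (\sum_(i < N) F i) = \sum_(i < N) complex.Re (F i).
  by apply: (big_morph (fun z : C => complex.Re z)) => // z w; exact: Re_add.
rewrite !Re_sum; apply: eq_bigr => i _; rewrite !Re_sum; apply: eq_bigr => j _.
rewrite !Re_sum; apply: eq_bigr => l _; rewrite /b.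
have [j0|j0] := eqVneq (j : nat) 0%N.
  by rewrite j0 addn0 expr0 mulr1.
have [i0|i0] := eqVneq (i : nat) 0%N; last first.
  by rewrite cE ?mul0r // lt0n ?i0 ?j0 ltn_ord.
rewrite i0 add0n expr0 mulr1.
have ReJ (z : C) : complex.Re (Num.conj z) = complex.Re z by case: z.
rewrite -[LHS]ReJ !rmorphM !rmorphXn /= conjCK.
suff -> : Num.conj (u%:C : C) = u%:C by [].
by congr (_ +i* _); rewrite oppr0.
Qed.

End HarmonicIsRe.

Section HolomorphicBounds.
Variables (R : realType) (wz wu : nat).
Let C := Cx R.

Lemma normcD (z w : C) : normc (z + w) <= normc z + normc w.
Proof. exact: le_normcD. Qed.

Lemma normc_ge0 (z : C) : 0 <= normc z.
Proof. by case: z => a b; exact: sqrtr_ge0. Qed.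

Lemma normc_i : normc ('i : C) = 1.
Proof. by rewrite /= expr0n /= add0r expr1n sqrtr1. Qed.

Lemma normcB (z w : C) : normc (z - w) = normc (w - z).
Proof. by rewrite -normcN opprB. Qed.

Lemma Re_normc (z : C) : `|complex.Re z| <= normc z.
Proof.
by case: z => a b /=; rewrite -sqrtr_sqr ler_wsqrtr // lerDl sqr_ge0.
Qed.

Lemma Im_normc (z : C) : `|complex.Im z| <= normc z.
Proof.
by case: z => a b /=; rewrite -sqrtr_sqr ler_wsqrtr // lerDr sqr_ge0.
Qed.

Lemma normc_ReIm (z : C) : normc z <= `|complex.Re z| + `|complex.Im z|.
Proof.
case: z => a b; have -> : (a +i* b : C) = (a +i* 0) + (0 +i* b).
  by congr (_ +i* _); rewrite /= ?addr0 ?add0r.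
apply: (le_trans (normcD _ _)).
by rewrite /= expr0n /= addr0 add0r !addr0 !add0r !sqrtr_sqr.
Qed.

(** A polynomial of weighted order n is O(s ^+ n) on the weighted polydisc of
size s. *)
Lemma wpol_bound n g : wpol wz wu n g -> forall B : R, 0 <= B ->
  exists2 c : R, 0 <= c & forall (s : R) z w, 0 <= s <= 1 ->
    normc z <= B * s ^+ wz -> normc w <= B * s ^+ wu ->
    normc (g z w) <= c * s ^+ n.
Proof.
move=> pg B B0; elim: pg => {n g}.
- move=> n; exists 0 => // s z w _ _ _; by rewrite normc0 mul0r.
- by move=> c; exists (normc c) => [|s z w _ _ _]; rewrite ?normc_ge0 ?mulr1.
- by exists B.
- by exists B.
- move=> n g1 g2 _ [c1 c10 H1] _ [c2 c20 H2]; exists (c1 + c2).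
    exact: addr_ge0.
  move=> s z w s01 zB wB; rewrite mulrDl (le_trans (normcD _ _)) // lerD //.
    exact: H1.
  exact: H2.
- move=> n1 n2 g1 g2 _ [c1 c10 H1] _ [c2 c20 H2]; exists (c1 * c2).
    exact: mulr_ge0.
  move=> s z w s01 zB wB; rewrite normcM exprD mulrACA.
  by rewrite ler_pM ?normc_ge0 // ?H1 ?H2.
- move=> m n g mn _ [c c0 H]; exists c => // s z w s01 zB wB.
  by rewrite (le_trans (H _ _ _ s01 zB wB)) // ler_wpM2l // expr_le_le1.
Qed.

(** The weighted modulus of continuity: moving z and w by the fraction eta of
the weighted polydisc of size s changes a polynomial of order n by O(eta * s ^+ n). *)
Lemma wpol_lipschitz n g : wpol wz wu n g -> forall B : R, 0 <= B ->
  exists2 c : R, 0 <= c & forall (s eta : R) z w z' w', 0 <= s <= 1 -> 0 <= eta ->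
    normc z <= B * s ^+ wz -> normc w <= B * s ^+ wu ->
    normc z' <= B * s ^+ wz -> normc w' <= B * s ^+ wu ->
    normc (z - z') <= eta * s ^+ wz -> normc (w - w') <= eta * s ^+ wu ->
    normc (g z w - g z' w') <= c * eta * s ^+ n.
Proof.
move=> pg B B0; elim: pg => {n g}.
- move=> n; exists 0 => // s eta z w z' w' *; by rewrite subrr normc0 !mul0r.
- move=> c; exists 0 => // s eta z w z' w' *; by rewrite subrr normc0 !mul0r.
- by exists 1 => // s eta z w z' w' *; rewrite mul1r.
- by exists 1 => // s eta z w z' w' *; rewrite mul1r.
- move=> n g1 g2 _ [c1 c10 H1] _ [c2 c20 H2]; exists (c1 + c2).
    exact: addr_ge0.
  move=> s eta z w z' w' s01 eta0 zB wB zB' wB' dz dw.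
  rewrite opprD addrACA !mulrDl (le_trans (normcD _ _)) // lerD //.
    exact: H1.
  exact: H2.
- move=> n1 n2 g1 g2 p1 [c1 c10 H1] p2 [c2 c20 H2].
  have [b1 b10 B1] := wpol_bound p1 B0; have [b2 b20 B2] := wpol_bound p2 B0.
  exists (c1 * b2 + b1 * c2); first by rewrite addr_ge0 ?mulr_ge0.
  move=> s eta z w z' w' s01 eta0 zB wB zB' wB' dz dw.
  have -> : g1 z w * g2 z w - g1 z' w' * g2 z' w' =
    (g1 z w - g1 z' w') * g2 z w + g1 z' w' * (g2 z w - g2 z' w') by ring.
  rewrite (le_trans (normcD _ _)) // !normcM exprD.
  have -> : (c1 * b2 + b1 * c2) * eta * (s ^+ n1 * s ^+ n2) =
    (c1 * eta * s ^+ n1) * (b2 * s ^+ n2) + (b1 * s ^+ n1) * (c2 * eta * s ^+ n2).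
    by ring.
  rewrite lerD // ler_pM ?normc_ge0 //.
  + exact: H1.
  + exact: B2.
  + exact: B1.
  + exact: H2.
- move=> m n g mn _ [c c0 H]; exists c => // s eta z w z' w' s01 e0 zB wB zB' wB' dz dw.
  by rewrite (le_trans (H _ _ _ _ _ _ s01 e0 zB wB zB' wB' dz dw)) // ler_wpM2l
    ?mulr_ge0 // expr_le_le1.
Qed.

End HolomorphicBounds.

(** * The Hessian in the z-direction *)

Section Hessian.
Variable (R : realType).
Implicit Types (f g : R3 R -> R) (a : R3 R).

(** The quadratic form of D2z, written out so that it can be estimated term by term. *)
Definition hess f a (p q : R) : R :=
  'D_(ex R) ('D_(ex R) f) a * p ^+ 2 +
  ('D_(ex R) ('D_(ey R) f) a + 'D_(ey R) ('D_(ex R) f) a) * (p * q) +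
  'D_(ey R) ('D_(ey R) f) a * q ^+ 2.

Lemma D2z_hess f a xi : D2z f a xi = hess f a (xi ord0) (xi ord_max).
Proof.
have Q (d : 'I_2 -> 'I_2 -> R) : \sum_(i < 2) \sum_(j < 2) d i j * xi i * xi j =
    d ord0 ord0 * xi ord0 ^+ 2 + (d ord0 ord_max + d ord_max ord0) *
    (xi ord0 * xi ord_max) + d ord_max ord_max * xi ord_max ^+ 2.
  rewrite !big_ord_recl !big_ord0.
  have -> : lift ord0 ord0 = ord_max :> 'I_2 by exact: val_inj.
  ring.
exact: (Q (fun i j => 'D_(zdir R i) ('D_(zdir R j) f) a)).
Qed.

Lemma hess_homogeneous f a (t p q : R) :
  hess f a (t * p) (t * q) = t ^+ 2 * hess f a p q.
Proof.
have Q (d11 d12 d21 d22 : R) : d11 * (t * p) ^+ 2 +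
    (d12 + d21) * (t * p * (t * q)) + d22 * (t * q) ^+ 2 =
    t ^+ 2 * (d11 * p ^+ 2 + (d12 + d21) * (p * q) + d22 * q ^+ 2) by ring.
exact: Q.
Qed.

Lemma hess_dir0 f a : hess f a 0 0 = 0.
Proof.
have := hess_homogeneous f a 0 0 0.
by move: (hess f a) => H; rewrite mul0r expr0n mul0r.
Qed.

(** A positive continuous function on the compact product of spheres has a
positive minimum; homogeneity extends the bound from unit directions to all. *)
Lemma hess_pos_compact f : poly3 f ->
  (forall x y u p q : R, x ^+ 2 + y ^+ 2 + u ^+ 2 = 1 -> p ^+ 2 + q ^+ 2 = 1 ->
     0 < hess f (pt3 x y u) p q) ->
  exists2 c : R, 0 < c & forall x y u p q : R, x ^+ 2 + y ^+ 2 + u ^+ 2 = 1 ->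
     c * (p ^+ 2 + q ^+ 2) <= hess f (pt3 x y u) p q.
Proof.
move=> pf fpos.
pose T := ((R * R * R) * (R * R))%type.
pose I := `[(-1 : R), 1]%classic.
pose N (b : T) := b.1.1.1 ^+ 2 + b.1.1.2 ^+ 2 + b.1.2 ^+ 2.
pose M (b : T) := b.2.1 ^+ 2 + b.2.2 ^+ 2.
pose K := ((I `*` I `*` I) `*` (I `*` I)) `&` (N @^-1` [set 1] `&` M @^-1` [set 1]).
have c111 : continuous (fun b : T => b.1.1.1).
  move=> b; apply: (@continuous_comp _ _ _ (fun b : T => b.1.1) fst); last exact: cvg_fst.
  apply: (@continuous_comp _ _ _ fst fst); exact: cvg_fst.
have c112 : continuous (fun b : T => b.1.1.2).
  move=> b; apply: (@continuous_comp _ _ _ (fun b : T => b.1.1) snd); last exact: cvg_snd.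
  apply: (@continuous_comp _ _ _ fst fst); exact: cvg_fst.
have c12 : continuous (fun b : T => b.1.2).
  by move=> b; apply: (@continuous_comp _ _ _ fst snd); [exact: cvg_fst|exact: cvg_snd].
have c21 : continuous (fun b : T => b.2.1).
  by move=> b; apply: (@continuous_comp _ _ _ snd fst); [exact: cvg_snd|exact: cvg_fst].
have c22 : continuous (fun b : T => b.2.2).
  by move=> b; apply: (@continuous_comp _ _ _ snd snd); exact: cvg_snd.
have sq (k : T -> R) : continuous k -> continuous (fun b => k b ^+ 2).
  by move=> ck b; under eq_fun do rewrite expr2; apply: continuousM; exact: ck.
have add (k l : T -> R) : continuous k -> continuous l -> continuous (fun b => k b + l b).
  by move=> ck cl b; apply: continuousD; [exact: ck|exact: cl].
have mul (k l : T -> R) : continuous k -> continuous l -> continuous (fun b => k b * l b).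
  by move=> ck cl b; apply: continuousM; [exact: ck|exact: cl].
have cN : continuous N by exact: add _ _ (add _ _ (sq _ c111) (sq _ c112)) (sq _ c12).
have cM : continuous M by exact: add _ _ (sq _ c21) (sq _ c22).
have cK : compact K.
  apply: compact_closedI.
    by do ![apply: compact_setX|exact: segment_compact].
  apply: closedI; apply: closed_comp => //; try exact: closed_eq.
pose H (b : T) := hess f b.1 b.2.1 b.2.2.
have cH : continuous H.
  have cD v w : continuous (fun b : T => 'D_v ('D_w f) b.1).
    move=> b; apply: (@continuous_comp _ _ _ fst ('D_v ('D_w f))); first exact: cvg_fst.
    apply: differentiable_continuous; apply: poly3_differentiable.
    by do 2 apply: poly3_derive.
  have cp2 := sq _ c21; have cq2 := sq _ c22.
  exact: (add _ _ (add _ _ (mul _ _ (cD (ex R) (ex R)) cp2)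
    (mul _ _ (add _ _ (cD (ex R) (ey R)) (cD (ey R) (ex R))) (mul _ _ c21 c22)))
    (mul _ _ (cD (ey R) (ey R)) cq2)).
have K0 : K !=set0.
  exists ((1, 0, 0), (1, 0)); rewrite /K /N /M /I /= !in_itv /=.
  rewrite !expr0n /= !expr1n !addr0.
  by do ! split => //; rewrite ?lexx ?ler01 ?ler0N1 ?oppr_le0 ?ler01 //; lra.
have [[[[x0 y0] u0] [p0 q0]]] := compact_EVT_min K0 cK (continuous_subspaceT cH).
rewrite inE => -[_ [/= N0 M0]] minK.
exists (H ((x0, y0, u0), (p0, q0))); first exact: fpos.
move=> x y u p q N1; move: (H _) minK => c minK.
have [pq0|pq0] := eqVneq (p ^+ 2 + q ^+ 2) 0.
  have /andP[/eqP p20 /eqP q20] : (p ^+ 2 == 0) && (q ^+ 2 == 0).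
    by rewrite -paddr_eq0 ?sqr_ge0 // pq0.
  move/eqP: p20; move/eqP: q20; rewrite !sqrf_eq0 => /eqP -> /eqP ->.
  by rewrite hess_dir0 expr0n /= addr0 mulr0.
pose r := Num.sqrt (p ^+ 2 + q ^+ 2).
have r2 : r ^+ 2 = p ^+ 2 + q ^+ 2 by rewrite sqr_sqrtr // addr_ge0 ?sqr_ge0.
have r0 : r != 0 by apply: contra_neq pq0 => r0; rewrite -r2 r0 expr0n.
have pE : p = r * (p / r) by rewrite mulrC divfK.
have qE : q = r * (q / r) by rewrite mulrC divfK.
rewrite [in leRHS]pE [in leRHS]qE hess_homogeneous r2 mulrC ler_wpM2l //.
  by rewrite addr_ge0 ?sqr_ge0.
have unit1 : (p / r) ^+ 2 + (q / r) ^+ 2 = 1.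
  by rewrite !expr_div_n -mulrDl r2 divff.
have bnd (a b e : R) : a ^+ 2 + b ^+ 2 + e ^+ 2 = 1 -> -1 <= a <= 1.
  move=> abe; rewrite -ler_norml -sqrtr_sqr -sqrtr1 ler_wsqrtr // -abe.
  by rewrite -addrA lerDl addr_ge0 ?sqr_ge0.
have := minK ((x, y, u), (p / r, q / r)); apply; rewrite inE /K /N /M /I /=.
have Z2 : (0 : R) ^+ 2 = 0 by rewrite expr0n.
rewrite !in_itv /=; split; [split; [split; [split|]|split]|split] => //.
- exact: (@bnd x y u).
- by apply: (@bnd y x u); rewrite [y ^+ 2 + _]addrC.
- by apply: (@bnd u x y); rewrite -N1; ring.
- by apply: (@bnd (p / r) (q / r) 0); rewrite Z2 addr0.
- by apply: (@bnd (q / r) (p / r) 0); rewrite Z2 addr0 addrC.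
Qed.

End Hessian.

(** * The sheared defining function along complex directions *)

Section LineDerivatives.
Variable R : realType.
Let C := Cx R.
Variables (F : R3 R -> R) (A : set (R3 R)).
Hypotheses (sF : smooth_on A F).
Variables (q gz gw gzz gzw gwz gww : C -> C -> C).
Hypotheses (dq : pathdiff q gz gw) (dgz : pathdiff gz gzz gzw)
  (dgw : pathdiff gw gwz gww).

(** The square of w adds Re w ^+ 2 = u ^+ 2 - v ^+ 2 to the defining function, which
is the source of convexity in u. *)
Definition Qfun (z w : C) : C := q z w + w ^+ 2.

(** The real part of w - i Q(z, w). *)
Definition Upath (z w : C) : R := complex.Re w + complex.Im (Qfun z w).

(** The point of C x R below the image of (z, w) under the shear. *)
Definition base (z w : C) : R3 R := pt3 (complex.Re z) (complex.Im z) (Upath z w).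

(** The defining function of D in the new coordinates: F - v at the image of (z, w)
under the shear. *)
Definition rr (z w : C) : R :=
  F (base z w) + complex.Re (Qfun z w) - complex.Im w.

(** First derivative of [Qfun] in the direction (zeta, om). *)
Definition Q1 (zeta om z w : C) : C := gz z w * zeta + (gw z w + 2 * w) * om.

(** Second derivative of [Qfun] in the direction (zeta, om). *)
Definition Q2 (zeta om z w : C) : C :=
  (gzz z w * zeta + gzw z w * om) * zeta +
  (gwz z w * zeta + gww z w * om + 2 * om) * om.

Definition U1 (zeta om z w : C) : R := complex.Re om + complex.Im (Q1 zeta om z w).

(** First derivative of [rr] in the direction (zeta, om). *)
Definition rr1 (zeta om z w : C) : R :=
  'D_(ex R) F (base z w) * complex.Re zeta + 'D_(ey R) F (base z w) * complex.Im zeta +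
  'D_(eu R) F (base z w) * U1 zeta om z w +
  complex.Re (Q1 zeta om z w) - complex.Im om.

Definition grad (f : R3 R -> R) (b : R3 R) (p1 p2 p3 : R) : R :=
  'D_(ex R) f b * p1 + 'D_(ey R) f b * p2 + 'D_(eu R) f b * p3.

(** Second derivative of [rr] in the direction (zeta, om). *)
Definition rr2 (zeta om z w : C) : R :=
  let b := base z w in let u1 := U1 zeta om z w in
  let p1 := complex.Re zeta in let p2 := complex.Im zeta in
  grad ('D_(ex R) F) b p1 p2 u1 * p1 + grad ('D_(ey R) F) b p1 p2 u1 * p2 +
  (grad ('D_(eu R) F) b p1 p2 u1 * u1 + 'D_(eu R) F b * complex.Im (Q2 zeta om z w)) +
  complex.Re (Q2 zeta om z w).

Section Line.
Variables z0 w0 zeta om : C.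
Let zt (t : R) := z0 + t%:C * zeta.
Let wt (t : R) := w0 + t%:C * om.

Lemma cder_zt t : cder zt zeta t. Proof. exact: cder_affine. Qed.
Lemma cder_wt t : cder wt om t. Proof. exact: cder_affine. Qed.

Lemma cder_Q t : cder (fun s => Qfun (zt s) (wt s)) (Q1 zeta om (zt t) (wt t)) t.
Proof.
apply: cder_eq (cder_add (dq (cder_zt t) (cder_wt t)) (cder_exp 2 (cder_wt t))).
have L (a b c : C) : a * zeta + b * om + 2%:R * c ^+ 1 * om =
    a * zeta + (b + 2 * c) * om by ring.
exact: L.
Qed.

Lemma cder_Q1 t : cder (fun s => Q1 zeta om (zt s) (wt s)) (Q2 zeta om (zt t) (wt t)) t.
Proof.
apply: cder_eq (cder_add (cder_mul (dgz (cder_zt t) (cder_wt t)) (cder_cst zeta t))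
  (cder_mul (cder_add (dgw (cder_zt t) (cder_wt t))
    (cder_mul (cder_cst 2 t) (cder_wt t))) (cder_cst om t))).
have L (a b c d e f g : C) : a * 0 + (d * zeta + e * om) * zeta +
    ((b + 2 * c) * 0 + (f * zeta + g * om + (2 * om + 0 * c)) * om) =
    (d * zeta + e * om) * zeta + (f * zeta + g * om + 2 * om) * om by ring.
exact: L.
Qed.

Lemma is_derive_Upath (t : R) : is_derive t 1 (fun s => Upath (zt s) (wt s))
   (U1 zeta om (zt t) (wt t)).
Proof. exact: is_deriveD (cder_wt t).1 (cder_Q t).2. Qed.

Lemma is_derive_base f (t : R) : differentiable f (base (zt t) (wt t)) ->
  is_derive t 1 (fun s => f (base (zt s) (wt s)))
    (grad f (base (zt t) (wt t)) (complex.Re zeta) (complex.Im zeta)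
        (U1 zeta om (zt t) (wt t))).
Proof.
move=> df; exact: (@is_derive_path R f (fun s => complex.Re (zt s))
  (fun s => complex.Im (zt s)) (fun s => Upath (zt s) (wt s)) t _ _ _ df
  (cder_zt t).1 (cder_zt t).2 (is_derive_Upath t)).
Qed.

Lemma is_derive_rr (t : R) : A (base (zt t) (wt t)) ->
  is_derive t 1 (fun s => rr (zt s) (wt s)) (rr1 zeta om (zt t) (wt t)).
Proof.
move=> Ab; have dF := is_derive_base (sF [::] Ab).
exact: is_deriveB (is_deriveD dF (cder_Q t).1) (cder_wt t).2.
Qed.

Lemma is_derive_rr1 (t : R) : A (base (zt t) (wt t)) ->
  is_derive t 1 (fun s => rr1 zeta om (zt s) (wt s)) (rr2 zeta om (zt t) (wt t)).
Proof.
move=> Ab.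
have dx := is_derive_base (sF [:: ex R] Ab).
have dy := is_derive_base (sF [:: ey R] Ab).
have du := is_derive_base (sF [:: eu R] Ab).
have dU1 : is_derive t 1 (fun s => U1 zeta om (zt s) (wt s))
    (complex.Im (Q2 zeta om (zt t) (wt t))).
  apply: is_derive_ext (is_deriveD (is_derive_cst (complex.Re om) t 1) (cder_Q1 t).2) => //.
  exact: add0r.
have mulc (k : R -> R) (d c : R) : is_derive t 1 k d ->
    is_derive t 1 (fun s => k s * c) (d * c).
  move=> dk; apply: is_derive_ext (is_deriveM dk (is_derive_cst c t 1)) => //.
  by rewrite scaler0 add0r [LHS]mulrC.
have prodU := is_deriveM du dU1.
apply: is_derive_ext (is_deriveB (is_deriveD (is_deriveD (is_deriveD
  (mulc _ _ (complex.Re zeta) dx) (mulc _ _ (complex.Im zeta) dy)) prodU)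
  (cder_Q1 t).1) (is_derive_cst (complex.Im om) t 1)) => //.
have L (a1 a2 a3 a4 a5 a6 a7 : R) :
  a1 + a2 + (a3 * a4 + a5 * a6) + a7 - 0 = a1 + a2 + (a6 * a5 + a3 * a4) + a7.
  by ring.
exact: L.
Qed.

End Line.

(** Both sides are the second derivative of h = Re q at t = 0 along
z + t zeta. *)
Lemma hess_Re_harmonic h : poly3 h ->
  (forall x y u, h (pt3 x y u) = complex.Re (q (x +i* y) u%:C)) ->
  forall (x y u : R) (zeta : C), hess h (pt3 x y u) (complex.Re zeta) (complex.Im zeta) =
    complex.Re (gzz (x +i* y) u%:C * zeta ^+ 2).
Proof.
move=> ph hE x y u zeta.
pose xt (t : R) := x + t * complex.Re zeta; pose yt (t : R) := y + t * complex.Im zeta.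
have czt (t : R) : cder (fun t => (xt t +i* yt t : C)) zeta t.
  by split; exact: is_derive_affine.
have dxt (t : R) : is_derive t 1 xt (complex.Re zeta) by exact: is_derive_affine.
have dyt (t : R) : is_derive t 1 yt (complex.Im zeta) by exact: is_derive_affine.
have dut (t : R) : is_derive t 1 (cst u) 0 by exact: is_derive_cst.
have h1 t : grad h (pt3 (xt t) (yt t) u) (complex.Re zeta) (complex.Im zeta) 0 =
            complex.Re (gz (xt t +i* yt t) u%:C * zeta).
  have [_ Eh] := @is_derive_path R h xt yt (cst u) t _ _ _ (poly3_differentiable ph _) (dxt t) (dyt t) (dut t).
  have [[_ E] _] := dq (czt t) (cder_cst u%:C t).
  have Ef : (fun s => h (pt3 (xt s) (yt s) (cst u s))) =
      (fun s => complex.Re (q (xt s +i* yt s) u%:C)).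
    by apply/funext => s; rewrite hE.
  apply: (etrans (esym Eh)); apply: (etrans (congr1 (fun k => 'D_1 k t) Ef)).
  by apply: (etrans E); rewrite mulr0 addr0.
have mulc (k : R -> R) (d c t : R) : is_derive t 1 k d ->
    is_derive t 1 (fun s => k s * c) (d * c).
  move=> dk; apply: is_derive_ext (is_deriveM dk (is_derive_cst c t 1)) => //.
  by rewrite scaler0 add0r [LHS]mulrC.
have dx := @is_derive_path R ('D_(ex R) h) xt yt (cst u) 0 _ _ _ (poly3_differentiable (poly3_derive (ex R) ph) _)
  (dxt 0) (dyt 0) (dut 0).
have dy := @is_derive_path R ('D_(ey R) h) xt yt (cst u) 0 _ _ _ (poly3_differentiable (poly3_derive (ey R) ph) _)
  (dxt 0) (dyt 0) (dut 0).
have [_ D1] := is_deriveD (mulc _ _ (complex.Re zeta) 0 dx) (mulc _ _ (complex.Im zeta) 0 dy).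
have [[_ D2] _] := cder_mul (dgz (czt 0) (cder_cst u%:C 0)) (cder_cst zeta 0).
have x0 : xt 0 = x by rewrite /xt mul0r addr0.
have y0 : yt 0 = y by rewrite /yt mul0r addr0.
have E : (fun s => 'D_(ex R) h (pt3 (xt s) (yt s) u) * complex.Re zeta) +
   (fun s => 'D_(ey R) h (pt3 (xt s) (yt s) u) * complex.Im zeta) =
   (fun s => complex.Re (gz (xt s +i* yt s) u%:C * zeta)).
  apply/funext => s; rewrite -h1.
  have L (a b c : R) : a + b = a + b + c * 0 by rewrite mulr0 addr0.
  exact: L.
have EE := etrans (esym D1) (etrans (congr1 (fun f => 'D_1 f (0 : R)) E) D2).
rewrite x0 y0 in EE.
transitivity (complex.Re (gz (x +i* y) u%:C * 0 +
  (gzz (x +i* y) u%:C * zeta + gzw (x +i* y) u%:C * 0) * zeta)); last first.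
  by rewrite !mulr0 add0r addr0 expr2 mulrA.
apply: etrans EE.
have L (a1 a2 a3 a4 a5 a6 p r : R) : a1 * p ^+ 2 + (a4 + a2) * (p * r) + a5 * r ^+ 2 =
  (a1 * p + a2 * r + a3 * 0) * p + (a4 * p + a5 * r + a6 * 0) * r by ring.
exact: L.
Qed.

End LineDerivatives.

(** * A perturbed quadratic form *)

Section NormalizedForm.
Variable R : realType.

(** The quadratic form to which the estimates reduce the second
derivative of rr: X stands for the size of zeta in the weighted scale, a and b for
|Re om| and |Im om|.  The terms A and 2 a^2 - 2 b^2 dominate, since b is small compared
with X + a by tangency; each other term carries a factor s and is at most quadratic in
X + a + b. *)
Lemma normalized_positive (c C : R) : 0 < c -> 0 <= C ->
  exists2 e0 : R, 0 < e0 & forall s eta X a b A t1 fuu fu q1 q2 r u1 : R,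
    0 <= s <= e0 -> 0 <= eta <= e0 -> 0 <= X -> 0 <= a -> 0 <= b ->
    b <= eta * (X + a) -> (c - C * s - C * eta) * X ^+ 2 <= A ->
    `|t1| <= C * (s * X) -> `|fuu| <= C * s -> `|fu| <= C * s ->
    `|q1| <= C * (s * (X + a + b)) -> `|u1| <= a + `|q1| ->
    `|q2| <= C * (X + a + b) ^+ 2 -> `|r| <= C * (s * (X + a + b) ^+ 2) ->
    c / 2 * X ^+ 2 + a ^+ 2 <=
      A + t1 * u1 + fuu * u1 ^+ 2 + fu * q2 + r + 2 * (a ^+ 2 - b ^+ 2).
Proof.
move=> c0 C0.
(* K bounds |u1| in terms of Z = X + a; M collects the constants of all error terms *)
pose K := 1 + 2 * C.
pose M := C * K + C * K ^+ 2 + 4 * C ^+ 2 + 4 * C + 2.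
have K0 : 0 <= K by rewrite /K; lra.
have M0 : 2 <= M.
  by rewrite /M lerDr !addr_ge0 ?mulr_ge0 ?sqr_ge0.
pose D := 2 * C + 4 * M.
have D0 : 0 < D by rewrite /D; lra.
exists (Num.min 1 (Num.min (c / 2 / D) (1 / D))).
  by rewrite !lt_min ltr01 !divr_gt0.
move=> s eta X a b A t1 fuu fu q1 q2 r u1.
rewrite !le_min => /andP[s0 /andP[s1 /andP[sc sD]]].
move=> /andP[e0 /andP[e1 /andP[ec eD]]] X0 a0 b0 bE hA ht1 hfuu hfu hq1 hu1 hq2 hr.
pose Z := X + a.
have Z0 : 0 <= Z by rewrite /Z; lra.
have bZ : b <= Z by apply: le_trans bE _; rewrite ler_piMl.
have SZ : X + a + b <= 2 * Z by rewrite /Z in bZ *; lra.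
have S0 : 0 <= X + a + b by lra.
have S2 : (X + a + b) ^+ 2 <= 4 * Z ^+ 2.
  have -> : 4 * Z ^+ 2 = (2 * Z) ^+ 2 by ring.
  by rewrite ler_pXn2r // nnegrE mulr_ge0.
have u1Z : `|u1| <= K * Z.
  apply: le_trans hu1 _; rewrite /K mulrDl mul1r lerD //; first by rewrite /Z; lra.
  apply: le_trans hq1 _; rewrite [2 * C]mulrC -mulrA ler_wpM2l //.
  by apply: le_trans SZ; rewrite ler_piMl.
pose Y := s * Z ^+ 2.
have Y0 : 0 <= Y by rewrite mulr_ge0 ?sqr_ge0.
have E1 : `|t1 * u1| <= C * K * Y.
  rewrite normrM (le_trans (ler_pM _ _ ht1 u1Z)) //.
  have -> : C * (s * X) * (K * Z) = C * K * (s * Z * X) by ring.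
  rewrite ler_wpM2l ?mulr_ge0 // /Y expr2 mulrA ler_wpM2l ?mulr_ge0 //.
  by rewrite /Z; lra.
have E2 : `|fuu * u1 ^+ 2| <= C * K ^+ 2 * Y.
  have -> : C * K ^+ 2 * Y = (C * s) * (K * Z) ^+ 2 by rewrite /Y; ring.
  rewrite normrM normrX ler_pM ?sqr_ge0 // ler_pXn2r ?nnegrE ?mulr_ge0 //.
have E3 : `|fu * q2| <= 4 * C ^+ 2 * Y.
  have -> : 4 * C ^+ 2 * Y = (C * s) * (C * (4 * Z ^+ 2)) by rewrite /Y; ring.
  by rewrite normrM ler_pM // (le_trans hq2) // ler_wpM2l.
have E4 : `|r| <= 4 * C * Y.
  apply: le_trans hr _; have -> : 4 * C * Y = C * (s * (4 * Z ^+ 2)) by rewrite /Y; ring.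
  by rewrite !ler_wpM2l.
have E5 : b ^+ 2 <= eta * Z ^+ 2.
  have -> : eta * Z ^+ 2 = (eta * Z) * Z by ring.
  by rewrite expr2 ler_pM.
have ZE : Z ^+ 2 <= 2 * X ^+ 2 + 2 * a ^+ 2.
  by have := sqr_ge0 (X - a); rewrite /Z; nra.
have MD : M * (s + eta) * Z ^+ 2 <= M * (s + eta) * (2 * X ^+ 2 + 2 * a ^+ 2).
  by apply: ler_wpM2l ZE; apply: mulr_ge0; [exact: le_trans M0|exact: addr_ge0].
have YM : C * K * Y + C * K ^+ 2 * Y + 4 * C ^+ 2 * Y + 4 * C * Y + 2 * (eta * Z ^+ 2)
    <= M * (s + eta) * Z ^+ 2.
  have : 0 <= (M - 2) * (eta * Z ^+ 2) by rewrite mulr_ge0 ?subr_ge0 // mulr_ge0 ?sqr_ge0.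
  have -> : M * (s + eta) * Z ^+ 2 = (C * K * Y + C * K ^+ 2 * Y + 4 * C ^+ 2 * Y +
      4 * C * Y + 2 * (eta * Z ^+ 2)) + (2 * Y + (M - 2) * (eta * Z ^+ 2)).
    by rewrite /M /Y; ring.
  by move=> ?; rewrite lerDl addr_ge0 // mulr_ge0.
have sD1 : D * s <= 1 by rewrite mulrC -ler_pdivlMr.
have eD1 : D * eta <= 1 by rewrite mulrC -ler_pdivlMr.
have scD : D * s <= c / 2 by rewrite mulrC -ler_pdivlMr.
have ecD : D * eta <= c / 2 by rewrite mulrC -ler_pdivlMr.
have N2 : 2 * M * (s + eta) <= 1.
  have : 0 <= C * s by rewrite mulr_ge0.
  have : 0 <= C * eta by rewrite mulr_ge0.
  by move: sD1 eD1; rewrite /D; lra.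
have N1 : C * s + C * eta + 2 * M * (s + eta) <= c / 2.
  have : 0 <= C * s by rewrite mulr_ge0.
  have : 0 <= C * eta by rewrite mulr_ge0.
  by move: scD ecD; rewrite /D; lra.
have P1 : (C * s + C * eta + 2 * M * (s + eta)) * X ^+ 2 <= c / 2 * X ^+ 2.
  by rewrite ler_wpM2r ?sqr_ge0.
have P2 : 2 * M * (s + eta) * a ^+ 2 <= 1 * a ^+ 2 by rewrite ler_wpM2r ?sqr_ge0.
move: E1 E2 E3 E4; rewrite !ler_norml => /andP[E1 _] /andP[E2 _] /andP[E3 _] /andP[E4 _].
clear - E1 E2 E3 E4 E5 P1 P2 YM MD hA.
lra.
Qed.

End NormalizedForm.

Section TaylorFamily.
Variables (R : realType) (wz wu : nat).
Hypotheses (wz0 : (0 < wz)%N) (wu0 : (0 < wu)%N).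

Lemma flat_iterD N (f : R3 R -> R) vs : all (mem (axes R)) vs ->
  flat wz wu N f -> flat wz wu (N - order_weight wz wu vs) (iterD vs f).
Proof.
move=> vsax ff; elim: vs vsax => [_|v vs IH /= /andP[vax /IH {}IH]].
  by rewrite /order_weight big_nil subn0.
by rewrite /order_weight big_cons addnC subnDA; exact: flat_derive.
Qed.

(** The later estimates combine several derivatives, which must share the radius
and the constant. *)
Lemma taylor_family A N (f : R3 R -> R) (L : seq (seq (R3 R))) :
  open A -> A 0 -> smooth_on A f -> flat wz wu N f ->
  all (all (mem (axes R))) L ->
  exists rho C : R, [/\ 0 < rho, 0 <= C & forall vs (s x y u : R), vs \in L ->
    0 <= s <= 1 -> s < rho -> `|x| <= 1 -> `|y| <= 1 -> `|u| <= 1 ->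
    `|iterD vs f (pt3 (s ^+ wz * x) (s ^+ wz * y) (s ^+ wu * u))| <=
      C * s ^+ (N - order_weight wz wu vs)].
Proof.
move=> oA A0 sf ff; elim: L => [_|vs L IH /= /andP[vsax /IH]].
  by exists 1, 0.
move=> [r1 [C1 [r10 C10 H1]]].
have [r2 [C2 [r20 C20 H2]]] := weighted_taylor wz0 wu0 ler01 oA A0
  (smooth_iterD vs sf) (flat_iterD vsax ff).
exists (Num.min r1 r2), (C1 + C2); rewrite addr_ge0 // lt_min r10 r20.
split=> // ws s x y u; rewrite lt_min inE => wsL s01 /andP[sr1 sr2] x1 y1 u1.
have /andP[s0 s1] := s01.
have bnd w a : (0 < w)%N -> `|a| <= 1 ->
    `|s ^+ w * a| <= 1 * s ^+ w /\ `|s ^+ w * a| < r2.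
  move=> w0 a1; have sw0 : 0 <= s ^+ w by rewrite exprn_ge0.
  have H : `|s ^+ w * a| <= s ^+ w by rewrite normrM (ger0_norm sw0) ler_piMr.
  rewrite mul1r; split=> //; apply: le_lt_trans sr2; apply: le_trans H _.
  by have := expr_le_le1 s01 w0; rewrite expr1.
have [bx1 bx2] := bnd _ _ wz0 x1; have [by1 by2] := bnd _ _ wz0 y1.
have [bu1 bu2] := bnd _ _ wu0 u1.
have sN k : 0 <= s ^+ k by rewrite exprn_ge0.
have [/eqP ->|wsL'] := orP wsL.
  apply: le_trans (H2 _ _ _ _ s01 bx1 by1 bu1 bx2 by2 bu2) _.
  by rewrite ler_wpM2r // lerDr.
apply: le_trans (H1 _ _ _ _ _ wsL' s01 sr1 x1 y1 u1) _.
by rewrite ler_wpM2r // lerDl.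
Qed.

End TaylorFamily.

(** * Estimates at points close to the real u-axis in w *)

Section MainEstimate.
Variables (R : realType) (wz wu n : nat).
Hypotheses (wz0 : (0 < wz)%N) (wu0 : (0 < wu)%N) (wzn : (wz < n)%N) (wun : (wu < n)%N).
Let C := Cx R.

(** The point z and the real number s^wu u form a point of the weighted sphere of
radius s, and w deviates from this real number by at most the fraction eta of the
weighted scale. *)
Definition near_axis (s eta x y u : R) (z w : C) : Prop :=
  [/\ 0 <= s <= 1, 0 <= eta <= 1, x ^+ 2 + y ^+ 2 + u ^+ 2 = 1,
      z = (s ^+ wz * x) +i* (s ^+ wz * y)
    & normc (w - (s ^+ wu * u)%:C) <= eta * s ^+ wu].

Lemma sphere_le1 (x y u : R) : x ^+ 2 + y ^+ 2 + u ^+ 2 = 1 ->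
  [/\ `|x| <= 1, `|y| <= 1 & `|u| <= 1].
Proof.
have bnd (a b e : R) : a ^+ 2 + (b ^+ 2 + e ^+ 2) = 1 -> `|a| <= 1.
  move=> abe; rewrite -sqrtr_sqr -sqrtr1 ler_wsqrtr // -abe.
  by rewrite lerDl addr_ge0 ?sqr_ge0.
move=> H; split.
- by apply: (bnd x y u); rewrite addrA.
- by apply: (bnd y x u); rewrite -H; ring.
- by apply: (bnd u x y); rewrite -H; ring.
Qed.

Lemma normc_real (a : R) : normc (a%:C : C) = `|a|.
Proof. by rewrite /= expr0n /= addr0 sqrtr_sqr. Qed.

Lemma near_axis_bound s eta x y u z w : near_axis s eta x y u z w ->
  [/\ normc z <= 2 * s ^+ wz, normc w <= 2 * s ^+ wu &
      normc ((s ^+ wu * u)%:C : C) <= 2 * s ^+ wu].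
Proof.
move=> [/andP[s0 s1] /andP[e0 e1] sph zE wE].
have [x1 y1 u1] := sphere_le1 sph.
have sN k : 0 <= s ^+ k by rewrite exprn_ge0.
have uE : normc ((s ^+ wu * u)%:C : C) <= s ^+ wu.
  by rewrite normc_real normrM ger0_norm // ler_piMr.
split.
- apply: le_trans (normc_ReIm _) _; rewrite zE /= !normrM !(ger0_norm (sN wz)).
  by rewrite mulr_natl mulr2n lerD // ler_piMr.
- rewrite -(subrK (s ^+ wu * u)%:C w) (le_trans (normcD _ _)) //.
  rewrite mulr_natl mulr2n lerD //; apply: le_trans wE _.
  by rewrite ler_piMl.
- by apply: le_trans uE _; rewrite mulr_natl mulr2n lerDl.
Qed.

Section DefiningFunction.
Variables (F : R3 R -> R) (A : set (R3 R)).
Hypotheses (oA : open A) (A0 : A 0) (sF : smooth_on A F).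
Hypothesis fF : flat wz wu (n + n) F.

(** Each bound is the weighted Taylor estimate for one derivative of F, of
weighted order n + n minus the weights of the directions.  Since wz < n and wu < n, a
factor s is left over in every case.  A derivative in z comes
with a component of zeta, which produces X = s^(n - wz) |zeta|. *)
Lemma defining_estimates : exists rho K : R, [/\ 0 < rho, 0 <= K &
  forall s eta x y u z w (zeta : C), near_axis s eta x y u z w -> s < rho ->
  let b := pt3 (s ^+ wz * x) (s ^+ wz * y) (s ^+ wu * u) in
  let X := s ^+ (n - wz) * normc zeta in
  let p := complex.Re zeta in let r := complex.Im zeta in
  [/\ `|'D_(ex R) F b * p + 'D_(ey R) F b * r| <= K * (s * X),
      `|'D_(eu R) F b| <= K * s,
      `|'D_(eu R) ('D_(ex R) F) b * p + 'D_(eu R) ('D_(ey R) F) b * r +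
        ('D_(ex R) ('D_(eu R) F) b * p + 'D_(ey R) ('D_(eu R) F) b * r)| <= K * (s * X),
      `|'D_(eu R) ('D_(eu R) F) b| <= K * s & `|F b| <= K * s ^+ (wu + 1)]].
Proof.
pose L := [:: [::]; [:: ex R]; [:: ey R]; [:: eu R]; [:: eu R; ex R]; [:: eu R; ey R];
  [:: ex R; eu R]; [:: ey R; eu R]; [:: eu R; eu R]].
have axx : ex R \in axes R by rewrite !inE eqxx.
have axy : ey R \in axes R by rewrite !inE eqxx orbT.
have axu : eu R \in axes R by rewrite !inE eqxx !orbT.
have Lax : all (all (mem (axes R))) L by rewrite /L /= axx axy axu.
have [rho [K [rho0 K0 H]]] := taylor_family wz0 wu0 oA A0 sF fF Lax.
exists rho, (4 * K); split=> //; first by rewrite mulr_ge0.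
have nz : (n - wz + 1 <= n + n - wz)%N by lia.
have nu : (1 <= n + n - wu)%N by lia.
have nuz : (n - wz + 1 <= n + n - (wu + wz))%N by lia.
have nuu : (1 <= n + n - (wu + wu))%N by lia.
have n0 : (wu + 1 <= n + n)%N by lia.
move=> s eta x y u z w zeta [s01 e01 sph zE wE] sr b X p r.
have [x1 y1 u1] := sphere_le1 sph.
have {}H vs : vs \in L -> `|iterD vs F b| <= K * s ^+ (n + n - order_weight wz wu vs).
  by move=> vsL; exact: H.
have [hx hy hu] := dir_weightE R wz wu.
have /andP[s0 s1] := s01.
have sN k : 0 <= s ^+ k by rewrite exprn_ge0.
have X0 : 0 <= X by rewrite mulr_ge0 ?normc_ge0.
have pz : `|p| <= normc zeta by exact: Re_normc.
have rz : `|r| <= normc zeta by exact: Im_normc.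
have one vs k d : vs \in L -> (k <= n + n - order_weight wz wu vs)%N ->
    d = iterD vs F b -> `|d| <= K * s ^+ k.
  by move=> vsL kn ->; apply: le_trans (H _ vsL) _; rewrite ler_wpM2l // expr_le_le1.
have two vs d e : vs \in L -> (n - wz + 1 <= n + n - order_weight wz wu vs)%N ->
    d = iterD vs F b -> `|e| <= normc zeta -> `|d * e| <= K * (s * X).
  move=> vsL kn dE ez; rewrite normrM.
  apply: le_trans (ler_pM _ _ (one _ _ _ vsL kn dE) ez) _ => //.
  by rewrite exprD expr1 /X -!mulrA ler_wpM2l // mulrCA.
have inL k : (k < 9)%N -> nth [::] L k \in L.
  by move=> k9; apply: (@mem_nth (seq (R3 R)) [::] L k).
have ow1 v : order_weight wz wu [:: v] = dir_weight wz wu v.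
  by rewrite /order_weight big_seq1.
have ow2 v v' : order_weight wz wu [:: v; v'] = (dir_weight wz wu v + dir_weight wz wu v')%N.
  by rewrite /order_weight big_cons big_seq1.
have sx : `|'D_(ex R) F b * p| <= K * (s * X).
  have vL : [:: ex R] \in L := inL 1 isT.
  have dE : ('D_(ex R) F) b = iterD [:: ex R] F b by [].
  apply: (two _ _ p vL _ dE pz); rewrite ow1 hx; exact: nz.
have sy : `|'D_(ey R) F b * r| <= K * (s * X).
  have vL : [:: ey R] \in L := inL 2 isT.
  have dE : ('D_(ey R) F) b = iterD [:: ey R] F b by [].
  apply: (two _ _ r vL _ dE rz); rewrite ow1 hy; exact: nz.
have su : `|'D_(eu R) F b| <= K * s.
  rewrite -[s in K * s]expr1.
  have vL : [:: eu R] \in L := inL 3 isT.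
  have dE : ('D_(eu R) F) b = iterD [:: eu R] F b by [].
  apply: (one _ _ _ vL _ dE); rewrite ow1 hu; exact: nu.
have sux : `|'D_(eu R) ('D_(ex R) F) b * p| <= K * (s * X).
  have vL : [:: eu R; ex R] \in L := inL 4 isT.
  have dE : ('D_(eu R) ('D_(ex R) F)) b = iterD [:: eu R; ex R] F b by [].
  apply: (two _ _ p vL _ dE pz); rewrite ow2 hx hu ?[(wz + wu)%N]addnC; exact: nuz.
have suy : `|'D_(eu R) ('D_(ey R) F) b * r| <= K * (s * X).
  have vL : [:: eu R; ey R] \in L := inL 5 isT.
  have dE : ('D_(eu R) ('D_(ey R) F)) b = iterD [:: eu R; ey R] F b by [].
  apply: (two _ _ r vL _ dE rz); rewrite ow2 hy hu ?[(wz + wu)%N]addnC; exact: nuz.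
have sxu : `|'D_(ex R) ('D_(eu R) F) b * p| <= K * (s * X).
  have vL : [:: ex R; eu R] \in L := inL 6 isT.
  have dE : ('D_(ex R) ('D_(eu R) F)) b = iterD [:: ex R; eu R] F b by [].
  apply: (two _ _ p vL _ dE pz); rewrite ow2 hx hu ?[(wz + wu)%N]addnC; exact: nuz.
have syu : `|'D_(ey R) ('D_(eu R) F) b * r| <= K * (s * X).
  have vL : [:: ey R; eu R] \in L := inL 7 isT.
  have dE : ('D_(ey R) ('D_(eu R) F)) b = iterD [:: ey R; eu R] F b by [].
  apply: (two _ _ r vL _ dE rz); rewrite ow2 hy hu ?[(wz + wu)%N]addnC; exact: nuz.
have suu : `|'D_(eu R) ('D_(eu R) F) b| <= K * s.
  rewrite -[s in K * s]expr1.
  have vL : [:: eu R; eu R] \in L := inL 8 isT.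
  have dE : ('D_(eu R) ('D_(eu R) F)) b = iterD [:: eu R; eu R] F b by [].
  apply: (one _ _ _ vL _ dE); rewrite ow2 hu; exact: nuu.
have s00 : `|F b| <= K * s ^+ (wu + 1).
  have vL : [::] \in L := inL 0 isT.
  have dE : F b = iterD [::] F b by [].
  apply: (one _ _ _ vL _ dE); rewrite /order_weight big_nil subn0; exact: n0.
have le4 Y : 0 <= Y -> K * Y <= 4 * K * Y.
  by move=> Y0; rewrite -mulrA ler_peMl ?mulr_ge0 // ler1n.
have le4' (Y a1 a2 : R) : 0 <= Y -> `|a1| <= K * Y -> `|a2| <= K * Y ->
    `|a1 + a2| <= 2 * (K * Y).
  move=> Y0 h1 h2; apply: le_trans (ler_normD _ _) _.
  by rewrite mulr_natl mulr2n lerD.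
have sX0 : 0 <= s * X by rewrite mulr_ge0.
have KsX0 : 0 <= K * (s * X) by rewrite mulr_ge0.
split.
- apply: le_trans (le4' _ _ _ sX0 sx sy) _; rewrite -mulrA ler_wpM2r //.
  by rewrite ler_nat.
- exact: le_trans su (le4 _ s0).
- apply: le_trans (ler_normD _ _) _.
  apply: le_trans (lerD (le4' _ _ _ sX0 sux suy) (le4' _ _ _ sX0 sxu syu)) _.
  by rewrite -mulrDl -natrD -mulrA.
- exact: le_trans suu (le4 _ s0).
- exact: le_trans s00 (le4 _ (sN _)).
Qed.

End DefiningFunction.

End MainEstimate.

(** One constant for all the bounds of [holomorphic_estimates]. *)
Lemma le_sum7 (R : realType) (k1 k2 k3 k4 k5 k6 k7 : R) :
  0 <= k1 -> 0 <= k2 -> 0 <= k3 -> 0 <= k4 -> 0 <= k5 -> 0 <= k6 -> 0 <= k7 ->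
  let K := k1 + k2 + 4 + k3 + k4 + k5 + k6 + k7 in
  [/\ k1 <= K, k2 + 4 <= K, k3 <= K, k4 + k5 <= K & k6 <= K /\ k7 <= K].
Proof.
move=> h1 h2 h3 h4 h5 h6 h7 K.
have KE : K = k1 + k2 + 4 + k3 + k4 + k5 + k6 + k7 by [].
by split; [lra|lra|lra|lra|split; lra].
Qed.

Section HolomorphicEstimates.
Variables (R : realType) (wz wu n : nat).
Hypotheses (wz0 : (0 < wz)%N) (wu0 : (0 < wu)%N) (wzn : (wz < n)%N) (wun : (wu < n)%N).
Let C := Cx R.
Variables (q gz gw gzz gzw gwz gww : C -> C -> C).
Hypotheses (pgz : wpol wz wu (n + n - wz) gz) (pgw : wpol wz wu (n + n - wu) gw)
  (pgzz : wpol wz wu (n + n - wz - wz) gzz) (pgzw : wpol wz wu (n + n - wz - wu) gzw)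
  (pgwz : wpol wz wu (n + n - wu - wz) gwz) (pgww : wpol wz wu (n + n - wu - wu) gww).

(** The analogue of [defining_estimates] for the partial derivatives of q.
The last bound replaces w by the nearby real number, so that gzz can be compared with
the Hessian of h, which lives on real values of w. *)
Lemma holomorphic_estimates : exists2 K : R, 0 <= K &
  forall s eta x y u z w (zeta : C), near_axis wz wu s eta x y u z w ->
  let X := s ^+ (n - wz) * normc zeta in
  [/\ normc (gz z w * zeta) <= K * (s * X), normc (gw z w + 2 * w) <= K * s,
      normc (gzz z w * zeta * zeta) <= K * X ^+ 2,
      normc ((gzw z w + gwz z w) * zeta) <= K * (s * X) /\ normc (gww z w) <= K * s
    & normc ((gzz z w - gzz z (s ^+ wu * u)%:C) * zeta ^+ 2) <= K * eta * X ^+ 2].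
Proof.
have ez : (n - wz + 1 <= n + n - wz)%N by lia.
have eu : (1 <= n + n - wu)%N by lia.
have ezz : (n + n - wz - wz)%N = (n - wz + (n - wz))%N by lia.
have ezu : (n - wz + 1 <= n + n - wz - wu)%N by lia.
have euz : (n - wz + 1 <= n + n - wu - wz)%N by lia.
have euu : (1 <= n + n - wu - wu)%N by lia.
have two0 : 0 <= 2 :> R by [].
have [k1 k10 H1] := wpol_bound pgz two0; have [k2 k20 H2] := wpol_bound pgw two0.
have [k3 k30 H3] := wpol_bound pgzz two0; have [k4 k40 H4] := wpol_bound pgzw two0.
have [k5 k50 H5] := wpol_bound pgwz two0; have [k6 k60 H6] := wpol_bound pgww two0.
have [k7 k70 H7] := wpol_lipschitz pgzz two0.
have [K1 K2 K3 K4 [K6 K7]] := le_sum7 k10 k20 k30 k40 k50 k60 k70.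
exists (k1 + k2 + 4 + k3 + k4 + k5 + k6 + k7); first by rewrite !addr_ge0.
move=> s eta x y u z w zeta H X; have [s01 /andP[e0 e1] sph zE wE] := H.
have [zB wB uB] := near_axis_bound H.
have /andP[s0 s1] := s01.
have sN k : 0 <= s ^+ k by rewrite exprn_ge0.
have X0 : 0 <= X by rewrite mulr_ge0 ?normc_ge0.
have weak (g : C) k m (c : R) : 0 <= c -> (m <= k)%N -> normc g <= c * s ^+ k ->
    normc g <= c * s ^+ m.
  by move=> c0 mk gk; apply: le_trans gk _; rewrite ler_wpM2l // expr_le_le1.
have weakX (g : C) k (c : R) : 0 <= c -> (n - wz + 1 <= k)%N ->
    normc g <= c * s ^+ k -> normc (g * zeta) <= c * (s * X).
  move=> c0 mk gk; rewrite normcM.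
  apply: (@le_trans _ _ (c * s ^+ (n - wz + 1) * normc zeta)).
    by rewrite ler_wpM2r ?normc_ge0 //; exact: weak gk.
  by rewrite exprD expr1 /X -!mulrA ler_wpM2l // mulrCA.
have sX0 : 0 <= s * X by rewrite mulr_ge0.
have X20 : 0 <= X ^+ 2 by rewrite sqr_ge0.
have X2E : X ^+ 2 = s ^+ (n + n - wz - wz) * normc zeta * normc zeta.
  by rewrite ezz exprD /X; ring.
have up (a k Y : R) : a <= k * Y -> 0 <= Y ->
    k <= k1 + k2 + 4 + k3 + k4 + k5 + k6 + k7 ->
    a <= (k1 + k2 + 4 + k3 + k4 + k5 + k6 + k7) * Y.
  by move=> h Y0 kK; apply: le_trans h _; rewrite ler_wpM2r.
split.
- apply: (up _ k1) => //.
  exact: weakX (H1 _ _ _ s01 zB wB).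
- apply: (up _ (k2 + 4)) => //.
  have h2 := weak _ _ 1%N _ k20 eu (H2 _ _ _ s01 zB wB); rewrite expr1 in h2.
  apply: le_trans (normcD _ _) _; rewrite [leRHS]mulrDl lerD // normcM.
  have -> : normc (2 : C) = 2.
    have -> : (2 : C) = (2 : R)%:C.
      by apply/eqP; rewrite eq_complex /= addr0 !eqxx.
    by rewrite normc_real ger0_norm.
  have -> : 4 * s = 2 * (2 * s) by ring.
  rewrite ler_wpM2l //; apply: le_trans wB _; rewrite ler_wpM2l //.
  by have := expr_le_le1 s01 wu0; rewrite expr1.
- apply: (up _ k3) => //.
  rewrite !normcM X2E !mulrA !ler_wpM2r ?normc_ge0 //.
  exact: H3.
- split.
    apply: (up _ (k4 + k5)) => //.
    rewrite mulrDl; apply: le_trans (normcD _ _) _; rewrite [leRHS]mulrDl lerD //.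
      exact: weakX (H4 _ _ _ s01 zB wB).
    exact: weakX (H5 _ _ _ s01 zB wB).
  apply: (up _ k6) => //.
  by have := weak _ _ 1%N _ k60 euu (H6 _ _ _ s01 zB wB); rewrite expr1.
- rewrite -mulrA; apply: (up _ k7) => //.
    have zz : normc (z - z) <= eta * s ^+ wz by rewrite subrr normc0 mulr_ge0.
    have := H7 _ _ _ _ _ _ s01 e0 zB wB zB uB zz wE.
    move=> h7; rewrite normcM expr2 normcM X2E.
    have -> : k7 * (eta * (s ^+ (n + n - wz - wz) * normc zeta * normc zeta)) =
      k7 * eta * s ^+ (n + n - wz - wz) * (normc zeta * normc zeta) by ring.
    by rewrite ler_wpM2r // mulr_ge0 ?normc_ge0.
  exact: mulr_ge0.
Qed.

End HolomorphicEstimates.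

Section HessianLowerBound.
Variables (R : realType) (wz wu n : nat).
Hypotheses (wz0 : (0 < wz)%N) (wu0 : (0 < wu)%N) (wzn : (wz < n)%N) (wun : (wu < n)%N).
Let C := Cx R.
Variables (F : R3 R -> R) (A : set (R3 R)).
Hypotheses (oA : open A) (A0 : A 0) (sF : smooth_on A F).

Lemma hessD (f g : R3 R -> R) a p r : poly3 f -> poly3 g ->
  hess (fun b => f b + g b) a p r = hess f a p r + hess g a p r.
Proof.
move=> pf pg.
have dd v v' : 'D_v ('D_v' (fun b => f b + g b)) a = 'D_v ('D_v' f) a + 'D_v ('D_v' g) a.
  have -> : 'D_v' (fun b => f b + g b) = (fun b => 'D_v' f b + 'D_v' g b).
    by apply/funext => b; apply: deriveD;
      apply: diff_derivable; exact: poly3_differentiable.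
  by apply: deriveD; apply: diff_derivable; apply: poly3_differentiable; exact: poly3_derive.
have L (a1 a2 a3 a4 b1 b2 b3 b4 c1 c2 c3 c4 : R) : c1 = a1 + b1 -> c2 = a2 + b2 ->
  c3 = a3 + b3 -> c4 = a4 + b4 ->
  c1 * p ^+ 2 + (c2 + c3) * (p * r) + c4 * r ^+ 2 =
  (a1 * p ^+ 2 + (a2 + a3) * (p * r) + a4 * r ^+ 2) +
  (b1 * p ^+ 2 + (b2 + b3) * (p * r) + b4 * r ^+ 2).
  by move=> -> -> -> ->; ring.
by apply: L; apply: dd.
Qed.

Lemma hessB_on (f : R3 R -> R) a p r : A a -> poly3 f ->
  hess (fun b => F b - f b) a p r = hess F a p r - hess f a p r.
Proof.
move=> Aa pf.
have dd v v' : 'D_v ('D_v' (fun b => F b - f b)) a = 'D_v ('D_v' F) a - 'D_v ('D_v' f) a.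
  exact: (iterDB [:: v; v'] oA sF (poly3_smooth pf) Aa).
have L (a1 a2 a3 a4 b1 b2 b3 b4 c1 c2 c3 c4 : R) : c1 = a1 - b1 -> c2 = a2 - b2 ->
  c3 = a3 - b3 -> c4 = a4 - b4 ->
  c1 * p ^+ 2 + (c2 + c3) * (p * r) + c4 * r ^+ 2 =
  (a1 * p ^+ 2 + (a2 + a3) * (p * r) + a4 * r ^+ 2) -
  (b1 * p ^+ 2 + (b2 + b3) * (p * r) + b4 * r ^+ 2).
  by move=> -> -> -> ->; ring.
by apply: L; apply: dd.
Qed.

(** F - P is flat of order one more than P, which gives the factor s. *)
Lemma hess_remainder (E : R3 R -> R) : smooth_on A E -> flat wz wu (n + n).+1 E ->
  exists rho K : R, [/\ 0 < rho, 0 <= K &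
  forall (s x y u p r m : R), 0 <= s <= 1 -> s < rho ->
   `|x| <= 1 -> `|y| <= 1 -> `|u| <= 1 -> `|p| <= m -> `|r| <= m ->
  `|hess E (pt3 (s ^+ wz * x) (s ^+ wz * y) (s ^+ wu * u)) p r|
     <= K * s * (s ^+ (n - wz) * m) ^+ 2].
Proof.
move=> sE fE.
pose L := [:: [:: ex R; ex R]; [:: ex R; ey R]; [:: ey R; ex R]; [:: ey R; ey R]].
have axx : ex R \in axes R by rewrite !inE eqxx.
have axy : ey R \in axes R by rewrite !inE eqxx orbT.
have Lax : all (all (mem (axes R))) L by rewrite /L /= axx axy.
have [rho [K [rho0 K0 H]]] := taylor_family wz0 wu0 oA A0 sE fE Lax.
exists rho, (4 * K); split=> //; first by rewrite mulr_ge0.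
have nzz : ((n + n).+1 - (wz + wz))%N = (1 + ((n - wz) + (n - wz)))%N by lia.
have [hx hy _] := dir_weightE R wz wu.
have inL k : (k < 4)%N -> nth [::] L k \in L.
  by move=> k9; apply: (@mem_nth (seq (R3 R)) [::] L k).
have ow2 v v' : order_weight wz wu [:: v; v'] = (dir_weight wz wu v + dir_weight wz wu v')%N.
  by rewrite /order_weight big_cons big_seq1.
move=> s x y u p r m s01 sr x1 y1 u1 pm rm; set b := pt3 _ _ _.
have m0 : 0 <= m by apply: le_trans pm.
have bnd vs : vs \in L -> order_weight wz wu vs = (wz + wz)%N ->
    `|iterD vs E b| <= K * (s * (s ^+ (n - wz)) ^+ 2).
  move=> vsL ow; have := H vs s x y u vsL s01 sr x1 y1 u1.
  by rewrite ow nzz exprD expr1 exprD -expr2; exact.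
have b11 : `|'D_(ex R) ('D_(ex R) E) b| <= K * (s * (s ^+ (n - wz)) ^+ 2).
  by apply: (bnd _ (inL 0%N isT)); rewrite /= ow2 hx.
have b12 : `|'D_(ex R) ('D_(ey R) E) b| <= K * (s * (s ^+ (n - wz)) ^+ 2).
  by apply: (bnd _ (inL 1%N isT)); rewrite /= ow2 hx hy.
have b21 : `|'D_(ey R) ('D_(ex R) E) b| <= K * (s * (s ^+ (n - wz)) ^+ 2).
  by apply: (bnd _ (inL 2%N isT)); rewrite /= ow2 hx hy.
have b22 : `|'D_(ey R) ('D_(ey R) E) b| <= K * (s * (s ^+ (n - wz)) ^+ 2).
  by apply: (bnd _ (inL 3%N isT)); rewrite /= ow2 hy.
have Q (d11 d12 d21 d22 T : R) : `|d11| <= T -> `|d12| <= T -> `|d21| <= T -> `|d22| <= T ->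
  `|d11 * p ^+ 2 + (d12 + d21) * (p * r) + d22 * r ^+ 2| <= 4 * (T * m ^+ 2).
  move=> h11 h12 h21 h22.
  have T0 : 0 <= T by apply: le_trans h11.
  have pr (d a a' : R) : `|d| <= T -> `|a| <= m -> `|a'| <= m -> `|d * (a * a')| <= T * m ^+ 2.
    by move=> hd ha ha'; rewrite !normrM expr2 !ler_pM // mulr_ge0.
  rewrite mulrDl !expr2.
  have -> : 4 * (T * (m * m)) = T * m ^+ 2 + (T * m ^+ 2 + T * m ^+ 2) + T * m ^+ 2.
    by ring.
  apply: le_trans (ler_normD _ _) _; apply: lerD; last exact: pr.
  apply: le_trans (ler_normD _ _) _; apply: lerD; first exact: pr.
  by apply: le_trans (ler_normD _ _) _; apply: lerD; exact: pr.
have -> : 4 * K * s * (s ^+ (n - wz) * m) ^+ 2 =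
    4 * (K * (s * (s ^+ (n - wz)) ^+ 2) * m ^+ 2).
  by move: (s ^+ (n - wz)) => t; ring.
exact: (Q _ _ _ _ _ b11 b12 b21 b22).
Qed.

End HessianLowerBound.

(** * Lower bound for the Hessian *)

(** Each of the four second derivatives scales by the power
n + n - (wz + wz) of s. *)
Lemma hess_dil (R : realType) (wz wu n : nat) (f : R3 R -> R) (s : R) a p r :
  (wz < n)%N -> poly3 f -> s != 0 ->
  (forall a, f (dil wz wu s a) = s ^+ (n + n) * f a) ->
  hess f (dil wz wu s a) p r = (s ^+ (n - wz)) ^+ 2 * hess f a p r.
Proof.
move=> wzn pf s0 fs.
have axx : ex R \in axes R by rewrite !inE eqxx.
have axy : ey R \in axes R by rewrite !inE eqxx orbT.
have [hx hy _] := dir_weightE R wz wu.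
have nn : ((n - wz) * 2 + (wz + wz) = n + n)%N by lia.
have H v v' : v \in axes R -> v' \in axes R -> dir_weight wz wu v = wz ->
   dir_weight wz wu v' = wz ->
   'D_v ('D_v' f) (dil wz wu s a) = (s ^+ (n - wz)) ^+ 2 * 'D_v ('D_v' f) a.
  move=> vax vax' hv hv'.
  have vsax : all (mem (axes R)) [:: v; v'] by rewrite /= vax vax'.
  apply: (etrans (iterD_dil vsax s0 pf fs a)); congr (_ * _).
  rewrite /order_weight big_cons big_seq1 hv hv' -exprM -nn exprD mulfK //.
  by rewrite expf_neq0.
have L (t a1 a2 a3 a4 c1 c2 c3 c4 : R) : c1 = t * a1 -> c2 = t * a2 ->
  c3 = t * a3 -> c4 = t * a4 ->
  c1 * p ^+ 2 + (c2 + c3) * (p * r) + c4 * r ^+ 2 =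
  t * (a1 * p ^+ 2 + (a2 + a3) * (p * r) + a4 * r ^+ 2).
  by move=> -> -> -> ->; ring.
exact: (L _ _ _ _ _ _ _ _ _ (H _ _ axx axx hx hx) (H _ _ axx axy hx hy)
  (H _ _ axy axx hy hx) (H _ _ axy axy hy hy)).
Qed.

Lemma lower_bound_arith (R : realType) (c K1 K2 s eta t1 t2 t3 t4 t5 t6 t7 Y : R) :
  0 <= s -> 0 <= eta -> 0 <= K1 -> 0 <= K2 -> 0 <= Y ->
  t1 = t2 - t3 -> t5 = t3 + t4 -> t4 = t7 ->
  c * Y <= t5 -> `|t1| <= K2 * s * Y -> `|t6 - t7| <= K1 * eta * Y ->
  (c - (K1 + K2) * s - (K1 + K2) * eta) * Y <= t2 + t6.
Proof.
move=> s0 e0 K10 K20 Y0 E1 E2 E3 b1; rewrite !ler_norml => /andP[b2 _] /andP[b3 _].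
have : 0 <= K1 * (s * Y) by rewrite !mulr_ge0.
have : 0 <= K2 * (eta * Y) by rewrite !mulr_ge0.
lra.
Qed.

Section Positivity.
Variables (R : realType) (wz wu n : nat).
Hypotheses (wz0 : (0 < wz)%N) (wu0 : (0 < wu)%N) (wzn : (wz < n)%N) (wun : (wu < n)%N).
Let C := Cx R.
Variables (F P h : R3 R -> R) (A : set (R3 R)).
Hypotheses (oA : open A) (A0 : A 0) (sF : smooth_on A F).
Hypotheses (pP : poly3 P) (ph : poly3 h).
Hypotheses (fF : flat wz wu (n + n) F) (fE : flat wz wu (n + n).+1 (fun a => F a - P a)).
Hypothesis dilPh : forall s a,
  P (dil wz wu s a) + h (dil wz wu s a) = s ^+ (n + n) * (P a + h a).
Variable c : R.
Hypothesis c0 : 0 < c.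
Hypothesis hessPh : forall x y u p r : R, x ^+ 2 + y ^+ 2 + u ^+ 2 = 1 ->
  c * (p ^+ 2 + r ^+ 2) <= hess (fun a => P a + h a) (pt3 x y u) p r.
Variables (q gz gw gzz gzw gwz gww : C -> C -> C).
Hypotheses (pgz : wpol wz wu (n + n - wz) gz) (pgw : wpol wz wu (n + n - wu) gw)
  (pgzz : wpol wz wu (n + n - wz - wz) gzz) (pgzw : wpol wz wu (n + n - wz - wu) gzw)
  (pgwz : wpol wz wu (n + n - wu - wz) gwz) (pgww : wpol wz wu (n + n - wu - wu) gww).
Hypotheses (dq : pathdiff q gz gw) (dgz : pathdiff gz gzz gzw).
Hypothesis hE : forall x y u, h (pt3 x y u) = complex.Re (q (x +i* y) u%:C).

(** The Hessian of F plus Re gzz zeta^2 is the Hessian of P + h up to the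
remainder F - P and the replacement of real by complex w in gzz.  The main part is at
least c X^2 by homogeneity and the bound on the sphere. *)
Lemma hess_lower_bound : exists rho K : R, [/\ 0 < rho, 0 <= K &
  forall s eta x y u z w (zeta : C), near_axis wz wu s eta x y u z w ->
  0 < s < rho ->
  (c - K * s - K * eta) * (s ^+ (n - wz) * normc zeta) ^+ 2 <=
  hess F (pt3 (s ^+ wz * x) (s ^+ wz * y) (s ^+ wu * u))
    (complex.Re zeta) (complex.Im zeta) + complex.Re (gzz z w * zeta ^+ 2)].
Proof.
have sE : smooth_on A (fun a => F a - P a).
  by apply: smooth_onB => //; exact: poly3_smooth.
have [K1 K10 H1] := holomorphic_estimates wz0 wu0 wzn wun pgz pgw pgzz pgzw pgwz pgww.
have [r2 [K2 [r20 K20 H2]]] := hess_remainder wz0 wu0 wzn wun oA A0 sE fE.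
have [d d0 Hd] := nbhs0_pt3 (open_nbhs_nbhs (conj oA A0)).
exists (Num.min r2 d), (K1 + K2); split; [by rewrite lt_min r20|exact: addr_ge0|].
move=> s eta x y u z w zeta H /andP[s0]; rewrite lt_min => /andP[sr sd].
have [s01 /andP[e0 e1] sph zE wE] := H; have /andP[_ s1] := s01.
have [x1 y1 u1] := sphere_le1 sph.
set b := pt3 _ _ _; set p := complex.Re zeta; set r := complex.Im zeta.
set X := s ^+ (n - wz) * normc zeta.
have inA k a : (0 < k)%N -> `|a| <= 1 -> `|s ^+ k * a| < d.
  move=> k0 a1; rewrite normrM (ger0_norm (exprn_ge0 _ (ltW s0))).
  apply: le_lt_trans sd; apply: le_trans (ler_piMr (exprn_ge0 _ (ltW s0)) a1) _.
  by have := expr_le_le1 s01 k0; rewrite expr1.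
have Ab : A b by apply: Hd; apply: inA.
have pr2 : p ^+ 2 + r ^+ 2 = normc zeta ^+ 2.
  rewrite /p /r; case: (zeta) => zr zi /=.
  by rewrite sqr_sqrtr // addr_ge0 ?sqr_ge0.
have E1 := hessB_on oA sF p r Ab pP.
have E2 := hessD b p r pP ph.
have E3 := hess_Re_harmonic dq dgz ph hE (s ^+ wz * x) (s ^+ wz * y) (s ^+ wu * u) zeta.
have E4 : hess (fun a => P a + h a) b p r =
    (s ^+ (n - wz)) ^+ 2 * hess (fun a => P a + h a) (pt3 x y u) p r.
  exact: (hess_dil (pt3 x y u) p r wzn (poly3_add pP ph) (lt0r_neq0 s0) (dilPh s)).
have B1 := hessPh p r sph.
have B2 := H2 _ _ _ _ _ _ _ s01 sr x1 y1 u1 (Re_normc zeta) (Im_normc zeta).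
have [_ _ _ _ B3] := H1 _ _ _ _ _ _ _ zeta H.
rewrite -zE in E3.
have {}B3 : `|complex.Re (gzz z w * zeta ^+ 2) -
    complex.Re (gzz z (s ^+ wu * u)%:C * zeta ^+ 2)| <= K1 * eta * X ^+ 2.
  have -> : complex.Re (gzz z w * zeta ^+ 2) -
      complex.Re (gzz z (s ^+ wu * u)%:C * zeta ^+ 2) =
      complex.Re ((gzz z w - gzz z (s ^+ wu * u)%:C) * zeta ^+ 2).
    by rewrite mulrBl Re_add; case: (gzz z (s ^+ wu * u)%:C * zeta ^+ 2).
  exact: le_trans (Re_normc _) B3.
have {}B1 : c * X ^+ 2 <= hess (fun a => P a + h a) b p r.
  rewrite E4 /X exprMn -pr2 mulrCA ler_wpM2l // exprn_ge0 //.
  by rewrite exprn_ge0 ?ltW.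
exact: (lower_bound_arith (ltW s0) e0 K10 K20 (sqr_ge0 X) E1 E2 E3 B1 B2 B3).
Qed.

End Positivity.

(** * Positivity of the second derivative in tangent directions *)

Section Arithmetic.
Variable R : realType.

(** Tangency expresses Im om as the sum of the terms f, fu u1 and rq, each of
which is small. *)
Lemma tangent_arith (K s X a b f fu u1 rq q1 : R) : 0 <= K -> 0 <= s <= 1 ->
  0 <= X -> 0 <= a -> 0 <= b -> `|f| <= K * (s * X) -> `|fu| <= K * s ->
  `|rq| <= K * (s * (X + a + b)) -> `|q1| <= K * (s * (X + a + b)) ->
  `|u1| <= a + `|q1| -> b <= `|f + fu * u1 + rq| ->
  b <= (3 * K + K ^+ 2) * s * (X + a + b).
Proof.
move=> K0 /andP[s0 s1] X0 a0 b0 hf hfu hrq hq1 hu1 hb.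
set S := X + a + b in hrq hq1 *.
have S0 : 0 <= S by rewrite /S !addr_ge0.
have aS : a <= S by rewrite /S -addrA addrCA lerDl addr_ge0.
have XS : X <= S by rewrite /S -addrA lerDl addr_ge0.
have KsS : 0 <= K * (s * S) by rewrite !mulr_ge0.
have u1S : `|u1| <= (1 + K) * S.
  apply: le_trans hu1 _; rewrite mulrDl mul1r lerD //.
  by apply: le_trans hq1 _; rewrite ler_wpM2l // ler_piMl.
have h1 : `|f| <= K * (s * S) by apply: le_trans hf _; rewrite !ler_wpM2l.
have h2 : `|fu * u1| <= (K + K ^+ 2) * (s * S).
  rewrite normrM (le_trans (ler_pM _ _ hfu u1S)) //.
  by rewrite le_eqVlt; apply/orP; left; apply/eqP; ring.
apply: le_trans hb _; apply: le_trans (ler_normD _ _) _.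
have -> : (3 * K + K ^+ 2) * s * S = K * (s * S) + (K + K ^+ 2) * (s * S) + K * (s * S).
  by ring.
by rewrite lerD //; apply: le_trans (ler_normD _ _) _; rewrite lerD.
Qed.

(** The part of the bound that contains b itself is absorbed in the left side. *)
Lemma tangent_absorb (M s eta X a b : R) : 0 <= X -> 0 <= a -> 0 <= b -> 0 <= eta <= 1 ->
  4 * (M * s) <= eta -> b <= M * s * (X + a + b) -> b <= eta * (X + a).
Proof.
move=> X0 a0 b0 /andP[e0 e1] Ms bM.
have S0 : 0 <= X + a + b by rewrite !addr_ge0.
have Xa0 : 0 <= X + a by rewrite addr_ge0.
have h1 : 4 * (M * s) * (X + a + b) <= eta * (X + a + b) by rewrite ler_wpM2r.
have h2 : eta * b <= b by rewrite ler_piMl.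
have h3 : 0 <= eta * (X + a) by rewrite mulr_ge0.
have h4 : 4 * b <= eta * (X + a) + eta * b.
  apply: le_trans (_ : 4 * (M * s * (X + a + b)) <= _); first by rewrite ler_pM2l.
  by apply: le_trans (_ : eta * (X + a + b) <= _);
    [rewrite mulrA|rewrite mulrDr].
by lra.
Qed.

(** In the application g1 and g2 are the partial derivatives of Q, and g3, g4, g5
the second derivatives of q, the mixed ones added up in g4. *)
Lemma complex_parts_arith (K s X a b : R) (g1 g2 g3 g4 g5 zeta om : Cx R) :
  0 <= K -> 0 <= s <= 1 -> 0 <= X ->
  a = `|complex.Re om| -> b = `|complex.Im om| ->
  normc (g1 * zeta) <= K * (s * X) -> normc g2 <= K * s ->
  normc (g3 * zeta * zeta) <= K * X ^+ 2 ->
  normc (g4 * zeta) <= K * (s * X) -> normc g5 <= K * s ->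
  [/\ normc (g1 * zeta + g2 * om) <= K * (s * (X + a + b)),
      normc (g4 * zeta * om + g5 * om ^+ 2) <= K * (s * (X + a + b) ^+ 2) &
      normc (g3 * zeta * zeta + (g4 * zeta * om + g5 * om ^+ 2) + 2%:C * om ^+ 2) <=
        (2 * K + 2) * (X + a + b) ^+ 2].
Proof.
move=> K0 /andP[s0 s1] X0 aE bE h1 h2 h3 h4 h5.
have a0 : 0 <= a by rewrite aE. have b0 : 0 <= b by rewrite bE.
have omE : normc om <= a + b by rewrite aE bE; exact: normc_ReIm.
have om0 := normc_ge0 om.
set S := X + a + b.
have omS : normc om <= S by rewrite /S -addrA (le_trans omE) // lerDr.
have XS : X <= S by rewrite /S -addrA lerDl addr_ge0.
have S0 : 0 <= S by apply: le_trans XS.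
have r2 : normc (g4 * zeta * om + g5 * om ^+ 2) <= K * (s * S ^+ 2).
  apply: le_trans (normcD _ _) _.
  rewrite [normc (g4 * zeta * om)]normcM [normc (g5 * _)]normcM.
  rewrite [om ^+ 2]expr2 [normc (om * om)]normcM.
  apply: (@le_trans _ _ (K * (s * X) * (a + b) + K * s * ((a + b) * (a + b)))).
    apply: lerD; first by apply: ler_pM => //; exact: normc_ge0.
    apply: ler_pM => //; [exact: normc_ge0|exact: mulr_ge0|exact: ler_pM].
  have -> : K * (s * X) * (a + b) + K * s * ((a + b) * (a + b)) =
    (K * s) * (S * (a + b)) by rewrite /S; ring.
  have -> : K * (s * S ^+ 2) = (K * s) * (S * S) by ring.
  rewrite ler_wpM2l ?mulr_ge0 // ler_wpM2l //.
  by rewrite /S -addrA lerDr.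
split=> //.
- apply: le_trans (normcD _ _) _; rewrite [X in _ + X]normcM.
  apply: (@le_trans _ _ (K * (s * X) + K * s * (a + b))).
    by apply: lerD => //; apply: ler_pM => //; exact: normc_ge0.
  by rewrite le_eqVlt; apply/orP; left; apply/eqP; rewrite /S; ring.
- apply: le_trans (normcD _ _) _.
  have -> : (2 * K + 2) * S ^+ 2 = K * S ^+ 2 + K * S ^+ 2 + 2 * S ^+ 2 by ring.
  apply: lerD.
    apply: le_trans (normcD _ _) _; apply: lerD.
      by apply: le_trans h3 _; rewrite ler_wpM2l // ler_pXn2r // nnegrE.
    by apply: le_trans r2 _; rewrite ler_wpM2l // ler_piMl // sqr_ge0.
  rewrite normcM normc_real ger0_norm // expr2 normcM expr2 ler_wpM2l //.
  by rewrite ler_pM.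
Qed.

End Arithmetic.

Section SecondDerivativePositive.
Variables (R : realType) (wz wu n : nat).
Hypotheses (wz0 : (0 < wz)%N) (wu0 : (0 < wu)%N) (wzn : (wz < n)%N) (wun : (wu < n)%N).
Let C := Cx R.
Variables (F P h : R3 R -> R) (A : set (R3 R)).
Hypotheses (oA : open A) (A0 : A 0) (sF : smooth_on A F).
Hypotheses (pP : poly3 P) (ph : poly3 h).
Hypotheses (fF : flat wz wu (n + n) F) (fE : flat wz wu (n + n).+1 (fun a => F a - P a)).
Hypothesis dilPh : forall s a,
  P (dil wz wu s a) + h (dil wz wu s a) = s ^+ (n + n) * (P a + h a).
Variable c : R.
Hypothesis c0 : 0 < c.
Hypothesis hessPh : forall x y u p r : R, x ^+ 2 + y ^+ 2 + u ^+ 2 = 1 ->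
  c * (p ^+ 2 + r ^+ 2) <= hess (fun a => P a + h a) (pt3 x y u) p r.
Variables (q gz gw gzz gzw gwz gww : C -> C -> C).
Hypotheses (pgz : wpol wz wu (n + n - wz) gz) (pgw : wpol wz wu (n + n - wu) gw)
  (pgzz : wpol wz wu (n + n - wz - wz) gzz) (pgzw : wpol wz wu (n + n - wz - wu) gzw)
  (pgwz : wpol wz wu (n + n - wu - wz) gwz) (pgww : wpol wz wu (n + n - wu - wu) gww).
Hypotheses (dq : pathdiff q gz gw) (dgz : pathdiff gz gzz gzw).
Hypothesis hE : forall x y u, h (pt3 x y u) = complex.Re (q (x +i* y) u%:C).

Notation Rr1 := (rr1 F q gz gw).
Notation Rr2 := (rr2 F q gz gw gzz gzw gwz gww).
Notation Base := (base q).

(** The terms of [Q2] that come neither from the pure second derivative of q in z nor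
from w ^+ 2. *)
Definition mixed (zeta om z w : C) : C :=
  (gzw z w + gwz z w) * zeta * om + gww z w * om ^+ 2.

Lemma Q2_split zeta om z w : Q2 gzz gzw gwz gww zeta om z w =
  gzz z w * zeta * zeta + mixed zeta om z w + (2 : R)%:C * om ^+ 2.
Proof.
rewrite /Q2 /mixed.
have -> : (2 : R)%:C = 2 :> C by apply/eqP; rewrite eq_complex /= addr0 !eqxx.
ring.
Qed.

Lemma Re_sqr (om : C) : complex.Re ((2 : R)%:C * om ^+ 2) =
  2 * (`|complex.Re om| ^+ 2 - `|complex.Im om| ^+ 2).
Proof. by case: om => a b; rewrite !real_normK ?num_real //=; ring. Qed.

(** The grouping of terms in which [normalized_positive] is stated. *)
Lemma rr2_split zeta om z w :
  let b := Base z w in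
  let p := complex.Re zeta in let r := complex.Im zeta in
  let u1 := U1 gz gw zeta om z w in
  Rr2 zeta om z w =
  (hess F b p r + complex.Re (gzz z w * zeta ^+ 2)) +
  ('D_(eu R) ('D_(ex R) F) b * p + 'D_(eu R) ('D_(ey R) F) b * r +
    ('D_(ex R) ('D_(eu R) F) b * p + 'D_(ey R) ('D_(eu R) F) b * r)) * u1 +
  'D_(eu R) ('D_(eu R) F) b * u1 ^+ 2 +
  'D_(eu R) F b * complex.Im (Q2 gzz gzw gwz gww zeta om z w) +
  complex.Re (mixed zeta om z w) +
  2 * (`|complex.Re om| ^+ 2 - `|complex.Im om| ^+ 2).
Proof.
move=> b p r u1.
have E : complex.Re (Q2 gzz gzw gwz gww zeta om z w) =
  complex.Re (gzz z w * zeta ^+ 2) + complex.Re (mixed zeta om z w) +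
  2 * (`|complex.Re om| ^+ 2 - `|complex.Im om| ^+ 2).
  rewrite Q2_split [complex.Re (_ + _ + _)]Re_add [complex.Re (_ + mixed _ _ _ _)]Re_add.
  by rewrite Re_sqr expr2 mulrA.
have L (a11 a12 a13 a21 a22 a23 a31 a32 a33 fu q2 t1 t2 t3 T : R) : T = t1 + t2 + t3 ->
  (a11 * p + a21 * r + a31 * u1) * p + (a12 * p + a22 * r + a32 * u1) * r +
  ((a13 * p + a23 * r + a33 * u1) * u1 + fu * q2) + T =
  (a11 * p ^+ 2 + (a12 + a21) * (p * r) + a22 * r ^+ 2 + t1) +
  (a31 * p + a32 * r + (a13 * p + a23 * r)) * u1 + a33 * u1 ^+ 2 + fu * q2 + t2 + t3.
  by move=> ->; ring.
exact: (L _ _ _ _ _ _ _ _ _ _ _ _ _ _ _ E).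
Qed.

(** Insert the estimates for F and q in [normalized_positive].  The alternative
om = 0 to tangency serves the touching argument at the origin; both imply that Im om
is small compared with X + |Re om|. *)
Lemma rr2_pos : exists rho eta : R, [/\ 0 < rho, 0 < eta <= 1 &
  forall s x y u z w zeta om, near_axis wz wu s eta x y u z w -> 0 < s < rho ->
  Base z w = pt3 (s ^+ wz * x) (s ^+ wz * y) (s ^+ wu * u) ->
  (zeta != 0) || (om != 0) -> Rr1 zeta om z w = 0 \/ om = 0 ->
  0 < Rr2 zeta om z w].
Proof.
have [r1 [K1 [r10 K10 H1]]] := hess_lower_bound wz0 wu0 wzn wun oA A0 sF pP ph fE dilPh
  hessPh pgz pgw pgzz pgzw pgwz pgww dq dgz hE.
have [r2 [K2 [r20 K20 H2]]] := defining_estimates wz0 wu0 wzn wun oA A0 sF fF.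
have [K3 K30 H3] := holomorphic_estimates wz0 wu0 wzn wun pgz pgw pgzz pgzw pgwz pgww.
pose K := K1 + K2 + K3.
have K0 : 0 <= K by rewrite !addr_ge0.
have K1K : K1 <= K by rewrite /K; lra.
have K2K : K2 <= K by rewrite /K; lra.
have K3K : K3 <= K by rewrite /K; lra.
have K220 : 0 <= 2 * K + 2 by rewrite addr_ge0 ?mulr_ge0.
have KK : K <= 2 * K + 2 by move: K0; lra.
have [e0 e00 Hpos] := @normalized_positive R c (2 * K + 2) c0 K220.
pose M := 3 * K + K ^+ 2.
have M0 : 0 <= M by rewrite addr_ge0 ?mulr_ge0 ?sqr_ge0.
pose eta := Num.min 1 e0.
have eta0 : 0 < eta by rewrite lt_min ltr01 e00.
have eta1 : eta <= 1 by rewrite ge_min lexx.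
have etae : eta <= e0 by rewrite ge_min lexx orbT.
have M40 : 0 < 4 * M + 1 by rewrite ltr_wpDl // mulr_ge0.
exists (Num.min (Num.min r1 r2) (Num.min e0 (eta / (4 * M + 1)))), eta.
rewrite eta0 eta1; split => //.
  by rewrite !lt_min r10 r20 e00 divr_gt0.
move=> s x y u z w zeta om H /andP[s0].
rewrite !lt_min => /andP[/andP[sr1 sr2] /andP[se sM]] bE nz tang.
have [s01 _ sph zE wE] := H; have /andP[_ s1] := s01.
have Ms : 4 * (M * s) <= eta.
  rewrite ltr_pdivlMr // in sM; apply: le_trans (ltW sM).
  have -> : s * (4 * M + 1) = 4 * (M * s) + s by ring.
  by rewrite lerDl ltW.
have h1 := H1 _ _ _ _ _ _ _ zeta H (introT andP (conj s0 sr1)).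
have [a1 a2 a3 a4 _] := H2 _ _ _ _ _ _ _ zeta H sr2.
have [b1 b2 b3 [b4 b5] _] := H3 _ _ _ _ _ _ _ zeta H.
set X := s ^+ (n - wz) * normc zeta in h1 a1 a3 b1 b3 b4.
set b := pt3 _ _ _ in bE h1 a1 a2 a3 a4.
pose a := `|complex.Re om|; pose v := `|complex.Im om|.
have X0 : 0 <= X by rewrite mulr_ge0 ?normc_ge0 // exprn_ge0 // ltW.
have a0 : 0 <= a by exact: normr_ge0.
have v0 : 0 <= v by exact: normr_ge0.
have sX0 : 0 <= s * X by rewrite mulr_ge0 // ltW.
have up (k Y t : R) : k <= K -> 0 <= Y -> t <= k * Y -> t <= K * Y.
  by move=> kK Y0 tY; apply: le_trans tY _; rewrite ler_wpM2r.
have {}a1 := up _ _ _ K2K sX0 a1; have {}a2 := up _ _ _ K2K (ltW s0) a2.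
have {}a3 := up _ _ _ K2K sX0 a3; have {}a4 := up _ _ _ K2K (ltW s0) a4.
have {}b1 := up _ _ _ K3K sX0 b1; have {}b2 := up _ _ _ K3K (ltW s0) b2.
have {}b3 := up _ _ _ K3K (sqr_ge0 X) b3.
have {}b4 := up _ _ _ K3K sX0 b4; have {}b5 := up _ _ _ K3K (ltW s0) b5.
have [c1 c2 c3] := complex_parts_arith (a := a) (b := v) K0 s01 X0 erefl erefl b1 b2 b3 b4 b5.
have S0 : 0 <= X + a + v by rewrite !addr_ge0.
have u1E : `|U1 gz gw zeta om z w| <= a + `|complex.Im (Q1 gz gw zeta om z w)|.
  exact: ler_normD.
have q1E := le_trans (Im_normc (Q1 gz gw zeta om z w)) c1.
have rq1E := le_trans (Re_normc (Q1 gz gw zeta om z w)) c1.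
have vE : v <= eta * (X + a).
  case: tang => [rr10|om0]; last first.
    by rewrite /v om0 /= normr0 mulr_ge0 ?addr_ge0 // ltW.
  apply: (tangent_absorb X0 a0 v0 _ Ms); first by rewrite (ltW eta0).
  apply: (tangent_arith K0 s01 X0 a0 v0 a1 a2 rq1E q1E u1E).
  rewrite /v; move: rr10; rewrite /rr1 bE => /eqP; rewrite subr_eq0 => /eqP <-.
  exact: lexx.
have K2' (Y : R) : 0 <= Y -> K * Y <= (2 * K + 2) * Y.
  by move=> Y0; rewrite ler_wpM2r.
have s0' := ltW s0.
have hA : (c - (2 * K + 2) * s - (2 * K + 2) * eta) * X ^+ 2 <=
    hess F b (complex.Re zeta) (complex.Im zeta) + complex.Re (gzz z w * zeta ^+ 2).
  apply: le_trans h1; rewrite ler_wpM2r ?sqr_ge0 //.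
  have k1 : K1 * s <= (2 * K + 2) * s.
    by apply: le_trans (K2' _ s0'); rewrite ler_wpM2r.
  have k2 : K1 * eta <= (2 * K + 2) * eta.
    by apply: le_trans (K2' _ (ltW eta0)); rewrite ler_wpM2r // ltW.
  by rewrite lerB // lerB.
have c2' := le_trans (Re_normc _) c2; have c3' := le_trans (Im_normc _) c3.
rewrite -Q2_split in c3'.
have sS20 : 0 <= s * (X + a + v) ^+ 2 by rewrite mulr_ge0 // sqr_ge0.
have sS0 : 0 <= s * (X + a + v) by rewrite mulr_ge0.
have := Hpos s eta X a v _ _ _ _ _ _ _ _ (introT andP (conj s0' (ltW se)))
  (introT andP (conj (ltW eta0) etae)) X0 a0 v0 vE hA
  (le_trans a3 (K2' _ sX0)) (le_trans a4 (K2' _ s0')) (le_trans a2 (K2' _ s0'))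
  (le_trans q1E (K2' _ sS0)) u1E c3' (le_trans c2' (K2' _ sS20)).
rewrite rr2_split bE; apply: lt_le_trans.
have [zeta0|zeta0] := eqVneq zeta 0; last first.
  have Xpos : 0 < X.
    rewrite mulr_gt0 ?exprn_gt0 // lt_def normc_ge0 andbT.
    by apply: contra_neq zeta0; exact: eq0_normc.
  by rewrite ltr_pwDl // ?sqr_ge0 // mulr_gt0 ?exprn_gt0 // divr_gt0.
rewrite zeta0 eqxx /= in nz.
have Xz : X = 0 by rewrite /X zeta0 normc0 mulr0.
have apos : 0 < a.
  rewrite lt_def a0 andbT; apply: contra_neq nz => a00.
  have v00 : v = 0.
    by apply/eqP; rewrite eq_le v0 andbT (le_trans vE) // Xz a00 addr0 mulr0.
  move: a00 v00; rewrite /a /v; case: (om) => o1 o2 /= /eqP + /eqP.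
  by rewrite !normr_eq0 => /eqP -> /eqP ->.
by rewrite Xz expr0n /= mulr0 add0r exprn_gt0.
Qed.

End SecondDerivativePositive.

(** * Weighted polar coordinates *)

Section PolarCoordinates.
Variables (R : realType) (wz wu : nat).
Hypotheses (wz0 : (0 < wz)%N) (wu0 : (0 < wu)%N).

(** The weighted sphere is met by the dilation orbit of any nonzero point: the
squared norm along the orbit is a polynomial in the dilation parameter that is 0 at 0
and at least 1 at 1 + 1/N, so that it takes the value 1. *)
Lemma dil_sphere (x y u : R) : x ^+ 2 + y ^+ 2 + u ^+ 2 != 0 ->
  exists s x0 y0 u0 : R, [/\ 0 < s, x0 ^+ 2 + y0 ^+ 2 + u0 ^+ 2 = 1 &
    [/\ x = s ^+ wz * x0, y = s ^+ wz * y0 & u = s ^+ wu * u0]].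
Proof.
move=> nz; pose N := x ^+ 2 + y ^+ 2 + u ^+ 2.
have N0 : 0 < N by rewrite lt_def nz /N !addr_ge0 ?sqr_ge0.
(* p.[t] is the squared norm of the dilation by t *)
pose p : {poly R} := (x ^+ 2 + y ^+ 2)%:P * 'X ^+ (wz * 2) + (u ^+ 2)%:P * 'X ^+ (wu * 2).
have pE t : p.[t] = (t ^+ wz * x) ^+ 2 + (t ^+ wz * y) ^+ 2 + (t ^+ wu * u) ^+ 2.
  by rewrite /p !hornerE !exprM !exprMn; ring.
have p0 : p.[0] = 0 by rewrite pE !expr0n /= !gtn_eqF // !mul0r !expr0n /= !addr0.
pose T := 1 + N^-1.
have T1 : 1 <= T by rewrite /T lerDl invr_ge0 ltW.
have Tk k : (0 < k)%N -> T <= T ^+ k by move=> k0; rewrite -[leLHS]expr1 ler_weXn2l.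
have pT : 1 <= p.[T].
  rewrite pE !exprMn -!exprM -mulrDr.
  have TN : 1 <= T * N by rewrite /T mulrDl mul1r mulVf ?gt_eqF // lerDr ltW.
  apply: le_trans TN _; rewrite /N [leLHS]mulrDr; apply: lerD.
    by rewrite ler_wpM2r ?addr_ge0 ?sqr_ge0 // Tk // muln_gt0 wz0.
  by rewrite ler_wpM2r ?sqr_ge0 // Tk // muln_gt0 wu0.
have T0 : 0 <= T by apply: le_trans T1.
have pB t : (p - 1%:P).[t] = p.[t] - 1 by rewrite hornerD hornerN hornerC.
have sgn : (p - 1%:P).[0] <= 0 <= (p - 1%:P).[T].
  by rewrite !pB p0 sub0r oppr_le0 ler01 subr_ge0.
have [t /andP[t0 _] /rootP] := poly_ivt T0 sgn.
rewrite pB => /eqP; rewrite subr_eq0 => /eqP pt1.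
have tn0 : t != 0 by apply: contra_eq_neq pt1 => ->; rewrite p0 eq_sym oner_eq0.
have tpos : 0 < t by rewrite lt_def tn0.
exists t^-1, (t ^+ wz * x), (t ^+ wz * y), (t ^+ wu * u).
split; [by rewrite invr_gt0|by rewrite -pE|].
by split; rewrite exprVn mulKf // expf_neq0.
Qed.

(** Some coordinate of a point of the unit sphere is at least 1/2 in absolute
value; the dilation multiplies it by a power of s, which is small only if s is. *)
Lemma dil_small (rho : R) : 0 < rho -> exists2 d : R, 0 < d &
  forall s x0 y0 u0 : R, 0 < s -> x0 ^+ 2 + y0 ^+ 2 + u0 ^+ 2 = 1 ->
    `|s ^+ wz * x0| < d -> `|s ^+ wz * y0| < d -> `|s ^+ wu * u0| < d -> s < rho.
Proof.
move=> rho0; pose r := Num.min rho 1.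
have r0 : 0 < r by rewrite lt_min rho0 ltr01.
exists (Num.min (r ^+ wz) (r ^+ wu) / 2).
  by rewrite divr_gt0 // lt_min !exprn_gt0.
move=> s x0 y0 u0 s0 sph; set d := Num.min _ _ => hx hy hu.
rewrite ltNge; apply/negP => rs.
have rs' : r <= s by apply: le_trans rs; rewrite ge_min lexx.
have bnd (w : nat) (a : R) : d <= r ^+ w -> `|s ^+ w * a| < d / 2 -> `|a| < 2^-1.
  move=> dw; rewrite normrM ger0_norm ?exprn_ge0 ?(ltW s0) // => ha.
  have sw : d <= s ^+ w by apply: le_trans dw _; rewrite lerXn2r // nnegrE ltW.
  have sw0 : 0 < s ^+ w by rewrite exprn_gt0.
  rewrite -(ltr_pM2l sw0); apply: lt_le_trans ha _.
  by rewrite ler_pM2r // invr_gt0.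
have hx' := bnd _ _ _ hx; have hy' := bnd _ _ _ hy; have hu' := bnd _ _ _ hu.
have sq (a : R) : `|a| < 2^-1 -> a ^+ 2 <= 4^-1.
  move=> ha; rewrite -real_normK ?num_real //.
  have -> : (4^-1 : R) = (2^-1) ^+ 2 by rewrite exprVn -natrX.
  by rewrite lerXn2r ?nnegrE ?invr_ge0 // ltW.
have dz : d <= r ^+ wz by rewrite ge_min lexx.
have du : d <= r ^+ wu by rewrite ge_min lexx orbT.
have := sq _ (hx' dz); have := sq _ (hy' dz); have := sq _ (hu' du).
move: sph; move: (x0 ^+ 2) (y0 ^+ 2) (u0 ^+ 2) => a b c.
by move=> *; lra.
Qed.

End PolarCoordinates.

(** * Smallness of the coordinate change *)

Section SmallLipschitz.
Variables (R : realType) (F : R3 R -> R) (A : set (R3 R)).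
Hypotheses (oA : open A) (A0 : A 0) (sF : smooth_on A F).
Hypothesis gradF0 : forall v, v \in axes R -> 'D_v F 0 = 0.

(** F has zero gradient at the origin, hence arbitrarily small Lipschitz
constants near it. *)
Lemma small_lipschitz (e : R) : 0 < e -> exists2 d : R, 0 < d &
  forall x y u : R, `|x| < d -> `|y| < d -> `|u| < d -> A (pt3 x y u) /\
  forall x' y' u' : R, `|x'| < d -> `|y'| < d -> `|u'| < d ->
    `|F (pt3 x y u) - F (pt3 x' y' u')| <= e * (`|x - x'| + `|y - y'| + `|u - u'|).
Proof.
move=> e0.
have L (a b k p1 p2 p3 : R) : `|a| <= e -> `|b| <= e -> `|k| <= e ->
    `|a * p1 + b * p2 + k * p3| <= e * (`|p1| + `|p2| + `|p3|).
  move=> ha hb hk; rewrite !mulrDr.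
  apply: le_trans (ler_normD _ _) _; apply: lerD; last by rewrite normrM ler_wpM2r.
  by apply: le_trans (ler_normD _ _) _; apply: lerD; rewrite normrM ler_wpM2r.
have axx : ex R \in axes R by rewrite !inE eqxx.
have axy : ey R \in axes R by rewrite !inE eqxx orbT.
have axu : eu R \in axes R by rewrite !inE eqxx !orbT.
have small v : v \in axes R -> exists2 d : R, 0 < d & forall x y u : R,
    `|x| < d -> `|y| < d -> `|u| < d -> `|'D_v F (pt3 x y u)| <= e.
  move=> vax; have cD : {for 0, continuous ('D_v F)}.
    exact: differentiable_continuous (sF [:: v] A0).
  move/cvgrPdist_lt: cD => /(_ e e0) /nbhs0_pt3[d d0 Hd]; exists d => // x y u hx hy hu.
  have := Hd x y u hx hy hu; rewrite gradF0 //= sub0r normrN; exact: ltW.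
have [d1 d10 H1] := small _ axx; have [d2 d20 H2] := small _ axy.
have [d3 d30 H3] := small _ axu.
have [d4 d40 H4] := nbhs0_pt3 (open_nbhs_nbhs (conj oA A0)).
exists (Num.min (Num.min d1 d2) (Num.min d3 d4)); first by rewrite !lt_min d10 d20 d30 d40.
move=> x y u; set d := Num.min _ _ => hx hy hu.
have [dd1 dd2 dd3 dd4] : [/\ d <= d1, d <= d2, d <= d3 & d <= d4].
  by rewrite /d; split; rewrite !ge_min lexx ?orbT.
have ltd a k : d <= k -> `|a| < d -> `|a| < k by move=> dk ad; exact: lt_le_trans dk.
split; first by apply: H4; apply: ltd dd4 _.
move=> x' y' u' hx' hy' hu'.
pose gx t := x' + t * (x - x'); pose gy t := y' + t * (y - y').
pose gu t := u' + t * (u - u').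
pose g1 t := 'D_(ex R) F (pt3 (gx t) (gy t) (gu t)) * (x - x') +
  'D_(ey R) F (pt3 (gx t) (gy t) (gu t)) * (y - y') +
  'D_(eu R) F (pt3 (gx t) (gy t) (gu t)) * (u - u').
have [t t01|t /andP[t0 t1]] := @mean_value R (fun t => F (pt3 (gx t) (gy t) (gu t))) g1 0 1 ltr01.
  apply: (@is_derive_path R F gx gy gu t); try exact: is_derive_affine.
  by apply: (sF [::]); apply: H4; apply: ltd dd4 _; exact: segment_lt.
have e1 a a' : a' + 1 * (a - a') = a :> R by ring.
have e2 a a' : a' + 0 * (a - a') = a' :> R by ring.
rewrite /gx /gy /gu !e1 !e2 subr0 mulr1 => ->.
have t01 : 0 <= t <= 1 by rewrite !ltW.
have k1 : `|'D_(ex R) F (pt3 (gx t) (gy t) (gu t))| <= e.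
  by apply: H1; apply: ltd dd1 _; exact: segment_lt.
have k2 : `|'D_(ey R) F (pt3 (gx t) (gy t) (gu t))| <= e.
  by apply: H2; apply: ltd dd2 _; exact: segment_lt.
have k3 : `|'D_(eu R) F (pt3 (gx t) (gy t) (gu t))| <= e.
  by apply: H3; apply: ltd dd3 _; exact: segment_lt.
exact: L k1 k2 k3.
Qed.

End SmallLipschitz.

Section SmallHolomorphic.
Variables (R : realType) (wz wu n : nat).
Hypotheses (wz0 : (0 < wz)%N) (wu0 : (0 < wu)%N) (wzn : (wz < n)%N) (wun : (wu < n)%N).
Let C := Cx R.
Variables (q : C -> C -> C).
Hypothesis pq : wpol wz wu (n + n) q.

Lemma Qfun_wpol : wpol wz wu (wu + wu) (Qfun q).
Proof.
apply: wpol_add; first by apply: wpol_weaken pq; lia.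
have H : wpol wz wu (wu + wu) (fun _ w : C => w * w) by apply: wpol_mul; exact: wpol_w.
exact: H.
Qed.

Lemma wpol_origin m (g : C -> C -> C) : (0 < m)%N -> wpol wz wu m g -> g 0 0 = 0.
Proof.
move=> m0 pg; have [c _ H] := wpol_bound pg ler01.
apply: eq0_normc; apply/eqP; rewrite eq_le normc_ge0 andbT.
have := H 0 0 0; rewrite lexx ler01 normc0 !mul1r !exprn_ge0 //.
by rewrite [0 ^+ m]expr0n gtn_eqF // mulr0; apply.
Qed.

(** The factor 1/16 leaves room in the later estimates.  Every monomial of q
and w ^+ 2 that contains w has weighted order at least wu + wu, which makes the
Lipschitz constant in w small; the part of q that is constant in w has order above wz. *)
Lemma Qfun_small : exists2 rho : R, 0 < rho & forall z w : C,
  normc z <= rho -> normc w <= rho ->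
  normc (Qfun q z w) <= (normc z + normc w) / 16 /\
  forall w', normc w' <= rho ->
    normc (Qfun q z w - Qfun q z w') <= normc (w - w') / 16.
Proof.
have q00 : q 0 0 = 0 by apply: wpol_origin pq; lia.
have nE : (n + n = wz + (1 + (n + n - wz - 1)))%N by lia.
have [c c0 H] := wpol_lipschitz Qfun_wpol ler01.
have [c' c'0 H'] := wpol_lipschitz pq ler01.
pose s := (16 * (c + c') + 1)^-1.
have D0 : 1 <= 16 * (c + c') + 1 by rewrite lerDr mulr_ge0 // addr_ge0.
have s0 : 0 < s by rewrite invr_gt0 (lt_le_trans ltr01).
have s1 : s <= 1 by rewrite invf_le1 // (lt_le_trans ltr01).
have s01 : 0 <= s <= 1 by rewrite ltW.
have cs : c * s <= 16^-1 /\ c' * s <= 16^-1.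
  by split; rewrite ler_pdivrMr ?(lt_le_trans ltr01) // ; lra.
exists (Num.min (s ^+ wz) (s ^+ wu)); first by rewrite lt_min !exprn_gt0.
move=> z w; rewrite !le_min => /andP[zz zu] /andP[wzz wuu].
have sp k : 0 < s ^+ k by rewrite exprn_gt0.
have b1 k (a : R) : a <= s ^+ k -> a <= 1 * s ^+ k by rewrite mul1r.
have lip w' : normc w' <= s ^+ wu -> normc (Qfun q z w - Qfun q z w') <= normc (w - w') / 16.
  move=> wu'.
  have eta0 : 0 <= normc (w - w') / s ^+ wu by rewrite divr_ge0 ?normc_ge0 // ltW.
  have dz : normc (z - z) <= normc (w - w') / s ^+ wu * s ^+ wz.
    by rewrite subrr normc0 mulr_ge0 // ltW.
  have dw : normc (w - w') <= normc (w - w') / s ^+ wu * s ^+ wu.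
    by rewrite divfK // gt_eqF.
  have h := H s _ z w z w' s01 eta0 (b1 _ _ zz) (b1 _ _ wuu) (b1 _ _ zz) (b1 _ _ wu') dz dw.
  apply: le_trans h _.
  have -> : c * (normc (w - w') / s ^+ wu) * s ^+ (wu + wu) = normc (w - w') * (c * s ^+ wu).
    by rewrite exprD; field; rewrite gt_eqF.
  rewrite ler_wpM2l ?normc_ge0 //; apply: le_trans cs.1.
  by rewrite ler_wpM2l //; have := expr_le_le1 s01 wu0; rewrite expr1.
split; last by move=> w'; rewrite le_min => /andP[_]; exact: lip.
have Q0 : normc (Qfun q z 0) <= normc z / 16.
  rewrite /Qfun expr0n /= addr0.
  have eta0 : 0 <= normc z / s ^+ wz by rewrite divr_ge0 ?normc_ge0 // ltW.
  have dw : normc (0 - 0 : C) <= normc z / s ^+ wz * s ^+ wu.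
    by rewrite subrr normc0 mulr_ge0 // ltW.
  have dz : normc (z - 0) <= normc z / s ^+ wz * s ^+ wz.
    by rewrite divfK ?gt_eqF // subr0.
  have n0 k : normc (0 : C) <= 1 * s ^+ k by rewrite normc0 mul1r ltW.
  have := H' s _ z 0 0 0 s01 eta0 (b1 _ _ zz) (n0 _) (n0 _) (n0 _) dz dw.
  rewrite q00 subr0 => h; apply: le_trans h _.
  have -> : c' * (normc z / s ^+ wz) * s ^+ (n + n) =
      normc z * (c' * s * s ^+ (n + n - wz - 1)).
    by rewrite nE exprD exprD expr1 -nE; field; rewrite gt_eqF.
  rewrite ler_wpM2l ?normc_ge0 //; apply: le_trans cs.2.
  by rewrite ler_piMr ?mulr_ge0 ?(ltW s0) // exprn_ile1 // ltW.
have w0 : normc (0 : C) <= s ^+ wu by rewrite normc0 ltW.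
have := lip 0 w0; rewrite subr0 => h.
rewrite -(subrK (Qfun q z 0) (Qfun q z w)) mulrDl addrC.
by apply: le_trans (normcD _ _) _; apply: lerD.
Qed.

End SmallHolomorphic.

(** * Boundary points are close to real w *)

Section BoundaryPoints.
Variables (R : realType) (wz wu n : nat).
Hypotheses (wz0 : (0 < wz)%N) (wu0 : (0 < wu)%N) (wzn : (wz < n)%N) (wun : (wu < n)%N).
Let C := Cx R.
Variables (F : R3 R -> R) (A : set (R3 R)).
Hypotheses (oA : open A) (A0 : A 0) (sF : smooth_on A F).
Hypotheses (fF : flat wz wu (n + n) F).
Variables (q : C -> C -> C).
Hypothesis pq : wpol wz wu (n + n) q.

Lemma boundary_arith (eta K c1 c2 s W U Fb Q Q0 sw : R) : 0 <= K -> 0 <= c1 ->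
  0 <= s <= 1 -> 0 <= sw -> U <= sw -> Fb <= K * (s * sw) -> Q0 <= c1 * (s * sw) ->
  W <= U + Fb + Q -> Q <= Q0 + W / 16 -> W <= 2 * (1 + K + c1) * sw.
Proof.
move=> K0 c10 /andP[s0 s1] sw0 hU hF hQ0 hW hQ.
have h1 : K * (s * sw) <= K * sw by rewrite ler_wpM2l // ler_piMl.
have h2 : c1 * (s * sw) <= c1 * sw by rewrite ler_wpM2l // ler_piMl.
have h3 : 0 <= K * sw by rewrite mulr_ge0.
have h4 : 0 <= c1 * sw by rewrite mulr_ge0.
lra.
Qed.

(** At boundary points w is u plus a complex number determined by F and Q,
which are of higher weighted order than u: with U = u + Im Q, the equation rr = 0 says
that w - U = i (F + Q).  On the line w = 0 this difference is -Im Q. *)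
Lemma boundary_near_axis (eta : R) : 0 < eta <= 1 -> exists2 rho : R, 0 < rho &
  forall s x y u z w, 0 < s < rho -> normc z <= rho -> normc w <= rho ->
  x ^+ 2 + y ^+ 2 + u ^+ 2 = 1 ->
  base q z w = pt3 (s ^+ wz * x) (s ^+ wz * y) (s ^+ wu * u) ->
  rr F q z w = 0 \/ w = 0 -> near_axis wz wu s eta x y u z w.
Proof.
move=> /andP[eta0 eta1].
have [r1 [K [r10 K0 H1]]] := defining_estimates wz0 wu0 wzn wun oA A0 sF fF.
have [r2 r20 H2] := Qfun_small wz0 wu0 wzn wun pq.
have pQ := Qfun_wpol wz0 wu0 wzn wun pq.
have [c1 c10 H3] := wpol_bound pQ (ler0n R 2).
pose B := 2 * (1 + K + c1).
have B0 : 0 <= B by rewrite mulr_ge0 // !addr_ge0.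
have B2 : 2 <= B by rewrite /B; lra.
have [c2 c20 H4] := wpol_bound pQ B0.
have D0 : 1 <= K + c2 + 1 by rewrite lerDr addr_ge0.
exists (Num.min (Num.min r1 r2) (Num.min 1 (eta / (K + c2 + 1)))).
  by rewrite !lt_min r10 r20 ltr01 divr_gt0 // (lt_le_trans ltr01).
move=> s x y u z w /andP[s0]; rewrite !lt_min !le_min.
move=> /andP[/andP[sr1 sr2] /andP[s1 sD]] /andP[/andP[zr1 zr2] _] /andP[/andP[wr1 wr2] _].
move=> sph bE bd; pose U := s ^+ wu * u.
have s01 : 0 <= s <= 1 by rewrite !ltW.
have sN k : 0 <= s ^+ k by rewrite exprn_ge0 // ltW.
have [zrE ziE UE] : [/\ complex.Re z = s ^+ wz * x, complex.Im z = s ^+ wz * y &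
    Upath q z w = U] by move: bE => [].
have zE : z = (s ^+ wz * x) +i* (s ^+ wz * y).
  by move: zrE ziE; case: (z) => zr zi /= -> ->.
(* the estimate for F only depends on the base point, for which w may be taken real *)
have H0 : near_axis wz wu s 0 x y u z U%:C.
  by split => //; rewrite ?lexx ?ler01 // subrr normc0 mul0r.
have [zB _ _] := near_axis_bound H0.
have [_ _ _ _ FbE] := H1 _ _ _ _ _ _ _ 0 H0 sr1.
rewrite -bE in FbE.
have wuS : s ^+ (wu + 1) = s * s ^+ wu by rewrite exprD expr1 mulrC.
rewrite wuS in FbE.
have [x1 y1 u1] := sphere_le1 sph.
have U1 : `|U| <= s ^+ wu by rewrite normrM (ger0_norm (sN wu)) ler_piMr.
have wUE : normc (w - U%:C) <= `|F (base q z w)| + normc (Qfun q z w).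
  case: bd => [rr0|w0].
    have -> : w - U%:C = 'i * ((F (base q z w))%:C + Qfun q z w).
      move: rr0; rewrite /rr -UE /Upath; move: (F _) (Qfun q z w) => f [Qr Qi].
      case: (w) => wr wi /= => /eqP; rewrite subr_eq0 => /eqP <-.
      by congr (_ +i* _); ring.
    rewrite normcM.
    by rewrite normc_i mul1r -normc_real normcD.
  rewrite w0 sub0r normcN normc_real -UE w0 /Upath /= add0r.
  by apply: le_trans (Im_normc _) _; rewrite lerDr.
have [_ /(_ 0)] := H2 _ _ zr2 wr2.
rewrite normc0 (ltW r20) subr0 => /(_ isT) Qlip.
have wub : s ^+ (wu + wu) <= s * s ^+ wu.
  rewrite exprD ler_wpM2r //; have := expr_le_le1 s01 wu0; by rewrite expr1.
have Q0E : normc (Qfun q z 0) <= c1 * (s * s ^+ wu).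
  have z0B : normc (0 : C) <= 2 * s ^+ wu by rewrite normc0 mulr_ge0.
  apply: le_trans (H3 s z 0 s01 zB z0B) _; by rewrite ler_wpM2l.
have wB : normc w <= B * s ^+ wu.
  apply: (@boundary_arith eta K c1 c2 s (normc w) `|U| `|F (base q z w)|
    (normc (Qfun q z w)) (normc (Qfun q z 0)) (s ^+ wu)) => //.
    rewrite -{1}(subrK U%:C w); apply: le_trans (normcD _ _) _.
    by rewrite normc_real addrC -addrA lerD2l.
  rewrite -{1}(subrK (Qfun q z 0) (Qfun q z w)); apply: le_trans (normcD _ _) _.
  by rewrite addrC lerD2l.
have zB' : normc z <= B * s ^+ wz by apply: le_trans zB _; rewrite ler_wpM2r.
have QE := H4 _ _ _ s01 zB' wB.
split=> //; first by rewrite eta1 ltW.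
apply: le_trans wUE _; apply: le_trans (lerD FbE QE) _.
apply: (@le_trans _ _ ((K + c2 + 1) * s * s ^+ wu)).
  rewrite -!mulrA 2!mulrDl; have h : c2 * s ^+ (wu + wu) <= c2 * (s * s ^+ wu).
    by rewrite ler_wpM2l.
  apply: le_trans (lerD (lexx _) h) _; rewrite lerDl mul1r; apply: mulr_ge0 => //.
  exact: ltW.
rewrite ler_wpM2r //; rewrite ltr_pdivlMr ?(lt_le_trans ltr01) // in sD.
by rewrite mulrC ltW.
Qed.

End BoundaryPoints.

(** * A radius on which the boundary is strongly convex off the origin *)

Section ComplexContinuity.
Variables (R : realType) (wz wu : nat) (T : topologicalType).
Let C := Cx R.

(** Continuity of both components; it spares the passage between the topologies of
Cx R and of pairs of reals. *)
Definition ccont (f : T -> C) (x : T) : Prop :=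
  {for x, continuous (fun y => complex.Re (f y))} /\
  {for x, continuous (fun y => complex.Im (f y))}.

Lemma ccont_cst c x : ccont (fun=> c) x.
Proof. by split; exact: cst_continuous. Qed.

Lemma ccont_add f g x : ccont f x -> ccont g x -> ccont (fun y => f y + g y) x.
Proof.
move=> [f1 f2] [g1 g2]; split.
  have -> : (fun y => complex.Re (f y + g y)) =
      (fun y => complex.Re (f y) + complex.Re (g y)).
    by apply/funext => y; exact: Re_add.
  exact: continuousD.
have -> : (fun y => complex.Im (f y + g y)) =
    (fun y => complex.Im (f y) + complex.Im (g y)).
  by apply/funext => y; exact: Im_add.
exact: continuousD.
Qed.

Lemma ccont_mul f g x : ccont f x -> ccont g x -> ccont (fun y => f y * g y) x.
Proof.
move=> [f1 f2] [g1 g2]; split.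
  have -> : (fun y => complex.Re (f y * g y)) =
      (fun y => complex.Re (f y) * complex.Re (g y) - complex.Im (f y) * complex.Im (g y)).
    by apply/funext => y; exact: Re_mul.
  by apply: continuousB; apply: continuousM.
have -> : (fun y => complex.Im (f y * g y)) =
    (fun y => complex.Re (f y) * complex.Im (g y) + complex.Im (f y) * complex.Re (g y)).
  by apply/funext => y; exact: Im_mul.
by apply: continuousD; apply: continuousM.
Qed.

Lemma ccont_wpol n g (zt wt : T -> C) x : wpol wz wu n g -> ccont zt x -> ccont wt x ->
  ccont (fun y => g (zt y) (wt y)) x.
Proof.
move=> pg cz cw; elim: pg => {n g}.
- by move=> n; exact: ccont_cst.
- by move=> c; exact: ccont_cst.
- exact: cz.
- exact: cw.
- by move=> n g1 g2 _ h1 _ h2; exact: ccont_add.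
- by move=> n1 n2 g1 g2 _ h1 _ h2; exact: ccont_mul.
- by move=> m n g _ _ IH; exact: IH.
Qed.

End ComplexContinuity.

Section GoodRadius.
Variables (R : realType) (wz wu n : nat).
Hypotheses (wz0 : (0 < wz)%N) (wu0 : (0 < wu)%N) (wzn : (wz < n)%N) (wun : (wu < n)%N).
Let C := Cx R.
Variables (F P h : R3 R -> R) (A : set (R3 R)).
Hypotheses (oA : open A) (A0 : A 0) (sF : smooth_on A F).
Hypotheses (pP : poly3 P) (ph : poly3 h).
Hypotheses (fF : flat wz wu (n + n) F) (fE : flat wz wu (n + n).+1 (fun a => F a - P a)).
Hypothesis dilPh : forall s a,
  P (dil wz wu s a) + h (dil wz wu s a) = s ^+ (n + n) * (P a + h a).
Variable c : R.
Hypothesis c0 : 0 < c.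
Hypothesis hessPh : forall x y u p r : R, x ^+ 2 + y ^+ 2 + u ^+ 2 = 1 ->
  c * (p ^+ 2 + r ^+ 2) <= hess (fun a => P a + h a) (pt3 x y u) p r.
Variables (q gz gw gzz gzw gwz gww : C -> C -> C).
Hypothesis pq : wpol wz wu (n + n) q.
Hypotheses (pgz : wpol wz wu (n + n - wz) gz) (pgw : wpol wz wu (n + n - wu) gw)
  (pgzz : wpol wz wu (n + n - wz - wz) gzz) (pgzw : wpol wz wu (n + n - wz - wu) gzw)
  (pgwz : wpol wz wu (n + n - wu - wz) gwz) (pgww : wpol wz wu (n + n - wu - wu) gww).
Hypotheses (dq : pathdiff q gz gw) (dgz : pathdiff gz gzz gzw).
Hypothesis hE : forall x y u, h (pt3 x y u) = complex.Re (q (x +i* y) u%:C).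

Notation Rr1 := (rr1 F q gz gw).
Notation Rr2 := (rr2 F q gz gw gzz gzw gwz gww).
Notation Base := (base q).
Notation Rr := (rr F q).

Lemma sqr3_neq0 (x y u : R) : pt3 x y u != 0 -> x ^+ 2 + y ^+ 2 + u ^+ 2 != 0.
Proof.
apply: contra_neq => /eqP; rewrite paddr_eq0 ?addr_ge0 ?sqr_ge0 //.
rewrite paddr_eq0 ?sqr_ge0 // !sqrf_eq0 => /andP[/andP[/eqP -> /eqP ->] /eqP ->].
by [].
Qed.

(** Choose weighted polar coordinates of [base] and apply [rr2_pos]. *)
Lemma strongly_convex_points : exists2 rho : R, 0 < rho & forall z w,
  normc z <= rho -> normc w <= rho -> Base z w != 0 -> Rr z w = 0 \/ w = 0 ->
  forall zeta om, (zeta != 0) || (om != 0) -> Rr1 zeta om z w = 0 \/ om = 0 ->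
  0 < Rr2 zeta om z w.
Proof.
have [r1 [eta [r10 eta01 H1]]] := rr2_pos wz0 wu0 wzn wun oA A0 sF pP ph fF fE dilPh
  c0 hessPh pgz pgw pgzz pgzw pgwz pgww dq dgz hE.
have [r2 r20 H2] := boundary_near_axis wz0 wu0 wzn wun oA A0 sF fF pq eta01.
have [r3 r30 H3] := Qfun_small wz0 wu0 wzn wun pq.
have r120 : 0 < Num.min r1 r2 by rewrite lt_min r10.
have [d d0 Hd] := dil_small wz wu r120.
exists (Num.min (Num.min r2 r3) (d / 4)); first by rewrite !lt_min r20 r30 divr_gt0.
move=> z w; rewrite !le_min => /andP[/andP[zr2 zr3] zd] /andP[/andP[wr2 wr3] wd].
move=> b0 bd zeta om nz tang.
have [s [x [y [u [s0 sph [xE yE uE]]]]]] := dil_sphere wz0 wu0 (sqr3_neq0 b0).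
have [QE _] := H3 _ _ zr3 wr3.
have zd' : normc z < d by apply: le_lt_trans zd _; rewrite ltr_pdivrMr //; lra.
have ud' : `|Upath q z w| < d.
  apply: le_lt_trans (ler_normD _ _) _.
  have := Re_normc w; have := Im_normc (Qfun q z w); lra.
have : s < Num.min r1 r2.
  apply: (Hd s x y u) => //; rewrite -?xE -?yE -?uE //.
    exact: le_lt_trans (Re_normc _) zd'.
  exact: le_lt_trans (Im_normc _) zd'.
rewrite lt_min => /andP[sr1 sr2].
have bE : Base z w = pt3 (s ^+ wz * x) (s ^+ wz * y) (s ^+ wu * u).
  by rewrite -xE -yE -uE.
apply: (H1 s x y u) => //; last by rewrite s0.
by apply: (H2 s x y u) => //; rewrite s0.
Qed.

(** All first and second derivatives of F and q vanish at the origin, because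
n + n exceeds the weight of any two directions. *)
Lemma origin_values zeta om : [/\ Base 0 0 = 0, Rr1 zeta om 0 0 = - complex.Im om &
  Rr2 zeta om 0 0 = 2 * (complex.Re om ^+ 2 - complex.Im om ^+ 2)].
Proof.
have Q0 : Qfun q 0 0 = 0.
  by apply: (wpol_origin _ (Qfun_wpol wz0 wu0 wzn wun pq)); lia.
have b0 : Base 0 0 = 0 by rewrite /base /Upath Q0 /= addr0.
have gz0 : gz 0 0 = 0 by apply: (wpol_origin _ pgz); lia.
have gw0 : gw 0 0 = 0 by apply: (wpol_origin _ pgw); lia.
have gzz0 : gzz 0 0 = 0 by apply: (wpol_origin _ pgzz); lia.
have gzw0 : gzw 0 0 = 0 by apply: (wpol_origin _ pgzw); lia.
have gwz0 : gwz 0 0 = 0 by apply: (wpol_origin _ pgwz); lia.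
have gww0 : gww 0 0 = 0 by apply: (wpol_origin _ pgww); lia.
have ww : (wz + wz < n + n)%N by lia.
have wuw : (wz + wu < n + n)%N by lia.
have uu : (wu + wu < n + n)%N by lia.
have uz : (wu + wz < n + n)%N by lia.
have wn : (wz < n + n)%N by lia.
have un : (wu < n + n)%N by lia.
have [hx hy hu] := dir_weightE R wz wu.
have axx : ex R \in axes R by rewrite !inE eqxx.
have axy : ey R \in axes R by rewrite !inE eqxx orbT.
have axu : eu R \in axes R by rewrite !inE eqxx !orbT.
have F1 v : v \in axes R -> 'D_v F 0 = 0.
  move=> vax; have h1 : all (mem (axes R)) [:: v] by rewrite /= vax.
  have h2 : (order_weight wz wu [:: v] < n + n)%N.
    rewrite /order_weight big_seq1 /dir_weight; case: ifP => _; [exact: un|exact: wn].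
  exact: (fF h1 h2).
have F2 v v' : v \in axes R -> v' \in axes R -> 'D_v ('D_v' F) 0 = 0.
  move=> vax vax'; have h1 : all (mem (axes R)) [:: v; v'] by rewrite /= vax vax'.
  have h2 : (order_weight wz wu [:: v; v'] < n + n)%N.
    rewrite /order_weight big_cons big_seq1 /dir_weight.
    by do 2 case: ifP => _; [exact: uu|exact: uz|exact: wuw|exact: ww].
  exact: (fF h1 h2).
have G (v : R3 R) p1 p2 p3 : v \in axes R -> grad ('D_v F) 0 p1 p2 p3 = 0.
  move=> vax.
  have L (a b e : R) : a = 0 -> b = 0 -> e = 0 -> a * p1 + b * p2 + e * p3 = 0.
    by move=> -> -> ->; rewrite !mul0r !addr0.
  by apply: L; apply: F2.
have Q1E : Q1 gz gw zeta om 0 0 = 0.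
  by rewrite /Q1 gz0 gw0 mulr0 addr0 !mul0r addr0.
have Q2E : Q2 gzz gzw gwz gww zeta om 0 0 = 2 * om ^+ 2.
  by rewrite /Q2 gzz0 gzw0 gwz0 gww0 !mul0r !addr0 !mul0r !add0r expr2 mulrA.
have twoE : (2 : C) = (2 : R)%:C by apply/eqP; rewrite eq_complex /= addr0 !eqxx.
split=> //.
  rewrite /rr1 b0 Q1E.
  have L (a b e p1 p2 p3 t : R) : a = 0 -> b = 0 -> e = 0 ->
      a * p1 + b * p2 + e * p3 + 0 - t = - t.
    by move=> -> -> ->; rewrite !mul0r !addr0 sub0r.
  by apply: L; apply: F1.
rewrite /rr2 b0 Q2E.
have L (a b e f p1 p2 p3 p4 t : R) : a = 0 -> b = 0 -> e = 0 -> f = 0 ->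
    a * p1 + b * p2 + (e * p3 + f * p4) + t = t.
  by move=> -> -> -> ->; rewrite !mul0r !addr0 add0r.
apply: etrans (L _ _ _ _ _ _ _ _ _ (G _ _ _ _ axx) (G _ _ _ _ axy) (G _ _ _ _ axu) (F1 _ axu)) _.
by rewrite twoE Re_sqr !real_normK ?num_real.
Qed.

(** If the base point is 0 and rr = 0 then w = i Q(0, w), which is smaller than w
unless w = 0. *)
Lemma base_eq0 : exists2 rho : R, 0 < rho & forall z w, normc z <= rho ->
  normc w <= rho -> Base z w = 0 -> Rr z w = 0 -> z = 0 /\ w = 0.
Proof.
have [r3 r30 H3] := Qfun_small wz0 wu0 wzn wun pq.
exists r3 => // z w zr wr bE rE.
have F0 : F 0 = 0.
  have h2 : (order_weight wz wu (Nil (R3 R)) < n + n)%N.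
    by rewrite /order_weight big_nil; lia.
  exact: (fF (vs := [::]) isT h2).
have [zr0 zi0 U0] : [/\ complex.Re z = 0, complex.Im z = 0 & Upath q z w = 0].
  by move: bE => [].
have z0 : z = 0 by move: zr0 zi0; case: (z) => a b /= -> ->.
split=> //; apply: eq0_normc.
have wE : w = 'i * Qfun q z w.
  move: rE U0; rewrite /rr bE F0 /Upath add0r; move: (Qfun q z w) => [a b].
  case: (w) => w1 w2 /= => /eqP; rewrite subr_eq0 => /eqP <- /eqP.
  rewrite addr_eq0 => /eqP ->; congr (_ +i* _); ring.
have [+ _] := H3 _ _ zr wr.
have : normc w = normc (Qfun q z w).
  by rewrite {1}wE normcM normc_i mul1r.
rewrite z0 normc0 add0r => <- hw; apply/eqP; rewrite eq_le normc_ge0 andbT.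
have := normc_ge0 w; lra.
Qed.

End GoodRadius.

(** * From tangential convexity to convexity *)

Section Touching.
Variables (R : realType) (wz wu n : nat).
Let C := Cx R.
Variables (F : R3 R -> R) (A : set (R3 R)).
Hypothesis sF : smooth_on A F.
Variables (q gz gw gzz gzw gwz gww : C -> C -> C).
Hypothesis pq : wpol wz wu n q.
Hypotheses (dq : pathdiff q gz gw) (dgz : pathdiff gz gzz gzw)
  (dgw : pathdiff gw gwz gww).

Notation Rr1 := (rr1 F q gz gw).
Notation Rr2 := (rr2 F q gz gw gzz gzw gwz gww).
Notation Base := (base q).
Notation Rr := (rr F q).

Variable rho : R.
Hypothesis HA : forall z w, normc z <= rho -> normc w <= rho -> A (Base z w).
Hypothesis Hpos : forall z w, normc z <= rho -> normc w <= rho ->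
  Base z w != 0 -> Rr z w = 0 \/ w = 0 ->
  forall zeta om, (zeta != 0) || (om != 0) -> Rr1 zeta om z w = 0 \/ om = 0 ->
  0 < Rr2 zeta om z w.
Hypothesis Horigin : forall zeta om, Rr1 zeta om 0 0 = - complex.Im om /\
  Rr2 zeta om 0 0 = 2 * (complex.Re om ^+ 2 - complex.Im om ^+ 2).
Hypothesis Hbase0 : forall z w, normc z <= rho -> normc w <= rho ->
  Base z w = 0 -> Rr z w = 0 -> z = 0 /\ w = 0.
Hypothesis Hdec : forall z w (t : R), normc z <= rho -> normc w <= rho ->
  normc (w + (0 +i* t)) <= rho -> 0 < t -> Rr z (w + (0 +i* t)) < Rr z w.

Lemma Rr_continuous (T : topologicalType) (zt wt : T -> C) x :
  ccont zt x -> ccont wt x -> normc (zt x) <= rho -> normc (wt x) <= rho ->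
  {for x, continuous (fun y => Rr (zt y) (wt y))}.
Proof.
move=> cz cw zr wr.
have cQ : ccont (fun y => Qfun q (zt y) (wt y)) x.
  apply: ccont_add; first exact: ccont_wpol pq cz cw.
  by apply: ccont_mul.
have cb : {for x, continuous (fun y => Base (zt y) (wt y))}.
  have cU : {for x, continuous (fun y => Upath q (zt y) (wt y))}.
    exact: continuousD cw.1 cQ.2.
  exact: (cvg_pair (cvg_pair cz.1 cz.2) cU).
have cF : {for Base (zt x) (wt x), continuous F}.
  exact: differentiable_continuous (sF [::] (HA zr wr)).
have cFb : {for x, continuous (fun y => F (Base (zt y) (wt y)))}.
  exact: (continuous_comp cb cF).
exact: continuousB (continuousD cFb cQ.1) cw.2.
Qed.

Section Segment.
Variables z0 w0 zeta om : C.
Let zt (t : R) := z0 + t%:C * zeta.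
Let wt (t : R) := w0 + t%:C * om.
Variables (t0 : R).
Hypotheses (t01 : 0 < t0 < 1).
Hypothesis inz : forall t, 0 <= t <= 1 -> normc (zt t) <= rho.
Hypothesis inw : forall t, 0 <= t <= 1 -> normc (wt t) <= rho.
Hypothesis neg : forall t, 0 <= t <= 1 -> Rr (zt t) (wt t) <= 0.
Hypothesis touch : Rr (zt t0) (wt t0) = 0.

Lemma touching_interval : exists2 e : R, 0 < e & forall t, `|t - t0| < e -> 0 <= t <= 1.
Proof.
have /andP[h1 h2] := t01.
exists (Num.min t0 (1 - t0)); first by rewrite lt_min h1 subr_gt0.
move=> t; rewrite lt_min !ltr_distl => /andP[/andP[k1 k2] /andP[k3 k4]].
by apply/andP; split; lra.
Qed.

Lemma touching_derivatives :
  Rr1 zeta om (zt t0) (wt t0) = 0 /\ Rr2 zeta om (zt t0) (wt t0) <= 0.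
Proof.
have [e e0 He] := touching_interval.
apply: (@second_derivative_test R (fun t => Rr (zt t) (wt t))
   (fun t => Rr1 zeta om (zt t) (wt t)) t0 _ e e0).
- move=> t /He t1; apply: (is_derive_rr sF dq).
  by apply: HA; [exact: inz|exact: inw].
- apply: (is_derive_rr1 sF dq dgz dgw).
  have t1 : 0 <= t0 <= 1 by have /andP[/ltW -> /ltW ->] := t01.
  by apply: HA; [exact: inz|exact: inw].
- by move=> t /He t1; rewrite touch; exact: neg.
Qed.

(** A touching point at which the base point is not the origin contradicts
[strongly_convex_points].  At the origin the two derivatives force om = 0, so that the
whole segment lies in w = 0; there the second derivative is positive off the origin and
rr would become positive on the segment. *)
Lemma no_touching : (zeta != 0) || (om != 0) -> False.
Proof.
move=> nz; have [d1 d2] := touching_derivatives.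
have t1 : 0 <= t0 <= 1 by have /andP[/ltW -> /ltW ->] := t01.
have [b0|b0] := eqVneq (Base (zt t0) (wt t0)) 0; last first.
  have := Hpos (inz t1) (inw t1) b0 (or_introl touch) nz (or_introl d1).
  by rewrite ltNge d2.
have [ztz wtz] := Hbase0 (inz t1) (inw t1) b0 touch.
move: d1 d2; rewrite ztz wtz; have [-> ->] := Horigin zeta om.
move=> /eqP; rewrite oppr_eq0 => /eqP im0; rewrite im0 expr0n /= subr0 => re0.
have om0 : om = 0.
  have {}re0 : complex.Re om = 0.
    apply/eqP; rewrite -sqrf_eq0 eq_le sqr_ge0 andbT.
    by rewrite -(@pmulr_rle0 _ 2).
  by move: re0 im0; case: (om) => a b /= -> ->.
have zn0 : zeta != 0 by move: nz; rewrite om0 eqxx orbF.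
(* the segment lies in the line w = 0, where the second derivative is positive
   off the origin; hence the derivative increases away from its zero at t0 *)
have wt0 t : wt t = 0.
  move: wtz; rewrite /wt om0 !mulr0 !addr0; exact.
have ztE t : zt t = (t - t0)%:C * zeta.
  have -> : (t - t0)%:C = t%:C - t0%:C :> C by exact: rmorphB.
  rewrite mulrBl -[zt t]subr0 -ztz /zt; ring.
have [e e0 He] := touching_interval.
pose g t := Rr (zt t) (wt t); pose g1 t := Rr1 zeta om (zt t) (wt t).
pose g2 t := Rr2 zeta om (zt t) (wt t).
have dg t : `|t - t0| < e -> is_derive t 1 g (g1 t).
  move=> /He t1'; apply: (is_derive_rr sF dq).
  by apply: HA; [exact: inz|exact: inw].
have dg1 t : `|t - t0| < e -> is_derive t 1 g1 (g2 t).
  move=> /He t1'; apply: (is_derive_rr1 sF dq dgz dgw).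
  by apply: HA; [exact: inz|exact: inw].
have g2pos t : `|t - t0| < e -> t != t0 -> 0 < g2 t.
  move=> /He t1' tt0; apply: Hpos => //; [exact: inz|exact: inw| |by right|by right].
  apply: contra_neq tt0 => bE.
  have [zr0 zi0] : complex.Re (zt t) = 0 /\ complex.Im (zt t) = 0 by move: bE => [].
  have : zt t = 0 by move: zr0 zi0; case: (zt t) => a b /= -> ->.
  rewrite ztE => /eqP; rewrite mulf_eq0 (negbTE zn0) orbF => /eqP [/eqP].
  by rewrite subr_eq0 => /eqP.
have g10 : g1 t0 = 0.
  by rewrite /g1 ztz wtz (Horigin zeta om).1 om0 /= oppr0.
have g1pos t : t0 < t -> t - t0 < e -> 0 < g1 t.
  move=> tt0 te; have [s /andP[s0 s1]|s /andP[s0 s1] E] := @mean_value R g1 g2 t0 t tt0.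
    by apply: dg1; rewrite ger0_norm; lra.
  have : 0 < g2 s * (t - t0).
    rewrite mulr_gt0 ?subr_gt0 // g2pos ?gt_eqF // ger0_norm; lra.
  by rewrite -E g10 subr0.
pose t' := t0 + e / 2.
have tt' : t0 < t' by rewrite /t'; lra.
have te' : t' - t0 < e by rewrite /t'; lra.
have [s /andP[s0 s1]|s /andP[s0 s1] E] := @mean_value R g g1 t0 t' tt'.
  by apply: dg; rewrite ger0_norm; lra.
have gp : 0 < g1 s by apply: g1pos => //; lra.
have : 0 < g1 s * (t' - t0) by rewrite mulr_gt0 // subr_gt0.
have t1' : 0 <= t' <= 1 by apply: He; rewrite ger0_norm; lra.
rewrite -E; have := neg t1'; rewrite -/(g t'); move: touch; rewrite -/(g t0) => ->.
by rewrite subr0 leNgt => /negP.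
Qed.

End Segment.

Section ConvexBox.
Variable eta : R.
Hypotheses (eta0 : 0 < eta) (etarho : 4 * eta <= rho).
Hypothesis Htop : forall z w, `|complex.Re z| < eta / 16 -> `|complex.Im z| < eta / 16 ->
  `|complex.Re w| < eta / 16 -> eta / 2 <= complex.Im w -> normc w <= rho -> Rr z w < 0.

(** Shorter in z and u than in v, by a factor that forces rr to be negative on the
upper part of the box. *)
Definition box (z w : C) : Prop :=
  [/\ `|complex.Re z| < eta / 16, `|complex.Im z| < eta / 16,
      `|complex.Re w| < eta / 16 & `|complex.Im w| < eta].

Lemma Re_segment (a b : C) (t : R) :
  complex.Re (a + t%:C * (b - a)) = complex.Re a + t * (complex.Re b - complex.Re a) /\
  complex.Im (a + t%:C * (b - a)) = complex.Im a + t * (complex.Im b - complex.Im a).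
Proof. by case: a b => [a1 a2] [b1 b2] /=; rewrite !mul0r subr0 addr0. Qed.

Lemma box_segment z0 w0 z1 w1 t : box z0 w0 -> box z1 w1 -> 0 <= t <= 1 ->
  box (z0 + t%:C * (z1 - z0)) (w0 + t%:C * (w1 - w0)).
Proof.
move=> [a1 a2 a3 a4] [b1 b2 b3 b4] t01.
have [z1E z2E] := Re_segment z0 z1 t; have [w1E w2E] := Re_segment w0 w1 t.
by rewrite /box z1E z2E w1E w2E; split; apply: segment_lt.
Qed.

Lemma box_shift_bound z w (t : R) : box z w -> 0 <= t <= 3 / 2 * eta ->
  normc z <= rho /\ normc (w + (0 +i* t)) <= rho.
Proof.
move=> [b1 b2 b3 b4] /andP[t0 t1]; split.
  apply: le_trans (normc_ReIm _) _; apply: le_trans (lerD (ltW b1) (ltW b2)) _.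
  by move: eta0 etarho; lra.
apply: le_trans (normcD _ _) _; apply: le_trans (lerD (normc_ReIm _) (normc_ReIm _)) _.
rewrite /= normr0 add0r (ger0_norm t0).
apply: le_trans (lerD (lerD (ltW b3) (ltW b4)) t1) _.
by move: eta0 etarho; lra.
Qed.

(** If the segment meets rr >= 0, let s0 be the largest shift in the direction
of v for which it still does.  This s0 exists by compactness, it is less than 3/2 eta because rr is
negative there, and the shifted end points keep rr < 0.  Hence rr has an interior zero
maximum on the shifted segment. *)
Theorem segment_negative z0 w0 z1 w1 t : box z0 w0 -> box z1 w1 ->
  Rr z0 w0 < 0 -> Rr z1 w1 < 0 -> 0 <= t <= 1 ->
  Rr (z0 + t%:C * (z1 - z0)) (w0 + t%:C * (w1 - w0)) < 0.
Proof.
move=> B0 B1 neg0 neg1 tin; rewrite ltNge; apply/negP => rpos.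
pose zeta := z1 - z0; pose om := w1 - w0; pose S := 3 / 2 * eta.
have S0 : 0 <= S by rewrite mulr_ge0 // ltW.
pose ws (s t : R) : C := w0 + (0 +i* s) + t%:C * om.
pose zt (t : R) : C := z0 + t%:C * zeta.
have wsE s r : ws s r = w0 + r%:C * om + (0 +i* s) by rewrite /ws addrAC.
have inb s r : 0 <= s <= S -> 0 <= r <= 1 ->
    normc (zt r) <= rho /\ normc (ws s r) <= rho.
  by move=> hs hr; rewrite wsE; exact: (box_shift_bound (box_segment B0 B1 hr) hs).
pose phi (x : R * R) := Rr (zt x.2) (ws x.1 x.2).
pose rect := `[0, S]%classic `*` `[0, 1]%classic : set (R * R).
have rectP x : rect x -> 0 <= x.1 <= S /\ 0 <= x.2 <= 1.
  by move=> [/=]; rewrite !in_itv.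
have cphi : {within rect, continuous phi}.
  apply: continuous_in_subspaceT => x; rewrite inE => /rectP[hs hr].
  have [zr wr] := inb _ _ hs hr.
  have c1 : {for x, continuous (fun y : R * R => y.1)} by exact: cvg_fst.
  have c2 : {for x, continuous (fun y : R * R => y.2)} by exact: cvg_snd.
  have ct : ccont (fun y : R * R => y.2%:C : C) x by split; [|exact: cst_continuous].
  have cs : ccont (fun y : R * R => (0 +i* y.1 : C)) x by split; [exact: cst_continuous|].
  apply: (@Rr_continuous _ (fun y => zt y.2) (fun y => ws y.1 y.2)) => //.
    apply: ccont_add; first exact: ccont_cst.
    by apply: ccont_mul => //; exact: ccont_cst.
  apply: ccont_add.
    by apply: ccont_add => //; exact: ccont_cst.
  by apply: ccont_mul => //; exact: ccont_cst.
have crect : compact rect by apply: compact_setX; exact: segment_compact.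
pose K := rect `&` phi @^-1` `[0, +oo[%classic.
have cK : compact K.
  have : closed (phi @^-1` `[0, +oo[%classic : set (subspace rect)).
    by move/continuous_closedP: cphi; apply; exact: interval_closed.
  move=> /closed_subspaceP[V cV VE].
  have -> : K = rect `&` V by rewrite [RHS]setIC VE setIC.
  exact: compact_closedI.
have K0 : K !=set0.
  exists (0, t); split; first by split; rewrite /= in_itv /= ?lexx ?S0.
  rewrite /= in_itv /= andbT /phi /ws /=.
  have -> : w0 + (0 +i* 0) = w0 by exact: addr0.
  exact: rpos.
have c1 : {within K, continuous (fun x : R * R => x.1)}.
  by apply: continuous_subspaceT => x; exact: cvg_fst.
have [[s0 t0]] := compact_EVT_max K0 cK c1.
rewrite inE => -[/rectP[/= hs0 ht0] /=]; rewrite in_itv /= andbT => phi0 maxK.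
have above s r : s0 < s -> s <= S -> 0 <= r <= 1 -> phi (s, r) < 0.
  move=> ss sS hr; rewrite ltNge; apply/negP => pos.
  have : (s, r) \in K.
    rewrite inE; split; last by rewrite /= in_itv /= pos.
    split; rewrite /= in_itv /= ?hr // sS andbT.
    by have /andP[h _] := hs0; rewrite (le_trans h) // ltW.
  by move=> /maxK /=; rewrite leNgt ss.
have top r : 0 <= r <= 1 -> phi (S, r) < 0.
  move=> hr; have [b1 b2 b3 b4] := box_segment B0 B1 hr.
  have SS : 0 <= S <= S by rewrite S0 lexx.
  have [_ wr] := inb _ _ SS hr.
  rewrite /phi /= wsE; apply: Htop => //.
  - by rewrite Re_add /= addr0.
  - rewrite Im_add /=; move: b4; rewrite ltr_norml => /andP[b4 _].
    rewrite /S; move: b4; rewrite -/om; lra.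
  - by rewrite -wsE.
have s0S : s0 < S.
  have /andP[_ h] := hs0; rewrite lt_neqAle h andbT; apply/negP => /eqP E.
  by have := top t0 ht0; rewrite -E ltNge phi0.
have below r : 0 <= r <= 1 -> phi (s0, r) <= 0.
  move=> hr; rewrite leNgt; apply/negP => pos.
  have [zr wr] := inb _ _ hs0 hr.
  have cs : ccont (fun s : R => ws s r) s0.
    apply: ccont_add; last exact: ccont_cst.
    apply: ccont_add; first exact: ccont_cst.
    by split; [exact: cst_continuous|move=> ? h; exact: h].
  have := @Rr_continuous R (fun=> zt r) (fun s => ws s r) s0 (ccont_cst _ _) cs zr wr.
  move=> /cvgrPdist_lt /(_ _ pos) /nbhs_ballP[d /= d0 Hd].
  pose s := s0 + Num.min d (S - s0) / 2.
  have m0 : 0 < Num.min d (S - s0) by rewrite lt_min d0 subr_gt0.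
  have md : Num.min d (S - s0) <= d by rewrite ge_min lexx.
  have mS : Num.min d (S - s0) <= S - s0 by rewrite ge_min lexx orbT.
  have ss : s0 < s by rewrite /s; lra.
  have sS : s <= S by rewrite /s; lra.
  have := above s r ss sS hr.
  have := Hd s; rewrite -ball_normE /= distrC gtr0_norm ?subr_gt0 //.
  have -> : s - s0 < d by rewrite /s; lra.
  move=> /(_ isT); rewrite -/(phi (s0, r)) -/(phi (s, r)) ltr_norml => /andP[_].
  lra.
have touch : phi (s0, t0) = 0 by apply/eqP; rewrite eq_le below.
have lower z w : box z w -> Rr z w < 0 -> Rr z (w + (0 +i* s0)) < 0.
  move=> Bzw zwneg; have /andP[s00 s0S'] := hs0.
  have [zr wr] := box_shift_bound Bzw hs0.
  have z00 : 0 <= (0 : R) <= 3 / 2 * eta by rewrite lexx.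
  have [_] := box_shift_bound Bzw z00.
  have -> : w + (0 +i* 0) = w by exact: addr0.
  move=> wr0; have [->|sn0] := eqVneq s0 0.
    by have -> : w + (0 +i* 0) = w by exact: addr0.
  apply: lt_trans zwneg; apply: Hdec => //.
  by rewrite lt_def sn0.
have e0 : phi (s0, 0) < 0.
  rewrite /phi /= /zt /ws !mul0r !addr0; exact: lower.
have e1 : phi (s0, 1) < 0.
  rewrite /phi /= wsE /zt.
  have -> : z0 + 1%:C * zeta = z1 by rewrite mul1r addrC subrK.
  have -> : w0 + 1%:C * om = w1 by rewrite mul1r addrC subrK.
  exact: lower.
have t0in : 0 < t0 < 1.
  have /andP[h1 h2] := ht0; rewrite !lt_def h1 h2 !andbT.
  apply/andP; split; apply/eqP => E.
    by move: e0; rewrite -[X in (s0, X)]E touch ltxx.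
  by move: e1; rewrite [X in (s0, X)]E touch ltxx.
apply: (@no_touching z0 (w0 + (0 +i* s0)) zeta om t0 t0in) => //.
- by move=> r hr; exact: (inb _ _ hs0 hr).1.
- by move=> r hr; exact: (inb _ _ hs0 hr).2.
rewrite -negb_and; apply/negP => /andP[/eqP zeta0 /eqP om0].
by move: e0; rewrite -touch /phi /= /zt /ws zeta0 om0 !mulr0 ltxx.
Qed.

End ConvexBox.

End Touching.

(** * Topology of C2 in terms of moduli *)

Section ComplexTopology.
Variable R : realType.
Let C := Cx R.

Lemma norm_normc (z : C) : `|z| = (normc z)%:C.
Proof. by case: z. Qed.

Lemma ltC_real (a b : R) : ((a%:C : C) < b%:C) = (a < b).
Proof. exact: ltcR. Qed.

Lemma leC_real (a b : R) : ((a%:C : C) <= b%:C) = (a <= b).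
Proof. exact: lecR. Qed.

Lemma gt0_real (e : C) : 0 < e -> exists2 d : R, 0 < d & e = d%:C.
Proof.
case: e => a b; rewrite ltcE /= => /andP[/eqP -> a0].
by exists a.
Qed.

(** The norm of C2 takes values in the complex numbers; moduli bring it back to
real numbers. *)
Lemma ball_C2 (p r : C2 R) (d : R) :
  ball p (d%:C : C) r <-> normc (p.1 - r.1) < d /\ normc (p.2 - r.2) < d.
Proof.
split=> [[]|[h1 h2]].
  by rewrite -!ball_normE /= !norm_normc !ltC_real.
by split; rewrite -ball_normE /= norm_normc ltC_real.
Qed.

Lemma nbhs_C2 (p : C2 R) (B : set (C2 R)) : nbhs p B <-> exists2 d : R, 0 < d &
  forall r, normc (r.1 - p.1) < d -> normc (r.2 - p.2) < d -> B r.
Proof.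
split=> [/nbhs_ballP[e /= /gt0_real[d d0 ->] H]|[d d0 H]].
  exists d => // r h1 h2; apply: H; apply/ball_C2.
  by rewrite normcB [normc (p.2 - _)]normcB.
apply/nbhs_ballP; exists (d%:C : C) => /=; first by rewrite ltC_real.
by move=> r /ball_C2[h1 h2]; apply: H; rewrite normcB.
Qed.

Lemma open_C2 (B : set (C2 R)) : open B <-> forall p, B p -> nbhs p B.
Proof. by rewrite openE; split. Qed.

Lemma norm_C2_ge (p : C2 R) : (normc p.1)%:C <= `|p| /\ (normc p.2)%:C <= `|p|.
Proof.
rewrite prod_normE -!norm_normc !comparable_le_max ?lexx ?orbT //.
  by rewrite real_comparable ?normr_real.
by rewrite real_comparable ?normr_real.
Qed.

Lemma norm_C2_le (p : C2 R) (d : R) : normc p.1 <= d -> normc p.2 <= d ->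
  `|p| <= (d%:C : C).
Proof.
move=> h1 h2; rewrite prod_normE comparable_ge_max; last first.
  by rewrite real_comparable ?normr_real.
by rewrite !norm_normc !leC_real h1 h2.
Qed.

Lemma norm_C2_real (p : C2 R) : exists2 d : R, 0 <= d & `|p| = d%:C.
Proof.
have := normr_ge0 p; case: (`|p|) => a b; rewrite lecE /= => /andP[/eqP -> a0].
by exists a.
Qed.

End ComplexTopology.

(** * The shear is a holomorphic coordinate change *)

Section Perturbation.
Variables (R : realType).
Let C := Cx R.
Variable T : C -> C.
Hypothesis cT : forall x : R * R, ccont (fun y : R * R => T (y.1 +i* y.2)) x.

(** If T has a small Lipschitz constant then w - T w = y is solvable near an
approximate solution.  Minimize |w - T w - y| over a closed square around w0.  The
minimizer lies well inside; were the minimum positive, a small step in the direction of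
the defect would decrease it, since T changes little along the step. *)
Lemma perturbed_identity_onto (w0 y : C) (e : R) : 0 < e ->
  (forall w w', normc (w - w0) <= 2 * e -> normc (w' - w0) <= 2 * e ->
     normc (T w - T w') <= normc (w - w') / 16) ->
  normc (w0 - T w0 - y) < e / 4 ->
  exists2 w, normc (w - w0) < e & w - T w = y.
Proof.
move=> e0 lipT close.
pose G w := w - T w - y.
pose Ia := `[complex.Re w0 - e, complex.Re w0 + e]%classic.
pose Ib := `[complex.Im w0 - e, complex.Im w0 + e]%classic.
pose K := Ia `*` Ib : set (R * R).
have cK : compact K by apply: compact_setX; exact: segment_compact.
pose f (x : R * R) := complex.Re (G (x.1 +i* x.2)) ^+ 2 + complex.Im (G (x.1 +i* x.2)) ^+ 2.
have fE x : f x = normc (G (x.1 +i* x.2)) ^+ 2.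
  rewrite /f; case: (G _) => a b /=; rewrite sqr_sqrtr // addr_ge0 ?sqr_ge0 //.
have cf : {within K, continuous f}.
  apply: continuous_subspaceT => x.
  have cG : ccont (fun y : R * R => G (y.1 +i* y.2)) x.
    apply: (ccont_add (f := fun y : R * R => (y.1 +i* y.2) + - T (y.1 +i* y.2))); last exact: ccont_cst.
    apply: ccont_add; first by split; [exact: cvg_fst|exact: cvg_snd].
    have := ccont_mul (ccont_cst (-1) x) (cT x).
    by under [X in ccont X]eq_fun do rewrite mulN1r.
  have sq (k : R * R -> R) : {for x, continuous k} -> {for x, continuous (fun y => k y ^+ 2)}.
    by move=> ck; apply: (continuousM ck ck).
  exact: continuousD (sq _ cG.1) (sq _ cG.2).
have inK w : normc (w - w0) <= e -> K (complex.Re w, complex.Im w).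
  move=> h; have hr := le_trans (Re_normc _) h; have hi := le_trans (Im_normc _) h.
  move: hr hi; have -> : complex.Re (w - w0) = complex.Re w - complex.Re w0.
    by case: (w) (w0) => [? ?] [? ?].
  have -> : complex.Im (w - w0) = complex.Im w - complex.Im w0.
    by case: (w) (w0) => [? ?] [? ?].
  rewrite !ler_distl => hr hi; split; rewrite ?/Ia ?/Ib /= in_itv /=; [exact: hr|exact: hi].
have K0 : K !=set0.
  by exists (complex.Re w0, complex.Im w0); apply: inK; rewrite subrr normc0 ltW.
have [[a b]] := compact_EVT_min K0 cK cf.
rewrite inE => -[/= ha hb] minK; move: ha hb; rewrite /Ia /Ib /= !in_itv /= => ha hb.
pose w := (a +i* b : C).
have etaw (v : C) : (complex.Re v +i* complex.Im v) = v by case: v.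
have minG v : normc (v - w0) <= e -> normc (G w) <= normc (G v).
  move=> /inK vK; have /minK : (complex.Re v, complex.Im v) \in K by rewrite inE.
  by rewrite !fE /= etaw ler_pXn2r // nnegrE normc_ge0.
have w2e : normc (w - w0) <= 2 * e.
  apply: le_trans (normc_ReIm _) _.
  have -> : complex.Re (w - w0) = a - complex.Re w0 by rewrite /w; case: (w0).
  have -> : complex.Im (w - w0) = b - complex.Im w0 by rewrite /w; case: (w0).
  by rewrite mulr_natl mulr2n lerD // ler_distl.
have z2e : normc (w0 - w0) <= 2 * e by rewrite subrr normc0 mulr_ge0 // ltW.
have G0 : normc (G w) < e / 4.
  by apply: le_lt_trans close; apply: minG; rewrite subrr normc0 ltW.
have wT := lipT _ _ w2e z2e.
(* the square is larger than the disc of radius e; the minimizer lies in the disc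
   because the defect at w is at most the defect at w0 *)
have we : normc (w - w0) < e.
  have wE : w - w0 = G w + (T w - T w0) - (w0 - T w0 - y) by rewrite /G; ring.
  have : normc (w - w0) <= normc (G w) + normc (T w - T w0) + normc (w0 - T w0 - y).
    rewrite {1}wE; apply: le_trans (normcD _ _) _; rewrite normcN lerD2r.
    exact: normcD.
  move: G0 wT close; lra.
exists w => //; apply/eqP; rewrite -subr_eq0; apply/eqP/eq0_normc/eqP.
rewrite -/(G w); apply: contraT => Gn0.
have Gp : 0 < normc (G w) by rewrite lt_def Gn0 normc_ge0.
pose t := Num.min 1 ((e - normc (w - w0)) / normc (G w)).
have t0 : 0 < t by rewrite lt_min ltr01 divr_gt0 // subr_gt0.
have t1 : t <= 1 by rewrite ge_min lexx.
have tG : t * normc (G w) <= e - normc (w - w0).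
  by rewrite -ler_pdivlMr // ge_min lexx orbT.
(* one step from the minimizer towards the solution, short enough to stay in the disc *)
pose v := w - t%:C * G w.
have nt : normc (t%:C * G w) = t * normc (G w).
  by rewrite normcM normc_real gtr0_norm.
have ve : normc (v - w0) <= e.
  have -> : v - w0 = (w - w0) - t%:C * G w by rewrite /v; ring.
  apply: le_trans (normcD _ _) _; rewrite normcN nt; move: tG; lra.
have v2e : normc (v - w0) <= 2 * e by move: ve e0; lra.
have := minG v ve; have := lipT _ _ v2e w2e.
have -> : normc (v - w) = t * normc (G w) by rewrite -nt -normcN /v; congr normc; ring.
move=> hT; have vE : G v = (1 - t)%:C * G w - (T v - T w).
  have -> : (1 - t)%:C = 1 - t%:C :> C by exact: rmorphB.
  by rewrite /G /v /G; ring.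
have : normc (G v) <= (1 - t) * normc (G w) + normc (T v - T w).
  rewrite vE; apply: le_trans (normcD _ _) _; rewrite normcN normcM normc_real.
  by rewrite ger0_norm // subr_ge0.
have : 0 < t * normc (G w) by rewrite mulr_gt0.
move: hT; rewrite mulrBl mul1r; lra.
Qed.

End Perturbation.

Section Shear.
Variables (R : realType) (wz wu m : nat).
Let C := Cx R.
Variables (Q Gz Gw : C -> C -> C) (rho : R).
Hypothesis pQ : wpol wz wu m Q.
Hypothesis dQ : pairdiff Q Gz Gw.
Hypothesis rho0 : 0 < rho.
Hypothesis lipQ : forall z w w', normc z <= rho -> normc w <= rho -> normc w' <= rho ->
  normc (Q z w - Q z w') <= normc (w - w') / 16.
Hypothesis smallGw : forall z w, normc z <= rho -> normc w <= rho -> normc (Gw z w) <= 2^-1.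

Definition shear (b : C2 R) : C2 R := (b.1, b.2 - 'i * Q b.1 b.2).

(** Equal images have equal z, and their values of w differ by the difference of
Q, which is smaller than that of w. *)
Lemma shear_inj b b' : normc b.1 <= rho -> normc b.2 <= rho -> normc b'.2 <= rho ->
  shear b = shear b' -> b = b'.
Proof.
case: b b' => [z w] [z' w'] /= zr wr wr' [zz]; rewrite -zz => ww.
have E : w - w' = 'i * (Q z w - Q z w').
  transitivity ((w - 'i * Q z w) + 'i * Q z w - w'); first by rewrite subrK.
  rewrite ww; ring.
have a0 := normc_ge0 (w - w').
have : normc (w - w') <= normc (w - w') / 16.
  by rewrite {1}E normcM normc_i mul1r; exact: lipQ.
move=> h; congr (_, _); apply/eqP; rewrite -subr_eq0; apply/eqP/eq0_normc.
by apply/eqP; rewrite eq_le a0 andbT; move: h a0; lra.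
Qed.

Lemma shear_diff b : is_diff b shear
  (fun e : C2 R => (e.1, e.2 - 'i * (Gz b.1 b.2 * e.1 + Gw b.1 b.2 * e.2))).
Proof.
have h1 : is_diff b (fst : C2 R -> C) fst.
  apply: DiffDef; first by apply: linear_differentiable => x; exact: cvg_fst.
  by apply: diff_lin => x; exact: cvg_fst.
have h2 : is_diff b (snd : C2 R -> C) snd.
  apply: DiffDef; first by apply: linear_differentiable => x; exact: cvg_snd.
  by apply: diff_lin => x; exact: cvg_snd.
exact: is_diff_pair h1 (is_diffB h2 (is_diffZ 'i (dQ b))).
Qed.

(** Surjectivity near a point with control of the preimage: solve in w for each
fixed z by [perturbed_identity_onto].  This gives both openness of the image and
continuity of the inverse. *)
Lemma shear_local (B : set (C2 R)) b0 : open B -> B b0 ->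
  normc b0.1 < rho -> normc b0.2 < rho -> forall e : R, 0 < e ->
  exists2 d : R, 0 < d & forall y : C2 R, normc (y.1 - (shear b0).1) < d ->
    normc (y.2 - (shear b0).2) < d ->
  exists b, [/\ B b, shear b = y, normc b.2 <= rho, normc (b.1 - b0.1) < e
    & normc (b.2 - b0.2) < e].
Proof.
case: b0 => z0 w0 oB Bb0 /= zr wr e e0.
have [d0 d00 Hd] := (nbhs_C2 _ _).1 ((open_C2 B).1 oB _ Bb0).
have [k k0 Hk] := wpol_lipschitz pQ (ltW rho0).
have [e' [e'0 e'e e'd e'r]] : exists e' : R,
    [/\ 0 < e', e' <= e, e' <= d0 & 2 * e' <= rho - normc w0].
  exists (Num.min (Num.min e d0) ((rho - normc w0) / 2)); split.
  - by rewrite !lt_min e0 d00 divr_gt0 // subr_gt0.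
  - by rewrite !ge_min lexx.
  - by rewrite !ge_min lexx orbT.
  - by rewrite mulrC -ler_pdivlMr // !ge_min lexx !orbT.
have k10 : 0 < 8 * (1 + k) by rewrite mulr_gt0 // ltr_wpDr.
pose d := Num.min (Num.min e' (rho - normc z0)) (e' / (8 * (1 + k))).
exists d; first by rewrite !lt_min e'0 subr_gt0 zr divr_gt0.
case=> z y /= hz; rewrite !lt_min in hz; move/andP: hz => [/andP[hz1 hz2] hz3].
rewrite !lt_min => /andP[_ hy].
have zr' : normc z <= rho.
  rewrite -(subrK z0 z); apply: le_trans (normcD _ _) _; move: hz2; lra.
have cT x : ccont (fun v : R * R => 'i * Q z (v.1 +i* v.2)) x.
  apply: ccont_mul; first exact: ccont_cst.
  apply: ccont_wpol pQ _ _; first exact: ccont_cst.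
  by split; [exact: cvg_fst|exact: cvg_snd].
have inr w : normc (w - w0) <= 2 * e' -> normc w <= rho.
  move=> h; rewrite -(subrK w0 w); apply: le_trans (normcD _ _) _.
  move: h e'r; lra.
have lipT w w' : normc (w - w0) <= 2 * e' -> normc (w' - w0) <= 2 * e' ->
    normc ('i * Q z w - 'i * Q z w') <= normc (w - w') / 16.
  by move=> /inr h /inr h'; rewrite -mulrBr normcM normc_i mul1r; exact: lipQ.
have close : normc (w0 - 'i * Q z w0 - y) < e' / 4.
  have -> : w0 - 'i * Q z w0 - y =
    - (y - (w0 - 'i * Q z0 w0)) - 'i * (Q z w0 - Q z0 w0) by ring.
  have one1 : 0 <= (1 : R) <= 1 by rewrite ler01 lexx.
  have b1 (a : R) l : a <= rho -> a <= rho * 1 ^+ l by rewrite expr1n mulr1.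
  have h := Hk 1 (normc (z - z0)) z w0 z0 w0 one1 (normc_ge0 _)
    (b1 _ _ zr') (b1 _ _ (ltW wr)) (b1 _ _ (ltW zr)) (b1 _ _ (ltW wr)).
  rewrite !expr1n !mulr1 lexx subrr normc0 normc_ge0 in h.
  have {}h := h isT isT.
  apply: le_lt_trans (normcD _ _) _; rewrite normcN normcN normcM normc_i mul1r.
  rewrite ltr_pdivlMr // in hz3; rewrite ltr_pdivlMr // in hy.
  have n1 := normc_ge0 (z - z0); have n2 := normc_ge0 (y - (w0 - 'i * Q z0 w0)).
  have k1 : 0 <= k * normc (y - (w0 - 'i * Q z0 w0)) by rewrite mulr_ge0.
  move: h hz3 hy k1 n1 n2.
  move: (normc (Q _ _ - _)) (normc (z - z0)) (normc (y - _)) => a1 a2 a3.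
  move=> h hz3 hy k1 n1 n2.
  lra.
have [w hw wE] := perturbed_identity_onto cT e'0 lipT close.
exists (z, w); split => //=.
- apply: Hd => /=; first exact: lt_le_trans hz1 e'd.
  exact: lt_le_trans hw e'd.
- by rewrite /shear /= wE.
- by apply: inr; move: hw e'0; lra.
- exact: lt_le_trans hz1 e'e.
- exact: lt_le_trans hw e'e.
Qed.

End Shear.

Section ShearInverse.
Variables (R : realType) (wz wu m : nat).
Let C := Cx R.
Variables (Q Gz Gw : C -> C -> C) (rho : R).
Hypothesis pQ : wpol wz wu m Q.
Hypothesis dQ : pairdiff Q Gz Gw.
Hypothesis rho0 : 0 < rho.
Hypothesis lipQ : forall z w w', normc z <= rho -> normc w <= rho -> normc w' <= rho ->
  normc (Q z w - Q z w') <= normc (w - w') / 16.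
Hypothesis smallGw : forall z w, normc z <= rho -> normc w <= rho -> normc (Gw z w) <= 2^-1.
Variable B : set (C2 R).
Hypothesis oB : open B.
Hypothesis Brho : forall b, B b -> normc b.1 < rho /\ normc b.2 < rho.

Lemma shear_open : open (shear Q @` B).
Proof.
apply/open_C2 => _ [b0 Bb0 <-]; apply/nbhs_C2.
have [zr wr] := Brho Bb0.
have [d d0 Hd] := shear_local pQ rho0 lipQ oB Bb0 zr wr ltr01.
exists d => // y h1 h2; have [b [Bb bE _ _ _]] := Hd y h1 h2.
by exists b.
Qed.

(** The differential of the inverse of the shear, lower triangular in (z, w). *)
Definition affine_lower (a k : C) (e : C2 R) : C2 R := (e.1, a * e.1 + k * e.2).

Lemma affine_lower_diff a k x : is_diff x (affine_lower a k) (affine_lower a k).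
Proof.
have h1 : is_diff x (fst : C2 R -> C) fst.
  apply: DiffDef; first by apply: linear_differentiable => y; exact: cvg_fst.
  by apply: diff_lin => y; exact: cvg_fst.
have h2 : is_diff x (snd : C2 R -> C) snd.
  apply: DiffDef; first by apply: linear_differentiable => y; exact: cvg_snd.
  by apply: diff_lin => y; exact: cvg_snd.
exact: is_diff_pair h1 (is_diffD (is_diffZ a h1) (is_diffZ k h2)).
Qed.

(** The remainder of the expansion of Q, in terms of the increment of the image
instead of that of the preimage. *)
Lemma inverse_arith (e1 K1 H n1 n2 h2 r : R) : 0 <= e1 <= 4^-1 -> 0 <= K1 ->
  0 <= H -> 0 <= n1 -> 0 <= n2 -> n1 <= H -> h2 <= H ->
  r <= e1 * (n1 + n2) -> n2 <= 2 * (h2 + K1 * n1 + r) ->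
  2 * r <= 2 * e1 * (6 + 4 * K1) * H.
Proof.
move=> /andP[e10 e14] K10 H0 n10 n20 n1H h2H hr hn2.
have k1 : K1 * n1 <= K1 * H by rewrite ler_wpM2l.
have k2 : e1 * (n1 + n2) <= 4^-1 * (n1 + n2) by rewrite ler_wpM2r // addr_ge0.
have k3 : 0 <= K1 * H by rewrite mulr_ge0.
have n2H : n2 <= 5 * H + 4 * (K1 * H) by lra.
have k4 : e1 * (n1 + n2) <= e1 * (6 * H + 4 * (K1 * H)) by rewrite ler_wpM2l //; lra.
have -> : 2 * e1 * (6 + 4 * K1) * H = 2 * (e1 * (6 * H + 4 * (K1 * H))) by ring.
lra.
Qed.

(** The differential of the inverse is obtained by solving the linearized
equation for the increment of w, which is possible because 1 - i Gw is bounded below. *)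
Lemma shear_inverse_diff G : (forall b, B b -> G (shear Q b) = b) ->
  forall y, (shear Q @` B) y -> differentiable G y.
Proof.
move=> GK _ [b0 Bb0 <-]; have [zr wr] := Brho Bb0.
pose gz := Gz b0.1 b0.2; pose gw := Gw b0.1 b0.2.
pose D := 1 - 'i * gw.
have gw2 : normc gw <= 2^-1 by apply: smallGw; exact: ltW.
have nD : 2^-1 <= normc D.
  have : normc (1 : C) <= normc D + normc ('i * gw).
    have {1}-> : (1 : C) = D + 'i * gw by rewrite subrK.
    exact: normcD.
  by rewrite normcM normc_i mul1r normc1; move: gw2; lra.
have D0 : D != 0.
  apply/eqP => D0; move: nD; rewrite D0 normc0 leNgt => /negP; apply.
  by rewrite invr_gt0.
have nDV : normc D^-1 <= 2.
  by rewrite normcV -[leRHS]invrK lef_pV2 // posrE ?invr_gt0 // (lt_le_trans _ nD) // invr_gt0.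
(* solve h.2 = D e.2 - i gz e.1 for e.2, with e.1 = h.1 *)
pose a := D^-1 * ('i * gz); pose k := D^-1.
have [dl lE] := affine_lower_diff a k 0.
apply: (@differentiable_eps _ _ _ G ('d (affine_lower a k) 0)).
  exact: diff_continuous.
move=> _ /gt0_real[e e0 ->].
pose K1 := normc gz.
have K10 : 0 <= K1 by exact: normc_ge0.
have K60 : 0 < 2 * (6 + 4 * K1) by rewrite mulr_gt0 // ltr_wpDr // mulr_ge0.
pose e1 := Num.min (4^-1) (e / (2 * (6 + 4 * K1))).
have e10 : 0 < e1 by rewrite lt_min invr_gt0 divr_gt0 ?ltr0n.
have e14 : e1 <= 4^-1 by rewrite ge_min lexx.
have e1e : 2 * e1 * (6 + 4 * K1) <= e.
  by rewrite mulrAC mulrC -ler_pdivlMr // ge_min lexx orbT.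
have [dQ1 dQE] := dQ b0.
have e1C : 0 < (e1%:C : C) by rewrite ltC_real.
have [d1 d10 Hd1] := (nbhs_C2 _ _).1 (eps_differentiable dQ1 e1C).
have [d2 d20 Hd2] := shear_local pQ rho0 lipQ oB Bb0 zr wr d10.
apply/nbhs_C2; exists d2 => // h; rewrite /= !subr0 => h1 h2.
have [b [Bb bE _ b1 b2]] : exists b, [/\ B b, shear Q b = h + shear Q b0, normc b.2 <= rho,
    normc (b.1 - b0.1) < d1 & normc (b.2 - b0.2) < d1].
  by apply: Hd2; rewrite /= addrK.
rewrite -bE !GK // lE.
have hE1 : h.1 = b.1 - b0.1.
  by have := congr1 fst bE; rewrite /= => ->; rewrite addrK.
have hE2 : h.2 = (b.2 - b0.2) - 'i * (Q b.1 b.2 - Q b0.1 b0.2).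
  have := congr1 snd bE; rewrite /= => E.
  have -> : h.2 = (h.2 + (b0.2 - 'i * Q b0.1 b0.2)) - (b0.2 - 'i * Q b0.1 b0.2) by rewrite addrK.
  rewrite -E; ring.
pose rem := Q b.1 b.2 - Q b0.1 b0.2 - (gz * (b.1 - b0.1) + gw * (b.2 - b0.2)).
have remE : normc rem <= e1 * (normc (b.1 - b0.1) + normc (b.2 - b0.2)).
  have hrem := Hd1 (b - b0); rewrite /= !subr0 in hrem; have {hrem} := hrem b1 b2.
  rewrite dQE.
  have remE' : rem = Q (b - b0 + b0).1 (b - b0 + b0).2 - (Q b0.1 b0.2 +
      (Gz b0.1 b0.2 * (b - b0).1 + Gw b0.1 b0.2 * (b - b0).2)).
    by rewrite subrK opprD addrA.
  rewrite -[X in `|X| <= _ -> _]/(Q (b - b0 + b0).1 (b - b0 + b0).2 - (Q b0.1 b0.2 +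
      (Gz b0.1 b0.2 * (b - b0).1 + Gw b0.1 b0.2 * (b - b0).2))) -remE'.
  rewrite norm_normc => hrem; rewrite -leC_real; apply: le_trans hrem _.
  rewrite [leRHS]rmorphM /= ler_wpM2l ?(ltW e1C) //.
  by apply: norm_C2_le; rewrite ?lerDl ?lerDr normc_ge0.
have errE : (b.2 - b0.2) - (a * h.1 + k * h.2) = k * ('i * rem).
  have DE : b.2 - b0.2 = k * (D * (b.2 - b0.2)) by rewrite /k mulKf.
  rewrite {1}DE hE2 hE1 /a -/k /D /rem; ring.
have n2E : normc (b.2 - b0.2) <= 2 * (normc h.2 + K1 * normc (b.1 - b0.1) + normc rem).
  have -> : b.2 - b0.2 = k * (h.2 + 'i * gz * (b.1 - b0.1) + 'i * rem).
    have DE : b.2 - b0.2 = k * (D * (b.2 - b0.2)) by rewrite /k mulKf.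
    rewrite {1}DE; congr (_ * _); rewrite hE2 /D /rem; ring.
  rewrite normcM ler_pM ?normc_ge0 //.
  apply: le_trans (normcD _ _) _; rewrite [normc ('i * rem)]normcM normc_i mul1r lerD2r.
  apply: le_trans (normcD _ _) _; rewrite lerD2l normcM [normc ('i * gz)]normcM normc_i mul1r.
  exact: lexx.
have [H H0 HE] := norm_C2_real h.
have [hH1 hH2] := norm_C2_ge h; rewrite HE !leC_real in hH1 hH2.
rewrite HE -[leRHS]rmorphM.
have -> : b - (b0 + affine_lower a k h) = (0, k * ('i * rem)) :> C2 R.
  rewrite -errE -[LHS]/((b.1 - (b0.1 + h.1),
    b.2 - (b0.2 + (a * h.1 + k * h.2))) : C2 R).
  by rewrite {1}hE1 [b0.1 + _]addrC subrK subrr opprD addrA.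
apply: norm_C2_le; first by rewrite [normc _]normc0 mulr_ge0 // ltW.
rewrite -[X in normc X]/(k * ('i * rem)) !normcM normc_i mul1r.
have n10 := normc_ge0 (b.1 - b0.1); have n20 := normc_ge0 (b.2 - b0.2).
have n1H : normc (b.1 - b0.1) <= H by rewrite -hE1.
have e11 : 0 <= e1 <= 4^-1 by rewrite ltW.
have := inverse_arith e11 K10 H0 n10 n20 n1H hH2 remE n2E.
move=> fin; apply: le_trans (_ : 2 * normc rem <= _).
  by rewrite ler_wpM2r ?normc_ge0.
by apply: le_trans fin _; rewrite ler_wpM2r.
Qed.

End ShearInverse.

(** * Integer weights and the weight of u *)

Section WeightOfU.
Variables (R : realType) (wz wu n : nat).
Hypotheses (wz0 : (0 < wz)%N) (wzn : (wz < n)%N).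
Variable f : R3 R -> R.
Hypothesis pf : poly3 f.
Hypothesis dilf : forall s a, f (dil wz wu s a) = s ^+ (n + n) * f a.

Lemma hess_axis a : hess f a 1 0 = 'D_(ex R) ('D_(ex R) f) a.
Proof.
have L (a1 a2 a3 a4 : R) : a1 * 1 ^+ 2 + (a2 + a3) * (1 * 0) + a4 * 0 ^+ 2 = a1.
  by rewrite expr1n expr0n /= !mulr0 !addr0 mulr1.
exact: L.
Qed.

(** Here x, z, y are the values of phi at 1, 0, -1, and c and d the slopes given
by the mean value theorem. *)
Lemma no_affine_positive (x y z c d : R) : z = 0 -> c = d -> 0 < x -> 0 < y ->
  x - z = c * (1 - 0) -> z - y = d * (0 - -1) -> False.
Proof. by move=> -> ->; lra. Qed.

(** Let phi(u) be the second derivative of f in x at (0, 0, u).  If wu >= n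
then the second derivative of phi would be homogeneous of negative weight, hence zero
since it is continuous; so phi is affine.  But phi(0) = 0 because wz < n, and an affine
function that vanishes at 0 is not positive at both 1 and -1. *)
Lemma hess_axis_pos_weight :
  0 < hess f (pt3 0 0 1) 1 0 -> 0 < hess f (pt3 0 0 (- 1)) 1 0 -> (wu < n)%N.
Proof.
rewrite !hess_axis => pos neg; rewrite ltnNge; apply/negP => nwu.
have wu0 : (0 < wu)%N by apply: leq_trans nwu; apply: leq_ltn_trans wzn.
have axx : ex R \in axes R by rewrite !inE eqxx.
have axu : eu R \in axes R by rewrite !inE eqxx !orbT.
have [hx hy hu] := dir_weightE R wz wu.
pose g := 'D_(ex R) ('D_(ex R) f).
have pg : poly3 g by do 2 apply: poly3_derive.
pose vs := [:: eu R; eu R; ex R; ex R].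
have vsax : all (mem (axes R)) vs by rewrite /= axu axx.
have ow : order_weight wz wu vs = (n + n + (wu + wu + (wz + wz) - (n + n)))%N.
  by rewrite /order_weight !big_cons big_nil hx hu; lia.
set r := (wu + wu + (wz + wz) - (n + n))%N in ow.
have r0 : (0 < r)%N by rewrite /r; lia.
(* the weighted order of g2 is (n + n) - (wu + wu + wz + wz) = - r < 0 *)
pose g2 := 'D_(eu R) ('D_(eu R) g).
have pg2 : poly3 g2 by do 2 apply: poly3_derive.
have g2dil s t : s != 0 -> g2 (pt3 0 0 t) = s ^+ r * g2 (pt3 0 0 (s ^+ wu * t)).
  move=> s0; have H := iterD_dil vsax s0 pf (dilf s) (pt3 0 0 t).
  have E : dil wz wu s (pt3 0 0 t) = pt3 0 0 (s ^+ wu * t) by rewrite /dil /= mulr0.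
  have L (x y : R) : y = s ^+ (n + n) / s ^+ (n + n + r) * x -> x = s ^+ r * y.
    move=> ->; rewrite [s ^+ (n + n + r)]exprD; field.
    by rewrite !expf_neq0.
  by apply: L; rewrite -ow -E; exact: H.
(* g2 (0, 0, t) is s ^+ r times a value near g2 0; let s tend to 0 *)
have g20 t : g2 (pt3 0 0 t) = 0.
  have : {for 0, continuous g2}.
    exact: differentiable_continuous (poly3_differentiable pg2 0).
  move=> /cvgrPdist_lt /(_ 1 ltr01) /nbhs0_pt3[d d0 Hd].
  pose M := `|g2 0| + 1.
  have M0 : 0 < M by rewrite ltr_wpDl.
  have bnd s : 0 < s -> s <= 1 -> s * (`|t| + 1) < d -> `|g2 (pt3 0 0 t)| <= s * M.
    move=> s0 s1 sd; rewrite (g2dil s) ?gt_eqF // normrM ger0_norm ?exprn_ge0 ?(ltW s0) //.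
    have s01 : 0 <= s <= 1 by rewrite ltW.
    apply: ler_pM; rewrite ?exprn_ge0 ?(ltW s0) //.
      by have := expr_le_le1 s01 r0; rewrite expr1.
    have td : `|s ^+ wu * t| < d.
      rewrite normrM ger0_norm ?exprn_ge0 ?(ltW s0) //; apply: le_lt_trans sd.
      apply: ler_pM; rewrite ?exprn_ge0 ?(ltW s0) ?lerDl //.
      by have := expr_le_le1 s01 wu0; rewrite expr1.
    have z0 : `|0 : R| < d by rewrite normr0.
    have := Hd _ _ _ z0 z0 td; rewrite /M; move: (g2 (pt3 _ _ _)) (g2 0) => a b h.
    rewrite -(subrK b a) addrC; apply: le_trans (ler_normD _ _) _.
    by rewrite lerD2l distrC ltW.
  apply/eqP; rewrite -normr_eq0 eq_le normr_ge0 andbT; apply/ler_addgt0Pr => e e0.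
  rewrite add0r.
  have T0 : 0 < `|t| + 1 by rewrite ltr_wpDl.
  pose s := Num.min 1 (Num.min (d / (`|t| + 1) / 2) (e / M)).
  have s0 : 0 < s by rewrite !lt_min ltr01 !divr_gt0.
  have s1 : s <= 1 by rewrite ge_min lexx.
  have sd : s <= d / (`|t| + 1) / 2 by rewrite !ge_min lexx !orbT.
  have se : s <= e / M by rewrite !ge_min lexx !orbT.
  rewrite ler_pdivlMr // in se; apply: le_trans se; apply: bnd => //.
  rewrite ler_pdivlMr // ler_pdivlMr // in sd.
  by apply: lt_le_trans sd; rewrite ltr_pM2r // ltr_pMr // ltr1n.
have g0 : g (pt3 0 0 0) = 0.
  have vsax' : all (mem (axes R)) [:: ex R; ex R] by rewrite /= axx.
  apply: (iterD_dil0 vsax' pf dilf).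
  by rewrite /order_weight !big_cons big_nil hx; lia.
have line (k : R3 R -> R) (t : R) : poly3 k -> is_derive t 1 (fun s => k (pt3 0 0 s)) ('D_(eu R) k (pt3 0 0 t)).
  move=> pk.
  have H := @is_derive_path R k (cst 0) (cst 0) id t 0 0 1 (poly3_differentiable pk _)
    (is_derive_cst _ _ _) (is_derive_cst _ _ _) (is_derive_id _ _).
  apply: is_derive_ext H => //.
  have L (a b c : R) : a * 0 + b * 0 + c * 1 = c by rewrite !mulr0 !add0r mulr1.
  exact: L.
pose g1 t := 'D_(eu R) g (pt3 0 0 t).
have [|c1 /andP[c10 _] E1] := @mean_value R (fun s => g (pt3 0 0 s)) g1 0 1 ltr01.
  by move=> t _; exact: line.
have m10 : (-1 : R) < 0 by rewrite ltrN10.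
have [|c2 /andP[_ c20] E2] := @mean_value R (fun s => g (pt3 0 0 s)) g1 (-1) 0 m10.
  by move=> t _; exact: line.
have c12 : c2 < c1 by apply: lt_trans c10.
have [|c3 _ E3] := @mean_value R g1 (fun t => g2 (pt3 0 0 t)) c2 c1 c12.
  by move=> t _; apply: line; exact: poly3_derive.
have {}E3 : g1 c1 = g1 c2 by apply/eqP; rewrite -subr_eq0 E3 g20 mul0r.
exact: no_affine_positive g0 E3 pos neg E1 E2.
Qed.

End WeightOfU.

Section Weights.
Variables (R : realType) (k : nat) (mu : rat).
Hypotheses (k2 : (2 < k)%N) (mu0 : 0 < mu).

Let a := `|numq mu|%N.
Let b := `|denq mu|%N.
(** The weights 1/k, mu and 1/2 multiplied by 2 k b, where mu = a / b: this makes
[wtz], [wtu] and [wtn] integers. *)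
Definition wtz : nat := (2 * b)%N.
Definition wtu : nat := (2 * k * a)%N.
Definition wtn : nat := (k * b)%N.

(** Rational weights are integral weights divided by the total n + n. *)
Lemma weight_nat m l : weight k%:R^-1 mu m l =
  (m * wtz + l * wtu)%:R / (wtn + wtn)%:R.
Proof.
have b0 : (b%:R : rat) != 0 by rewrite pnatr_eq0 absz_eq0 denq_eq0.
have k0 : (k%:R : rat) != 0 by rewrite pnatr_eq0; case: (k) k2.
have muE : mu = a%:R / b%:R.
  rewrite -[LHS]divq_num_den /a /b; congr (_ / _).
    by rewrite -[in LHS](gez0_abs (m := numq mu)) ?numq_ge0 ?ltW.
  by rewrite -[in LHS](gez0_abs (m := denq mu)) ?denq_ge0.
rewrite /weight muE /wtz /wtu /wtn !natrD !natrM; field.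
by rewrite b0 k0 !andbT -mulr2n mulrn_eq0 mulf_neq0.
Qed.

Lemma wtn_gt0 : ((0 : rat) < (wtn + wtn)%:R).
Proof.
rewrite ltr0n addn_gt0 muln_gt0 absz_gt0 denq_eq0 andbT orbb.
by apply: ltn_trans k2.
Qed.

Lemma weight_eq1 m l : weight k%:R^-1 mu m l = 1 -> (m * wtz + l * wtu)%N = (wtn + wtn)%N.
Proof.
rewrite weight_nat => /divr1_eq /eqP; rewrite eqr_nat => /eqP; exact.
Qed.

Lemma weight_le1 m l : (m * wtz + l * wtu <= wtn + wtn)%N -> weight k%:R^-1 mu m l <= 1.
Proof. by move=> h; rewrite weight_nat ler_pdivrMr ?wtn_gt0 // mul1r ler_nat. Qed.

Lemma wtz_gt0 : (0 < wtz)%N.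
Proof. by rewrite muln_gt0 absz_gt0 denq_eq0. Qed.

Lemma wtu_gt0 : (0 < wtu)%N.
Proof.
rewrite !muln_gt0 absz_gt0 numq_eq0 (gt_eqF mu0) andbT /=.
by apply: ltn_trans k2.
Qed.

Lemma wtz_lt : (wtz < wtn)%N.
Proof. by rewrite ltn_mul2r k2 andbT absz_gt0 denq_eq0. Qed.

End Weights.

(** * A small box in which the domain is convex *)

Section SmallBox.
Variable R : realType.
Let C := Cx R.

Lemma box_normc (eta rho : R) (z w : C) : 0 < eta -> 4 * eta <= rho -> box eta z w ->
  normc z < rho /\ normc w < rho.
Proof.
move=> e0 er [a1 a2 a3 a4]; split.
  apply: le_lt_trans (normc_ReIm z) _; apply: lt_trans (ltrD a1 a2) _.
  by move: e0 er; lra.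
apply: le_lt_trans (normc_ReIm w) _; apply: lt_trans (ltrD a3 a4) _.
by move: e0 er; lra.
Qed.

Lemma wpol_small wz wu m (g : C -> C -> C) (e : R) : (0 < m)%N -> wpol wz wu m g ->
  0 < e -> exists2 rho : R, 0 < rho & forall z w,
    normc z <= rho -> normc w <= rho -> normc (g z w) <= e.
Proof.
move=> m0 pg e0; have [c c0 Hc] := wpol_bound pg ler01.
have [s s0 [s1 cs]] : exists2 s : R, 0 < s & s <= 1 /\ c * s <= e.
  exists (Num.min 1 (e / (c + 1))); first by rewrite lt_min ltr01 divr_gt0 // ltr_wpDl.
  split; first by rewrite ge_min lexx.
  apply: le_trans (_ : (c + 1) * (e / (c + 1)) <= _).
    rewrite ler_pM // ?lerDl ?ge_min ?lexx ?orbT //.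
    by rewrite le_min ler01 divr_ge0 ?ltW // ltr_wpDl.
  by rewrite mulrC divfK // gt_eqF // ltr_wpDl.
have s01 : 0 <= s <= 1 by rewrite ltW.
exists (Num.min (s ^+ wz) (s ^+ wu)); first by rewrite lt_min !exprn_gt0.
move=> z w; rewrite !le_min => /andP[z1 _] /andP[_ w1].
apply: le_trans (Hc s z w s01 _ _) _; rewrite ?mul1r //.
apply: le_trans cs; rewrite ler_wpM2l //.
by have := expr_le_le1 s01 m0; rewrite expr1.
Qed.

End SmallBox.

Section SmallConvexBox.
Variables (R : realType) (wz wu n : nat).
Let C := Cx R.
Hypotheses (wz0 : (0 < wz)%N) (wu0 : (0 < wu)%N) (wzn : (wz < n)%N) (wun : (wu < n)%N).
Variables (F P h : R3 R -> R) (A : set (R3 R)).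
Hypotheses (oA : open A) (A0 : A 0) (sF : smooth_on A F).
Hypotheses (pP : poly3 P) (ph : poly3 h).
Hypotheses (fF : flat wz wu (n + n) F)
  (fE : flat wz wu (n + n).+1 (fun a => F a - P a)).
Hypothesis dilPh : forall s a,
  P (dil wz wu s a) + h (dil wz wu s a) = s ^+ (n + n) * (P a + h a).
Hypothesis hessPh : forall x y u p r : R, x ^+ 2 + y ^+ 2 + u ^+ 2 = 1 ->
  p ^+ 2 + r ^+ 2 = 1 -> 0 < hess (fun a => P a + h a) (pt3 x y u) p r.
Variable q : C -> C -> C.
Hypothesis pq : wpol wz wu (n + n) q.
Hypothesis hE : forall x y u : R, h (pt3 x y u) = complex.Re (q (x +i* y) u%:C).

Lemma flat_grad v : v \in axes R -> 'D_v F 0 = 0.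
Proof.
have [hx hy hu] := dir_weightE R wz wu.
have wz2 : (wz < n + n)%N by apply: leq_trans wzn _; exact: leq_addr.
have wu2 : (wu < n + n)%N by apply: leq_trans wun _; exact: leq_addr.
move=> vax; apply: (fF (vs := [:: v])); first by rewrite /= vax.
rewrite /order_weight big_cons big_nil.
by move: vax; rewrite !inE => /or3P[/eqP->|/eqP->|/eqP->]; rewrite ?hx ?hy ?hu addn0.
Qed.

(** The radius rho is chosen small enough for all the local statements, and
eta = rho / 4.  That rr decreases with v, and is negative for v >= eta / 2 in the box,
follows from small Lipschitz constants of F and Q. *)
Lemma small_convex_box (r : R) : 0 < r ->
  exists rho eta : R, exists Gz Gw : C -> C -> C,
  [/\ [/\ 0 < rho, rho <= r, 0 < eta & 4 * eta <= rho],
      pairdiff (Qfun q) Gz Gw,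
      forall z w, normc z <= rho -> normc w <= rho ->
        normc (Qfun q z w) <= (normc z + normc w) / 16 /\ normc (Gw z w) <= 2^-1,
      forall z w w', normc z <= rho -> normc w <= rho -> normc w' <= rho ->
        normc (Qfun q z w - Qfun q z w') <= normc (w - w') / 16
    & forall z0 w0 z1 w1 t, box eta z0 w0 -> box eta z1 w1 ->
        rr F q z0 w0 < 0 -> rr F q z1 w1 < 0 -> 0 <= t <= 1 ->
        rr F q (z0 + t%:C * (z1 - z0)) (w0 + t%:C * (w1 - w0)) < 0].
Proof.
move=> r0.
have [c c0 Hc] := hess_pos_compact (poly3_add pP ph) hessPh.
have [gz [gw [pgz pgw dq _]]] := wpol_derive pq.
have [gzz [gzw [pgzz pgzw dgz _]]] := wpol_derive pgz.
have [gwz [gww [pgwz pgww dgw _]]] := wpol_derive pgw.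
have pQ := Qfun_wpol wz0 wu0 wzn wun pq.
have [Gz [Gw [_ pGw _ dQ]]] := wpol_derive pQ.
rewrite addnK in pGw.
have half0 : (0 : R) < 2^-1 by rewrite invr_gt0.
have [r1 r10 H1] := wpol_small wu0 pGw half0.
have [r2 r20 H2] := Qfun_small wz0 wu0 wzn wun pq.
have [r3 r30 H3] := strongly_convex_points wz0 wu0 wzn wun oA A0 sF pP ph fF fE dilPh
  c0 Hc pq pgz pgw pgzz pgzw pgwz pgww dq dgz hE.
have [r4 r40 H4] := base_eq0 wz0 wu0 wzn wun fF c0 pq.
have e16 : (0 : R) < 16^-1 by rewrite invr_gt0.
have [r5 r50 H5] := small_lipschitz oA A0 sF flat_grad e16.
have Ho := origin_values wz0 wu0 wzn wun fF c0 pq pgz pgw pgzz pgzw pgwz pgww.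
have F0 : F 0 = 0.
  apply: (fF (vs := [::])) => //; rewrite /order_weight big_nil addn_gt0.
  by rewrite (leq_ltn_trans (leq0n _) wzn).
have [rho [rho0 h0 h1 h2 [h3 h4 h5]]] : exists rho, [/\ 0 < rho, rho <= r, rho <= r1,
    rho <= r2 & [/\ rho <= r3, rho <= r4 & 2 * rho < r5]].
  exists (Num.min (Num.min (Num.min r r1) (Num.min r2 r3)) (Num.min r4 (r5 / 4))).
  split; rewrite ?lt_min ?r0 ?r10 ?r20 ?r30 ?r40 ?divr_gt0 ?ge_min ?lexx ?orbT //.
  split; rewrite ?ge_min ?lexx ?orbT //.
  apply: le_lt_trans (_ : 2 * (r5 / 4) < _).
    by rewrite ler_pM2l // !ge_min lexx !orbT.
  by move: r50; lra.
have QS z w : normc z <= rho -> normc w <= rho ->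
    normc (Qfun q z w) <= (normc z + normc w) / 16.
  by move=> hz hw; have [] := H2 z w (le_trans hz h2) (le_trans hw h2).
have QL z w w' : normc z <= rho -> normc w <= rho -> normc w' <= rho ->
    normc (Qfun q z w - Qfun q z w') <= normc (w - w') / 16.
  move=> hz hw hw'; have [_] := H2 z w (le_trans hz h2) (le_trans hw h2).
  by apply; exact: le_trans hw' h2.
have small z w : normc z <= rho -> normc w <= rho ->
    [/\ `|complex.Re z| < r5, `|complex.Im z| < r5 & `|Upath q z w| < r5].
  move=> hz hw; have hQ := QS z w hz hw.
  have k1 := Re_normc z; have k2 := Im_normc z; have k3 := Re_normc w.
  have k4 := Im_normc (Qfun q z w).
  split; [by move: k1 hz h5 rho0; lra|by move: k2 hz h5 rho0; lra|].
  apply: le_lt_trans (ler_normD _ _) _.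
  by move: k3 k4 hQ hz hw h5 rho0; lra.
have base_small z w : normc z <= rho -> normc w <= rho -> A (base q z w).
  by move=> hz hw; have [k1 k2 k3] := small z w hz hw; have [] := H5 _ _ _ k1 k2 k3.
exists rho, (rho / 4), Gz, Gw; split => //.
- by split => //; [rewrite divr_gt0|rewrite mulrC divfK ?lexx // pnatr_eq0].
- move=> z w hz hw; split; first exact: QS.
  by apply: H1; [exact: le_trans hz h1|exact: le_trans hw h1].
move=> z0 w0 z1 w1 t.
have eta0 : 0 < rho / 4 by rewrite divr_gt0.
have eta4 : 4 * (rho / 4) <= rho by rewrite mulrC divfK ?lexx // pnatr_eq0.
apply: (@segment_negative R wz wu (n + n) F A sF q gz gw gzz gzw gwz gww pq dq dgz dgw
  rho base_small _ _ _ _ (rho / 4) eta0 eta4).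
- move=> z w hz hw; apply: H3; [exact: le_trans hz h3|exact: le_trans hw h3].
- by move=> zeta om; have [] := Ho zeta om.
- move=> z w hz hw; apply: H4; [exact: le_trans hz h4|exact: le_trans hw h4].
- move=> z w s hz hw hws s0.
  have [k1 k2 k3] := small z w hz hw.
  have [_ _ k3'] := small z _ hz hws.
  have [_ /(_ _ _ _ k1 k2 k3')] := H5 _ _ _ k1 k2 k3.
  rewrite !subrr normr0 !add0r.
  have := QL z w _ hz hw hws.
  have -> : normc (w - (w + (0 +i* s))) = s.
    by rewrite opprD addrA subrr sub0r normcN /= expr0n add0r sqrtr_sqr gtr0_norm.
  rewrite /rr /base Im_add /=.
  have -> : Upath q z (w + (0 +i* s)) = complex.Re w + complex.Im (Qfun q z (w + (0 +i* s))).
    by rewrite /Upath Re_add /= addr0.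
  have KA (x a b : R) : x + a - (x + b) = a - b by rewrite opprD addrACA subrr add0r.
  rewrite /Upath KA => qd.
  have d1 := Re_normc (Qfun q z w - Qfun q z (w + (0 +i* s))).
  have d2 := Im_normc (Qfun q z w - Qfun q z (w + (0 +i* s))).
  have ReE (a b : C) : complex.Re (a - b) = complex.Re a - complex.Re b by case: a b => ? ? [].
  have ImE (a b : C) : complex.Im (a - b) = complex.Im a - complex.Im b by case: a b => ? ? [].
  rewrite ReE in d1; rewrite ImE in d2; move=> fd.
  have L (fa fb a b u v N y T : R) : N <= s / 16 -> `|a - b| <= N -> T <= N ->
      `|fa - fb| <= 16^-1 * T -> fb + b - (y + s) < fa + a - y.
    rewrite !ler_norml => g1 /andP[g2 g3] g4 /andP[g5 g6]; move: s0 g1 g2 g3 g4 g5 g6; lra.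
  exact: L qd d1 d2 fd.
- move=> z w x1 x2 x3 x4 hw.
  have hz : normc z <= rho.
    by apply: le_trans (normc_ReIm z) _; move: x1 x2 rho0; lra.
  have [k1 k2 k3] := small z w hz hw.
  have z0' : `|0 : R| < r5 by rewrite normr0.
  have [_ /(_ _ _ _ z0' z0' z0')] := H5 _ _ _ k1 k2 k3.
  rewrite !subr0 -[pt3 0 0 0]/(0 : R3 R) F0 subr0 => Fb.
  have hQ := QS z w hz hw.
  have q1 := Re_normc (Qfun q z w); have q2 := Im_normc (Qfun q z w).
  have nz := normc_ReIm z; have nw := normc_ReIm w.
  have Ub : `|Upath q z w| <= `|complex.Re w| + `|complex.Im (Qfun q z w)| by exact: ler_normD.
  have iw : `|complex.Im w| = complex.Im w by rewrite ger0_norm //; move: x4 rho0; lra.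
  have Fb' := ler_norm (F (base q z w)); have q1' := ler_norm (complex.Re (Qfun q z w)).
  rewrite iw in nw; rewrite /rr.
  have L (fa fab a ab nq U x y u v N M : R) : fa <= fab -> a <= ab -> ab <= nq ->
     fab <= 16^-1 * (x + y + U) -> U <= u + nq -> nq <= (N + M) / 16 -> N <= x + y ->
     M <= u + v -> x < rho / 4 / 16 -> y < rho / 4 / 16 -> u < rho / 4 / 16 ->
     rho / 4 / 2 <= v -> fa + a - v < 0.
    by move: rho0; lra.
  exact: (L _ _ _ _ _ _ _ _ _ _ _ _ Fb' q1' q1 Fb (le_trans Ub (lerD (lexx _) q2)) hQ nz nw).
Qed.

End SmallConvexBox.

(** * Convex coordinates from the shear *)

Section Box.
Variable R : realType.

Lemma box_open (eta : R) : open [set b : C2 R | box eta b.1 b.2].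
Proof.
have near (a b : Cx R) (c d : R) : normc (b - a) < d -> d <= c - `|complex.Re a| ->
    `|complex.Re b| < c.
  move=> h hd; have -> : complex.Re b = complex.Re a + complex.Re (b - a).
    by case: (a) (b) => ? ? [? ?] /=; rewrite addrC subrK.
  apply: le_lt_trans (ler_normD _ _) _; have := Re_normc (b - a).
  move: (`|complex.Re a|) (`|complex.Re (b - a)|) (normc _) h hd => A X N; lra.
have near' (a b : Cx R) (c d : R) : normc (b - a) < d -> d <= c - `|complex.Im a| ->
    `|complex.Im b| < c.
  move=> h hd; have -> : complex.Im b = complex.Im a + complex.Im (b - a).
    by case: (a) (b) => ? ? [? ?] /=; rewrite addrC subrK.
  apply: le_lt_trans (ler_normD _ _) _; have := Im_normc (b - a).
  move: (`|complex.Im a|) (`|complex.Im (b - a)|) (normc _) h hd => A X N; lra.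
apply/open_C2 => b [b1 b2 b3 b4]; apply/nbhs_C2.
exists (Num.min (Num.min (eta / 16 - `|complex.Re b.1|) (eta / 16 - `|complex.Im b.1|))
  (Num.min (eta / 16 - `|complex.Re b.2|) (eta - `|complex.Im b.2|))).
  by rewrite !lt_min !subr_gt0 b1 b2 b3 b4.
move=> r h1 h2; split.
- by apply: near h1 _; rewrite !ge_min lexx.
- by apply: near' h1 _; rewrite !ge_min lexx !orbT.
- by apply: near h2 _; rewrite !ge_min lexx !orbT.
- by apply: near' h2 _; rewrite !ge_min lexx !orbT.
Qed.

Lemma convex_combination (l x y : R) : x + (1 - l) * (y - x) = l * x + (1 - l) * y.
Proof. ring. Qed.

End Box.

Section Straightening.
Variables (R : realType) (wz wu m : nat).
Let C := Cx R.
Variables (D U : set (C2 R)) (p : C2 R) (Phi : C2 R -> C2 R) (F : R3 R -> R).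
Hypothesis graph : graph_coordinates D p U Phi F.
Variables (q Gz Gw : C -> C -> C) (rho eta : R).
Hypotheses (rho0 : 0 < rho) (eta0 : 0 < eta) (etarho : 4 * eta <= rho).
Hypothesis pQ : wpol wz wu m (Qfun q).
Hypothesis dQ : pairdiff (Qfun q) Gz Gw.
Hypothesis bQ : forall z w, normc z <= rho -> normc w <= rho ->
  normc (Qfun q z w) <= (normc z + normc w) / 16 /\ normc (Gw z w) <= 2^-1.
Hypothesis lipQ : forall z w w', normc z <= rho -> normc w <= rho -> normc w' <= rho ->
  normc (Qfun q z w - Qfun q z w') <= normc (w - w') / 16.
Hypothesis image : forall y : C2 R, normc y.1 <= rho -> normc y.2 <= 2 * rho ->
  (Phi @` U) y.
Hypothesis segment : forall z0 w0 z1 w1 t, box eta z0 w0 -> box eta z1 w1 ->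
  rr F q z0 w0 < 0 -> rr F q z1 w1 < 0 -> 0 <= t <= 1 ->
  rr F q (z0 + t%:C * (z1 - z0)) (w0 + t%:C * (w1 - w0)) < 0.

Notation S := (shear (Qfun q)).
Let B : set (C2 R) := [set b | box eta b.1 b.2].

Let Brho b : B b -> normc b.1 < rho /\ normc b.2 < rho.
Proof. exact: box_normc. Qed.

Lemma zu_shear b : zu (S b) = base q b.1 b.2 /\
  vv (S b) = complex.Im b.2 - complex.Re (Qfun q b.1 b.2).
Proof.
rewrite /zu /vv /base /Upath /=; case: (Qfun q b.1 b.2) => s t; case: b => [z [w1 w2]] /=.
have e1 : w1 - (0 * s - 1 * t) = w1 + t by ring.
have e2 : w2 - (0 * t + 1 * s) = w2 - s by ring.
by rewrite e1 e2.
Qed.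

Lemma shear_box_image b : B b -> (Phi @` U) (S b).
Proof.
move=> Bb; have [/ltW h1 /ltW h2] := Brho Bb; apply: image => //=.
apply: le_trans (normcD _ _) _; rewrite normcN normcM normc_i mul1r.
have [+ _] := bQ h1 h2; move: h1 h2 rho0.
move: (normc b.1) (normc b.2) (normc (Qfun _ _ _)) => x y z; lra.
Qed.

(** The new coordinates are the given ones followed by the inverse of the shear,
on the preimage of the sheared box.  Their image is the box, where D is rr < 0. *)
Theorem straightening : locally_convexifiable D p.
Proof.
case: graph => [[[Up [oU oPU dPhi [Psi [PsiK dPsi]]]] Phi0] _ _ DF _].
have oB : open B by exact: box_open.
have smallGw z w : normc z <= rho -> normc w <= rho -> normc (Gw z w) <= 2^-1.
  by move=> hz hw; have [] := bQ hz hw.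
(* the inverse of the shear on the box, by choice *)
pose G (y : C2 R) : C2 R := xget 0 [set b | B b /\ S b = y].
have GK b : B b -> G (S b) = b.
  move=> Bb; have [BG SG] : [set b' | B b' /\ S b' = S b] (G (S b)).
    by apply: (xgetPex 0); exists b.
  have [/ltW h1 /ltW h2] := Brho BG; have [_ /ltW h3] := Brho Bb.
  exact: shear_inj lipQ _ _ h1 h2 h3 SG.
have dG := shear_inverse_diff pQ dQ rho0 lipQ smallGw oB Brho GK.
have oSB := shear_open pQ rho0 lipQ oB Brho.
pose U' : set (C2 R) := [set x | U x /\ (S @` B) (Phi x)].
have U'B x : U' x -> exists2 b, B b & S b = Phi x /\ G (Phi x) = b.
  by move=> [_ [b Bb Sb]]; exists b => //; rewrite -Sb GK.
have BU' b : B b -> exists2 x, U' x & S b = Phi x /\ G (Phi x) = b.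
  move=> Bb; have [x Ux xE] := shear_box_image Bb.
  exists x; first by split => //; exists b.
  by rewrite xE GK.
have imU' : (G \o Phi) @` U' = B.
  apply/seteqP; split=> [_ [x /U'B[b Bb [_ bE]] <-]|b /BU'[x xU [_ xE]]].
    by rewrite /= bE.
  by exists x.
have oU' : open U'.
  apply/open_C2 => x [Ux Sx]; apply: filterI.
    by apply: (open_C2 _).1.
  apply: (differentiable_continuous (dPhi _ Ux)).
  exact: (open_C2 _).1.
have B00 : B 0 by rewrite /B /box /= !normr0 divr_gt0.
have S0 : S 0 = 0.
  have z0 : normc (0 : C) <= rho by rewrite normc0 ltW.
  have [+ _] := bQ z0 z0; rewrite normc0 addr0 mul0r => Q0.
  have {}Q0 : Qfun q 0 0 = 0.
    by apply: eq0_normc; apply/eqP; rewrite eq_le Q0 normc_ge0.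
  by rewrite /shear /= Q0 mulr0 subr0.
exists U', (G \o Phi); split.
  split; first by split => //; exists 0; rewrite ?S0 ?Phi0.
  split; rewrite ?imU' //.
    move=> x [Ux Sx]; apply: differentiable_comp; first exact: dPhi.
    exact: dG.
  exists (Psi \o S); split.
    by move=> x xU; have [b Bb [/= bE ->]] := U'B _ xU; rewrite bE PsiK //; case: xU.
  move=> b Bb; apply: differentiable_comp; first by have [] := shear_diff dQ b.
  exact/dPsi/shear_box_image.
have imP b : B b -> ((G \o Phi) @` (D `&` U')) b <-> rr F q b.1 b.2 < 0.
  move=> Bb; have [zE vE] := zu_shear b.
  have L : rr F q b.1 b.2 < 0 <-> F (zu (S b)) < vv (S b).
    by rewrite zE vE /rr subr_lt0 ltrBrDr.
  split=> [[x [Dx xU] /= xE]|/L neg].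
    have [b' Bb' [SE b'E]] := U'B _ xU; apply/L.
    have [Ux _] := xU.
    by rewrite -xE b'E SE; exact/DF.
  have [x xU [xE xE']] := BU' _ Bb; have [Ux _] := xU.
  by exists x => //; split => //; apply/DF => //; rewrite -xE.
have subB b : ((G \o Phi) @` (D `&` U')) b -> B b.
  by move=> [x [_ xU] <-]; rewrite -imU'; exists x.
move=> x y l; rewrite !inE => -[a aD <-] [b bD <-] {x y}.
have Ba := subB _ aD; have Bb := subB _ bD.
pose t : R := 1 - l%:num.
have t01 : 0 <= t <= 1.
  by rewrite subr_ge0 gerBl; apply/andP.
pose c : C2 R := (a.1 + t%:C * (b.1 - a.1), a.2 + t%:C * (b.2 - a.2)).
have Bc : B c := box_segment Ba Bb t01.
exists c.
  apply/imP => //; apply: segment => //; exact/imP.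
have [c1 c2] := Re_segment a.1 b.1 t; have [c3 c4] := Re_segment a.2 b.2 t.
rewrite /real_of_cplx c1 c2 c3 c4.
by rewrite /t !convex_combination.
Qed.

End Straightening.

(** * Local convexifiability *)

Section Model.
Variables (R : realType) (k : nat).
Hypothesis k2 : (2 < k)%N.

Lemma weight0_eq1 m l : weight k%:R^-1 0 m l = 1 -> (m * 2 + l * 0)%N = (k + k)%N.
Proof.
have k0 : (k%:R : rat) != 0 by rewrite pnatr_eq0; case: (k) k2.
rewrite /weight mulr0 addr0 => /divr1_eq /eqP; rewrite eqr_nat => /eqP ->.
by rewrite muln0 addn0 muln2 addnn.
Qed.

(** For mu = 0 the dilations fix the u-axis, while the Hessian is multiplied by
4 ^ (k - 2) under the dilation with s = 2. *)
Lemma mu0_not_positive (P h : R3 R -> R) :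
  homogeneous k%:R^-1 0 1 P -> homogeneous k%:R^-1 0 1 h ->
  hess (fun a => P a + h a) (pt3 0 0 1) 1 0 <= 0.
Proof.
move=> hP hh; rewrite leNgt; apply/negP => H0.
have pf := poly3_add (homogeneous_poly3 hP) (homogeneous_poly3 hh).
have two0 : (2 : R) != 0 by rewrite pnatr_eq0.
have dilf s a : P (dil 2 0 s a) + h (dil 2 0 s a) = s ^+ (k + k) * (P a + h a).
  by rewrite (homogeneous_dil weight0_eq1 hP) (homogeneous_dil weight0_eq1 hh) mulrDr.
have := hess_dil (pt3 0 0 1) 1 0 k2 pf two0 (dilf 2).
have -> : dil 2 0 2 (pt3 0 0 1 : R3 R) = pt3 0 0 1 by rewrite /dil /= !mulr0 mulr1.
have e1 : 1 < ((2 : R) ^+ (k - 2)) ^+ 2.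
  have e0 : ((k - 2) * 2 != 0)%N by rewrite muln_eq0 subn_eq0 leqNgt k2.
  by rewrite -exprM exprn_egt1 ?ltr1n.
move: (hess _ _ _ _) H0 (_ ^+ 2) e1 => x x0 c c1 E.
by move: c1; rewrite -(ltr_pMl _ x0) -E ltxx.
Qed.

Section PositiveWeight.
Variables (mu : rat) (D : set (C2 R)) (p : C2 R) (P h : R3 R -> R).
Hypothesis mu0 : 0 < mu.
Hypothesis model : model_coordinates D p k%:R^-1 mu P.
Hypothesis Hh : Hspace k mu h.
Hypothesis hessPh : forall x y u a b : R, x ^+ 2 + y ^+ 2 + u ^+ 2 = 1 ->
  a ^+ 2 + b ^+ 2 = 1 -> 0 < hess (fun a => P a + h a) (pt3 x y u) a b.

Lemma positive_weight_convexifiable : locally_convexifiable D p.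
Proof.
case: model Hh => U [Phi [F [graph hP oF]]] [hh lap].
have w1 := weight_eq1 k2 mu0; have wle := weight_le1 k2 mu0.
have pP := homogeneous_poly3 hP; have ph := homogeneous_poly3 hh.
have dilf s a : P (dil (wtz mu) (wtu k mu) s a) + h (dil (wtz mu) (wtu k mu) s a) =
    s ^+ (wtn k mu + wtn k mu) * (P a + h a).
  by rewrite (homogeneous_dil w1 hP) (homogeneous_dil w1 hh) mulrDr.
have wz0 := wtz_gt0 mu; have wzn := wtz_lt mu k2; have wu0 := wtu_gt0 k2 mu0.
have wun : (wtu k mu < wtn k mu)%N.
  apply: (hess_axis_pos_weight wz0 wzn (poly3_add pP ph) dilf); apply: hessPh;
  by rewrite ?sqrrN !expr0n !expr1n /= ?add0r ?addr0.
have [q pq hE] := harmonic_Re w1 hh lap.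
have [[[Up [oU oPU _ _]] Phi0] sF _ _ _] := graph.
have O0 : (Phi @` U) 0 by exists p.
have [d d0 Hd] := (nbhs_C2 _ _).1 ((open_C2 _).1 oPU _ O0).
have Hd' (y : C2 R) : Normc.normc y.1 < d -> Normc.normc y.2 < d -> (Phi @` U) y.
  by move=> h1 h2; apply: Hd; rewrite subr0.
(* F is smooth on the projection of the coordinate domain, which is a neighbourhood
   of 0 because the image of Phi is one *)
pose A : set (R3 R) := interior (@zu R @` (Phi @` U)).
have oA : open A by exact: open_interior.
have A0 : A 0.
  apply/nbhs_ballP; exists (d / 2) => /=; first by rewrite divr_gt0.
  case=> [[x y] u] /ball_pt3[hx hy hu].
  exists (x +i* y, u%:C)%C => //; apply: Hd'.
    apply: le_lt_trans (normc_ReIm _) _; move: hx hy => /=; lra.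
  by rewrite normc_real; move: hu d0; lra.
have {}sF : smooth_on A F by apply: smooth_onS sF; exact: interior_subset.
have fF := flat_defining w1 wle oA A0 sF hP oF.
have fE := flat_remainder wle oA A0 sF pP oF.
have d3 : 0 < d / 3 by rewrite divr_gt0.
have [rho [eta [Gz [Gw [[rho0 rhod eta0 etarho] dQ bQ lipQ seg]]]]] :=
  small_convex_box wz0 wu0 wzn wun oA A0 sF pP ph fF fE dilf hessPh pq hE d3.
apply: (straightening graph rho0 eta0 etarho (Qfun_wpol wz0 wu0 wzn wun pq) dQ bQ lipQ _ seg).
by move=> y h1 h2; apply: Hd'; move: h1 h2 rhod rho0 d0; lra.
Qed.

End PositiveWeight.
End Model.

Theorem propositionA (R : realType) (D : set (C2 R)) (p : C2 R) (k : nat)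
    (mu : rat) (P : R3 R -> R)
    (domD : domain D) (smoothD : smooth_boundary D) (pscD : pseudoconvex D)
    (bdp : bdry D p) (k_gt2 : (2 < k)%N) (typep : has_type D p k)
    (hmu : is_mu D p k mu) (modelP : generalized_model D p k mu P)
    (hH : exists h : R3 R -> R, Hspace k mu h /\
       forall (x y u : R) (xi : 'I_2 -> R),
         x ^+ 2 + y ^+ 2 + u ^+ 2 = 1 ->
         xi ord0 ^+ 2 + xi ord_max ^+ 2 = 1 ->
         0 < D2z (fun a => P a + h a) (pt3 x y u) xi) :
  locally_convexifiable D p.
Proof.
case: hH => h [Hh pos].
have hessPh x y u a b : x ^+ 2 + y ^+ 2 + u ^+ 2 = 1 -> a ^+ 2 + b ^+ 2 = 1 ->
    0 < hess (fun a => P a + h a) (pt3 x y u) a b.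
  move=> sph ab; have := pos x y u (fun i => if i == ord0 then a else b) sph.
  by rewrite D2z_hess /= => /(_ ab).
case: hmu modelP => [[_ [[mu0 _ _] _] _] [model _]|[mu0 _] [_ leading]].
  exact: (@positive_weight_convexifiable R k k_gt2 mu D p P h mu0 (model mu0) Hh hessPh).
have [U [Phi [F [_ [hP _] _]]]] := leading mu0.
case: Hh => hh _; rewrite mu0 in hh.
have := mu0_not_positive k_gt2 hP hh; rewrite leNgt => /negP; case.
by apply: hessPh; rewrite !expr0n !expr1n /= ?add0r ?addr0.
Qed.
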